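(* Let $a,b\in\widetilde{\mathbb R}$ with $a<b$, let $F\in\mathcal{GC}^\infty([a,b]\times\widetilde{\mathbb R}^d\times\widetilde{\mathbb R}^d,\widetilde{\mathbb R})$, let $I(u)=\int_a^bF(t,u,\dot u)\,dt$, and let $u\in\mathcal{GC}^\infty([a,b],\widetilde{\mathbb R}^d)$. Then $u$ solves the Euler-Lagrange equations $$F_u(t,u,\dot u)-\frac{d}{dt}F_{\dot u}(t,u,\dot u)=0\quad\text{on }[a,b]$$ if and only if $\delta I(u;\eta)=0$ for all $\eta\in\mathcal{GC}^\infty_0(a,b)$, i.e. if and only if $u$ is a critical point of $I$.
   Context: Generalized numbers. Let $I_0=(0,1]\subseteq\mathbb R$; ''for $\varepsilon$ small'' means for all $\varepsilon\in(0,\varepsilon_0]$ for some $\varepsilon_0\in I_0$. Fix a net $\rho=(\rho_\varepsilon)_{\varepsilon\in I_0}$ of reals with $\rho_\varepsilon\to0^+$ as $\varepsilon\to0^+$. A net $(x_\varepsilon)$ in $\mathbb R^n$ is moderate if $|x_\varepsilon|=O(\rho_\varepsilon^{-N})$ for some $N\in\mathbb R_{>0}$; $(x_\varepsilon)\sim(y_\varepsilon)$ if $|x_\varepsilon-y_\varepsilon|=O(\rho_\varepsilon^{N})$ for every $N\in\mathbb R_{>0}$. $\widetilde{\mathbb R}$ is the ring of moderate real nets modulo $\sim$, with classes $[x_\varepsilon]$; $\widetilde{\mathbb R}^n$ is defined analogously. $\mathbb R\subseteq\widetilde{\mathbb R}$ via constant nets. $x\le y$ iff there are representatives with $x_\varepsilon\le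 y_\varepsilon$ for all $\varepsilon$; $x<y$ iff $y-x\ge0$ and $y-x$ is invertible; $|[x_\varepsilon]|=[|x_\varepsilon|]$ (Euclidean norm). $[a,b]=\{x\in\widetilde{\mathbb R}:a\le x\le b\}$. The sharp topology on $\widetilde{\mathbb R}^n$ has as base the balls $B_r(c)=\{x:|x-c|<r\}$, $r\in\widetilde{\mathbb R}_{>0}$. Generalized smooth functions (GSF). For open $\Omega_\varepsilon\subseteq\mathbb R^n$, $\langle\Omega_\varepsilon\rangle$ is the set of $[x_\varepsilon]\in\widetilde{\mathbb R}^n$ such that for every representative $x_\varepsilon\in\Omega_\varepsilon$ for $\varepsilon$ small. For $X\subseteq\widetilde{\mathbb R}^n$, $Y\subseteq\widetilde{\mathbb R}^k$, $\mathcal{GC}^\infty(X,Y)$ is the set of maps $f:X\to Y$ for which there are $f_\varepsilon\in C^\infty(\Omega_\varepsilon,\mathbb R^k)$ with $X\subseteq\langle\Omega_\varepsilon\rangle$, $f([x_\varepsilon])=[f_\varepsilon(x_\varepsilon)]$ and $(\partial^\alpha f_\varepsilon(x_\varepsilon))$ moderate for all $[x_\varepsilon]\in X$ and all multi-indices $\alpha$. Derivatives are $\partial^\alpha f([x_\varepsilon])=[\partial^\alpha f_\varepsilon(x_\varepsilon)]$ at sharply interior points (independent of the defining net) and one-sided limits at endpoints of intervals. $\int_a^bf(t)\,dt=[\int_{a_\varepsilon}^{b_\varepsilon}f_\varepsilon(t)\,dt]$. Variational notions. $\mathcal{GC}^\infty_0(a,b)=\{\eta\in\mathcal{GC}^\infty(\widetilde{\mathbb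 R},\widetilde{\mathbb R}^d):\eta(a)=0=\eta(b)\}$. $F_u$, $F_{\dot u}$ are the partial gradients of $F$ with respect to its second and third variables. The first variation is $\delta I(u;\eta)=\frac{d}{ds}I(u+s\eta)|_{s=0}$, $\eta\in\mathcal{GC}^\infty_0(a,b)$; $u$ is a critical point of $I$ if $\delta I(u;\eta)=0$ for all such $\eta$. *)

(* Defs.v *)
From HB Require Import structures.
From mathcomp Require Import all_boot all_order all_algebra.
From mathcomp Require Import all_classical all_reals all_analysis.
From mathcomp Require Import generic_quotient ring_quotient.

Set Implicit Arguments.
Unset Strict Implicit.
Unset Printing Implicit Defensive.
Import Order.TTheory GRing.Theory Num.Theory.
Import numFieldNormedType.Exports.

Local Open Scope classical_set_scope.
Local Open Scope ring_scope.

(* Nets are indexed by I_0 = ]0, 1].  They are represented by functions on the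
   whole of R, of which only the values on I_0 (in fact the germ at 0^'+) are
   ever used; "for epsilon small" is [\forall e \near 0^'+]. *)
Record gauge (R : realType) := Gauge {
  gauge_fun :> R -> R ;
  gauge_cvg : gauge_fun @ 0^'+ `=>` 0^'+ }.

Section Nets.
Context {R : realType} (rho : gauge R).
Implicit Types x y : R -> R.

(* x_e = O(y_e) as e -> 0^+ *)
Definition bigOh x y : Prop :=
  exists C : R, \forall e \near 0^'+, `|x e| <= C * `|y e|.

Definition moderate x : Prop :=
  exists2 N : R, 0 < N & bigOh x (fun e => rho e `^ (- N)).

Definition negligible x : Prop :=
  forall N : R, 0 < N -> bigOh x (fun e => rho e `^ N).

Lemma gauge_near (c : R) : 0 < c -> \forall e \near 0^'+, 0 < rho e < c.
Proof.
move=> c0.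
have : \forall r \near (0 : R)^'+, 0 < r < c.
  by near=> r; apply/andP; split => //; near: r; exact: nbhs_right_lt.
exact: (@gauge_cvg _ rho).
Unshelve. all: by end_near. Qed.

Lemma bigOhC_ge0 x y : bigOh x y ->
  exists2 C : R, 0 <= C & \forall e \near 0^'+, `|x e| <= C * `|y e|.
Proof.
move=> [C HC]; exists `|C| => //; near=> e.
apply: (@le_trans _ _ (C * `|y e|)); first by near: e.
rewrite ler_wpM2r// ler_norm.
Unshelve. all: by end_near. Qed.

Lemma bigOhB x y z : bigOh x z -> bigOh y z -> bigOh (x - y) z.
Proof.
move=> [C HC] [D HD]; exists (C + D); near=> e.
rewrite (le_trans (ler_normB _ _))// mulrDl lerD//.
  by near: e.
by near: e.
Unshelve. all: by end_near. Qed.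

Lemma bigOhM x y z t : bigOh x z -> bigOh y t -> bigOh (x * y) (z * t).
Proof.
move=> /bigOhC_ge0[C C0 HC] /bigOhC_ge0[D D0 HD]; exists (C * D); near=> e.
rewrite -[(x * y) e]/(x e * y e) -[(z * t) e]/(z e * t e).
rewrite !normrM mulrACA ler_pM//.
  by near: e.
by near: e.
Unshelve. all: by end_near. Qed.

Lemma bigOh_le x y z : (\forall e \near 0^'+, `|y e| <= `|z e|) ->
  bigOh x y -> bigOh x z.
Proof.
move=> yz /bigOhC_ge0[C C0 HC]; exists C; near=> e.
apply: (@le_trans _ _ (C * `|y e|)); first by near: e.
rewrite ler_wpM2l//.
by near: e.
Unshelve. all: by end_near. Qed.

Lemma bigOh_le_l x y z : (\forall e \near 0^'+, `|x e| <= `|y e|) ->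
  bigOh y z -> bigOh x z.
Proof.
move=> xy [C HC]; exists C; near=> e.
apply: (@le_trans _ _ `|y e|); first by near: e.
by near: e.
Unshelve. all: by end_near. Qed.

Lemma bigOh_powR x N M : N <= M -> bigOh x (fun e => rho e `^ M) ->
  bigOh x (fun e => rho e `^ N).
Proof.
move=> NM; apply: bigOh_le; near=> e.
have /andP[r0 r1] : 0 < rho e < 1 by near: e; exact: gauge_near.
by rewrite !ger0_norm ?powR_ge0// ger_powR// r0 ltW.
Unshelve. all: by end_near. Qed.

Lemma bigOhM_powR x y N M :
  bigOh x (fun e => rho e `^ N) -> bigOh y (fun e => rho e `^ M) ->
  bigOh (x * y) (fun e => rho e `^ (N + M)).
Proof.
move=> hx hy; apply: bigOh_le (bigOhM hx hy); near=> e.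
have /andP[r0 _] : 0 < rho e < 1 by near: e; exact: gauge_near.
rewrite -[(_ * _ : R -> R) e]/(rho e `^ N * rho e `^ M) powRD//.
by rewrite (gt_eqF r0) implybT.
Unshelve. all: by end_near. Qed.

Lemma moderate1 : moderate 1.
Proof.
exists 1 => //; apply: (@bigOh_powR _ _ 0); first by rewrite oppr_le0.
by exists 1; near=> e; rewrite powRr0 normr1 mulr1.
Unshelve. all: by end_near. Qed.

Lemma moderateB x y : moderate x -> moderate y -> moderate (x - y).
Proof.
move=> [N N0 hx] [M M0 hy]; exists (N + M); first exact: addr_gt0.
by apply: bigOhB; [apply: bigOh_powR hx | apply: bigOh_powR hy];
  rewrite lerN2 (lerDl, lerDr) ltW.
Qed.

Lemma moderateM x y : moderate x -> moderate y -> moderate (x * y).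
Proof.
move=> [N N0 hx] [M M0 hy]; exists (N + M); first exact: addr_gt0.
by rewrite opprD; exact: bigOhM_powR.
Qed.

Lemma negligible_moderate x : negligible x -> moderate x.
Proof.
move=> /(_ 1 ltr01) hx; exists 1 => //.
by apply: bigOh_powR hx; rewrite (@le_trans _ _ 0)// oppr_le0.
Qed.

Lemma negligible0 : negligible 0.
Proof.
move=> N _; exists 0; near=> e; by rewrite normr0 mul0r.
Unshelve. all: by end_near. Qed.

Lemma negligibleB x y : negligible x -> negligible y -> negligible (x - y).
Proof. by move=> hx hy N N0; apply: bigOhB; [apply: hx | apply: hy]. Qed.

Lemma negligibleM x y : moderate x -> negligible y -> negligible (x * y).
Proof.
move=> [M M0 hx] hy N N0.
have -> : N = - M + (M + N) by rewrite addKr.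
by apply: bigOhM_powR => //; apply: hy; exact: addr_gt0.
Qed.

Lemma negligible1 : ~ negligible 1.
Proof.
move=> /(_ 1 ltr01) /bigOhC_ge0[C C0 HC].
have C1 : 0 < (C + 1)^-1 by rewrite invr_gt0 ltr_wpDl.
have : \forall e \near (0 : R)^'+, False.
  near=> e.
  have /andP[r0 r1] : 0 < rho e < (C + 1)^-1.
    near: e; exact: gauge_near.
  have : `|(1 : R -> R) e| <= C * `|rho e `^ 1| by near: e.
  rewrite powRr1; last exact: ltW.
  rewrite (gtr0_norm r0) [X in X <= _]normr1 leNgt => /negP; apply.
  rewrite (@le_lt_trans _ _ ((C + 1) * rho e))//.
    by rewrite ler_wpM2r ?lerDl// ltW.
  by rewrite -ltr_pdivlMl ?mulr1// ltr_wpDl.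
by move=> /filter_ex[].
Unshelve. all: by end_near. Qed.

Definition moderatep : {pred R -> R} := fun x => `[< moderate x >].

Lemma moderatep_closed : GRing.subring_closed moderatep.
Proof.
split=> [|x y /asboolP hx /asboolP hy|x y /asboolP hx /asboolP hy].
- by apply/asboolP; exact: moderate1.
- by apply/asboolP; exact: moderateB.
- by apply/asboolP; exact: moderateM.
Qed.

HB.instance Definition _ :=
  GRing.isSubringClosed.Build _ moderatep moderatep_closed.

Record mnet := MNet { mnet_fun :> R -> R ; _ : mnet_fun \in moderatep }.
HB.instance Definition _ := [isSub for mnet_fun].
HB.instance Definition _ := [Choice of mnet by <:].
HB.instance Definition _ := [SubChoice_isSubComNzRing of mnet by <:].

Definition negligiblep : {pred mnet} := fun x : mnet => `[< negligible x >].

Lemma negligiblep_idealr : idealr_closed negligiblep.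
Proof.
split; first by apply/asboolP; exact: negligible0.
  by apply/asboolP; exact: negligible1.
move=> a x y /asboolP hx /asboolP hy; apply/asboolP.
rewrite -[X in negligible X]/(mnet_fun a * mnet_fun x + mnet_fun y).
rewrite -[mnet_fun y]opprK; apply: negligibleB.
  by apply: negligibleM => //; case: a => a /= /asboolP.
by rewrite -[- _]add0r; apply: negligibleB => //; exact: negligible0.
Qed.

HB.instance Definition _ := isIdealr.Build _ negligiblep negligiblep_idealr.

Definition gnum := {ideal_quot negligiblep}.
HB.instance Definition _ := GRing.ComNzRing.on gnum.
HB.instance Definition _ := Choice.on gnum.

(* [x_e]; nets that are not moderate are sent to 0. *)
Definition gclass x : gnum := \pi_gnum%qT (insubd (0 : mnet) x).

Definition is_repr x (c : gnum) : Prop := moderate x /\ gclass x = c.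

Definition gle (x y : gnum) : Prop :=
  exists p q : R -> R, [/\ is_repr p x, is_repr q y &
    forall e, 0 < e <= 1 -> p e <= q e].

Definition invertible (x : gnum) : Prop := exists y : gnum, x * y = 1.

Definition glt (x y : gnum) : Prop := gle 0 (y - x) /\ invertible (y - x).

Definition gitv (a b : gnum) : set gnum := [set x | gle a x /\ gle x b].

Definition enorm n (x : 'rV[R]_n) : R := Num.sqrt (\sum_(i < n) x 0 i ^+ 2).

(* R~^n is 'rV[gnum]_n; [vclass_eq] and [vclass_surj] below show that this is
   the quotient of the moderate nets in R^n by Euclidean negligibility. *)
Section Vectors.
Variable n : nat.
Implicit Types (v w : R -> 'rV[R]_n) (c : 'rV[gnum]_n).

Definition vmoderate v : Prop := moderate (fun e => enorm (v e)).

Definition vclass v : 'rV[gnum]_n := \row_i gclass (fun e => v e 0 i).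

Definition is_vrepr v c : Prop := vmoderate v /\ vclass v = c.

Definition vrepr c : R -> 'rV[R]_n :=
  fun e => \row_i (repr (c 0 i) : mnet) e.

Definition gnorm c : gnum := gclass (fun e => enorm (vrepr c e)).

Definition sharp_ball c (r : gnum) : set 'rV[gnum]_n :=
  [set x | glt (gnorm (x - c)) r].

(* Neighbourhood filter of the sharp topology. *)
Definition sharp_nbhs c : set_system 'rV[gnum]_n :=
  [set A | exists2 r, glt 0 r & sharp_ball c r `<=` A].

Definition sharp_interior (X : set 'rV[gnum]_n) : set 'rV[gnum]_n :=
  [set c | sharp_nbhs c X].

(* <Omega_e> *)
Definition internal (O : R -> set 'rV[R]_n) : set 'rV[gnum]_n :=
  [set c | forall v, is_vrepr v c -> \forall e \near 0^'+, O e (v e)].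

Lemma moderate_gclass_eq x y : moderate x -> moderate y ->
  gclass x = gclass y <-> negligible (x - y).
Proof.
move=> mx my; have hx : x \in moderatep by apply/asboolP.
have hy : y \in moderatep by apply/asboolP.
have vE : mnet_fun (insubd (0 : mnet) x - insubd (0 : mnet) y) = x - y.
  rewrite -[LHS]/(val (insubd (0 : mnet) x) - val (insubd (0 : mnet) y)).
  by rewrite !val_insubd hx hy.
split=> [/eqP|h]; last apply/eqP.
  by rewrite /gclass -Quotient.idealrBE => /asboolP; rewrite vE.
by rewrite /gclass -Quotient.idealrBE; apply/asboolP; rewrite vE.
Qed.

Lemma gclass_repr (c : gnum) : gclass (mnet_fun (repr c)) = c.
Proof. by rewrite /gclass -[mnet_fun _]/(val _) valKd reprK. Qed.

Lemma enorm_ge0 (x : 'rV[R]_n) : 0 <= enorm x.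
Proof. exact: sqrtr_ge0. Qed.

Lemma coord_le_enorm (x : 'rV[R]_n) i : `|x 0 i| <= enorm x.
Proof.
rewrite -sqrtr_sqr /enorm ler_wsqrtr// (bigD1 i)//= lerDl.
by apply: sumr_ge0 => j _; exact: sqr_ge0.
Qed.

Lemma enorm_le_sum (x : 'rV[R]_n) : enorm x <= \sum_i `|x 0 i|.
Proof.
have s0 : 0 <= \sum_i `|x 0 i| by apply: sumr_ge0.
rewrite -[leRHS]ger0_norm// -sqrtr_sqr ler_wsqrtr// expr2 mulr_suml.
apply: ler_sum => i _; rewrite -normr_id -real_normK ?num_real// expr2.
rewrite normr_id ler_wpM2l// (bigD1 i)//= lerDl; exact: sumr_ge0.
Qed.

Lemma moderate_le x y : (forall e, `|x e| <= `|y e|) ->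
  moderate y -> moderate x.
Proof.
move=> xy [N N0 hy]; exists N => //; apply: bigOh_le_l hy; near=> e; exact: xy.
Unshelve. all: by end_near. Qed.

Lemma negligible_le x y : (forall e, `|x e| <= `|y e|) ->
  negligible y -> negligible x.
Proof.
move=> xy hy N N0; apply: bigOh_le_l (hy N N0); near=> e; exact: xy.
Unshelve. all: by end_near. Qed.

Lemma moderateD x y : moderate x -> moderate y -> moderate (x + y).
Proof.
move=> mx my; apply/asboolP.
by apply: (@rpredD _ moderatep); apply/asboolP.
Qed.

Lemma negligibleD x y : negligible x -> negligible y -> negligible (x + y).
Proof.
move=> hx hy; rewrite -[y]opprK; apply: negligibleB => //.
by rewrite -[- y]add0r; apply: negligibleB => //; exact: negligible0.
Qed.

Lemma vmoderateP v : vmoderate v <-> forall i, moderate (fun e => v e 0 i).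
Proof.
split=> [hv i|hv].
  apply: moderate_le hv => e.
  by rewrite [leRHS]ger0_norm ?enorm_ge0// coord_le_enorm.
apply: (@moderate_le _ (fun e => \sum_i `|v e 0 i|)) => [e|].
  rewrite ger0_norm ?enorm_ge0// ger0_norm ?sumr_ge0//; exact: enorm_le_sum.
have -> : (fun e => \sum_i `|v e 0 i|) = \sum_i (fun e => `|v e 0 i|).
  by apply/funext => e; rewrite fct_sumE.
elim/big_ind : _ => [||i _]; last 1 first.
- by apply: moderate_le (hv i) => e; rewrite normr_id.
- by apply: negligible_moderate; exact: negligible0.
- exact: moderateD.
Qed.

Lemma negligible_enormP v : negligible (fun e => enorm (v e)) <->
  forall i, negligible (fun e => v e 0 i).
Proof.
split=> [hv i|hv].
  apply: negligible_le hv => e.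
  by rewrite [leRHS]ger0_norm ?enorm_ge0// coord_le_enorm.
apply: (@negligible_le _ (fun e => \sum_i `|v e 0 i|)) => [e|].
  rewrite ger0_norm ?enorm_ge0// ger0_norm ?sumr_ge0//; exact: enorm_le_sum.
have -> : (fun e => \sum_i `|v e 0 i|) = \sum_i (fun e => `|v e 0 i|).
  by apply/funext => e; rewrite fct_sumE.
elim/big_ind : _ => [||i _]; last 1 first.
- by apply: negligible_le (hv i) => e; rewrite normr_id.
- exact: negligible0.
- exact: negligibleD.
Qed.

Lemma vclass_eq v w : vmoderate v -> vmoderate w ->
  vclass v = vclass w <-> negligible (fun e => enorm (v e - w e)).
Proof.
move=> /vmoderateP mv /vmoderateP mw.
have E i : (fun e => (v e - w e) 0 i) = (fun e => v e 0 i) - (fun e => w e 0 i).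
  by apply/funext => e; rewrite !mxE.
split=> [/rowP h|/negligible_enormP h].
  apply/negligible_enormP => i; rewrite E; apply/moderate_gclass_eq => //.
  by have := h i; rewrite !mxE.
by apply/rowP => i; rewrite !mxE; apply/moderate_gclass_eq => //; rewrite -E.
Qed.

Lemma vrepr_is_vrepr c : is_vrepr (vrepr c) c.
Proof.
have E i : (fun e => vrepr c e 0 i) = mnet_fun (repr (c 0 i)).
  by apply/funext => e; rewrite mxE.
split; first by apply/vmoderateP => i; rewrite E; case: (repr _) => x /= /asboolP.
by apply/rowP => i; rewrite mxE E gclass_repr.
Qed.

Lemma vclass_surj c : exists2 v, vmoderate v & vclass v = c.
Proof. by have [] := vrepr_is_vrepr c; exists (vrepr c). Qed.

End Vectors.
End Nets.

Arguments gnum {R} rho.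
Arguments sharp_interior {R rho n} X.
Arguments gitv {R rho} a b.

(* [pd [:: i1; ...; ik] f] is d_i1 ... d_ik f.  Words in the coordinates are
   used instead of multi-indices; for C^oo functions the order of the letters
   is immaterial. *)
Definition pd {R : realType} {n k : nat} (s : seq 'I_n)
    (f : 'rV[R]_n -> 'rV[R]_k) : 'rV[R]_n -> 'rV[R]_k :=
  foldr (fun i g x => 'D_(delta_mx 0 i) g x) f s.

(* f is of class C^oo on the open set O *)
Definition smooth {R : realType} {n k : nat} (O : set 'rV[R]_n)
    (f : 'rV[R]_n -> 'rV[R]_k) : Prop :=
  forall (s : seq 'I_n) x, O x ->
    {for x, continuous (pd s f)} /\
    forall i, derivable (pd s f) x (delta_mx 0 i).

Section GSF.
Context {R : realType} {rho : gauge R}.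
Local Notation K := (gnum rho).

Section Maps.
Variables n k : nat.
Implicit Types (X : set 'rV[K]_n) (Y : set 'rV[K]_k)
  (f : 'rV[K]_n -> 'rV[K]_k) (O : R -> set 'rV[R]_n)
  (fe : R -> 'rV[R]_n -> 'rV[R]_k).

(* The net (fe : O_e -> R^k) of smooth maps defines f on X; the values of f
   outside X, and of fe e outside O e, are irrelevant. *)
Definition defines X f O fe : Prop :=
  [/\ forall e, 0 < e <= 1 -> open (O e) /\ smooth (O e) (fe e),
      X `<=` internal O
    & forall c xe, X c -> is_vrepr xe c ->
        (forall s, vmoderate rho (fun e => pd s (fe e) (xe e))) /\
        f c = vclass rho (fun e => fe e (xe e))].

(* f \in GC^oo(X, Y) *)
Definition is_GSF X Y f : Prop :=
  (forall c, X c -> Y (f c)) /\ exists O fe, defines X f O fe.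

(* d_i f on the sharp interior of X, computed on a defining net *)
Definition gpartial_int X f (i : 'I_n) (c : 'rV[K]_n) : 'rV[K]_k :=
  xget 0 [set y | exists O fe xe, [/\ defines X f O fe, is_vrepr xe c &
    y = vclass rho (fun e => pd [:: i] (fe e) (xe e))]].

(* At the other points, d_i f is the sharp limit of its values along the sharp
   interior of X; for X = [a, b] these are the one-sided limits at a and b. *)
Definition gpartial X f (i : 'I_n) (c : 'rV[K]_n) : 'rV[K]_k :=
  if `[< sharp_interior X c >] then gpartial_int X f i c
  else xget 0 [set y | gpartial_int X f i c'
    @[c' --> within (sharp_interior X) (sharp_nbhs c)] `=>` sharp_nbhs y].

End Maps.

(* R~ is identified with R~^1. *)
Definition line (J : set K) : set 'rV[K]_1 := [set x | J (x 0 0)].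

Definition on_line k (u : K -> 'rV[K]_k) : 'rV[K]_1 -> 'rV[K]_k :=
  fun x => u (x 0 0).

Definition is_GSF_curve k (J : set K) (u : K -> 'rV[K]_k) : Prop :=
  is_GSF (line J) setT (on_line u).

Definition gderiv k (J : set K) (u : K -> 'rV[K]_k) : K -> 'rV[K]_k :=
  fun t => gpartial (line J) (on_line u) ord0 (const_mx t).

Definition scalar (f : K -> K) : K -> 'rV[K]_1 := fun t => const_mx (f t).

(* For a < b, ae e <= be e for e small, so that the orientation of the integral
   plays no role. *)
Definition gintegral (a b : K) (f : K -> K) : K :=
  xget 0 [set y | exists O fe ae be,
    [/\ defines (line (gitv a b)) (on_line (scalar f)) O fe,
        is_repr ae a, is_repr be b &
        y = gclass rho (fun e =>
          \int[lebesgue_measure]_(t in `[ae e, be e]) fe e (const_mx t) 0 0)]].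

Section Variational.
Variables (d : nat) (a b : K).
Implicit Types (F : K -> 'rV[K]_d -> 'rV[K]_d -> K) (u eta : K -> 'rV[K]_d).

(* R~ x R~^d x R~^d is identified with R~^(1 + (d + d)). *)
Definition lagr_dom : set 'rV[K]_(1 + (d + d)) :=
  [set z | gitv a b (lsubmx z 0 0)].

Definition uncurried F : 'rV[K]_(1 + (d + d)) -> 'rV[K]_1 :=
  fun z => const_mx (F (lsubmx z 0 0) (lsubmx (rsubmx z)) (rsubmx (rsubmx z))).

(* F \in GC^oo([a, b] x R~^d x R~^d, R~) *)
Definition is_lagrangian F : Prop := is_GSF lagr_dom setT (uncurried F).

Definition point (t : K) (x v : 'rV[K]_d) : 'rV[K]_(1 + (d + d)) :=
  row_mx (const_mx t) (row_mx x v).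

Definition grad2 F t x v : 'rV[K]_d :=
  \row_(j < d) gpartial lagr_dom (uncurried F)
    (rshift 1 (lshift d j)) (point t x v) 0 0.

Definition grad3 F t x v : 'rV[K]_d :=
  \row_(j < d) gpartial lagr_dom (uncurried F)
    (rshift 1 (rshift d j)) (point t x v) 0 0.

Definition action F u : K :=
  gintegral a b (fun t => F t (u t) (gderiv (gitv a b) u t)).

Definition euler_lagrange F u : Prop :=
  let du := gderiv (gitv a b) u in
  forall t, gitv a b t ->
    grad2 F t (u t) (du t)
      - gderiv (gitv a b) (fun t' => grad3 F t' (u t') (du t')) t = 0.

(* GC^oo_0(a, b) *)
Definition test_fun eta : Prop :=
  [/\ is_GSF_curve setT eta, eta a = 0 & eta b = 0].

Definition first_variation F u eta : K :=
  gderiv setT (scalar (fun s => action F (fun t => u t + s *: eta t))) 0 0 0.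

Definition critical_point F u : Prop :=
  forall eta, test_fun eta -> first_variation F u eta = 0.

End Variational.
End GSF.

(* Main.v *)
(** The partial derivatives of a generalized smooth function at any point of a
slab, interior or not, are the classes of the partial derivatives of any
defining net: a Taylor step of length [rho ^ q] shows that a net of smooth
functions with moderate derivatives and negligible values has negligible
derivatives, and Lipschitz bounds with moderate constants give the sharp limits
at the remaining points. Hence both sides of the equivalence can be read off
nets. On the level of nets, differentiation under the integral sign and
integration by parts identify the first variation with [int E . eta], where [E]
is the Euler-Lagrange net; that net vanishes on [a, b] in the generalized sense
iff it is negligible along every net of points of [a_e, b_e]. For the converse
direction no compactly supported bump is needed, since test functions only
vanish at [a] and [b]: the rational peak
[(t - a) (b - t) / (1 + ((t - t0) / h ^ 2) ^ 2) ^ 3] with [h = rho ^ q]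
concentrates enough at [t0] to yield [|E t0| <= 16 |int E . eta| / h ^ 4 + O(h)]
with a moderate constant, and [q] is arbitrary. *)
From HB Require Import structures.
From mathcomp Require Import all_boot all_order all_algebra.
From mathcomp Require Import all_classical all_reals all_analysis.
From mathcomp Require Import ring lra.
Require Import Defs.

Set Implicit Arguments.
Unset Strict Implicit.
Unset Printing Implicit Defensive.
Import Order.TTheory GRing.Theory Num.Theory.
Import numFieldNormedType.Exports.

Local Open Scope classical_set_scope.
Local Open Scope ring_scope.

(** * Nets of real numbers *)

Section NetArithmetic.
Context {R : realType} {rho : gauge R}.
Implicit Types (x y z : R -> R) (c : gnum rho).

(** A generalized smooth function is controlled only along single nets of points, with an exponent
    of moderateness that may change from one net to the next, whereas mean values and integrals need
    bounds that are uniform on sets. The freedom in choosing nets supplies them: a net that picks a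
    nearly worst point at each [e] is itself admissible, and the exponent that belongs to it serves
    for the whole set.

    Derivatives and integrals are defined by choosing some defining net, so each must be shown
    independent of that choice before anything can be computed.

    The scales of the peak are forced. Its width is [h ^ 2], so at distance [h] from the centre the
    basic kernel is at most [h ^ 2]. Its mass is bounded below by order [h ^ 4]: one factor [h ^ 2]
    comes from the width, the other from the weight at distance [h] from the ends. The cube, with
    tails of order [h ^ 6], is the least integer power of the kernel that beats this mass. A
    rational kernel whose denominator is at least [1] also stays moderate with all its derivatives
    on the whole generalized line, where test functions have to live. *)

Lemma near_at_right0 (P : R -> Prop) (c0 : R) : 0 < c0 ->
  (forall e, 0 < e < c0 -> P e) -> \forall e \near 0^'+, P e.
Proof.
move=> c00 H; near=> e; apply: H; apply/andP; split; near: e.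
  exact: nbhs_right_gt.
exact: nbhs_right_lt.
Unshelve. all: by end_near. Qed.

(** A spare power of [rho] absorbs the constant in [O]; after this lemma and [negligibleE],
    estimates compare integer powers of [rho] only. *)
Lemma moderateE x : moderate rho x <->
  exists n : nat, \forall e \near 0^'+, `|x e| * rho e ^+ n <= 1.
Proof.
split=> [[N N0 /bigOhC_ge0[C C0 HC]]|[n Hn]].
  (* The unit above [N] is the spare power that beats [C]. *)
  have [n Nn] : exists n : nat, N + 1 <= n%:R.
    by have /andP[_ /ltW] := truncn_itv (addr_ge0 (ltW N0) ler01);
      exists (Num.trunc (N + 1)).+1.
  exists n; near=> e.
  have /andP[r0 r1] : 0 < rho e < (C + 1)^-1.
    by near: e; apply: gauge_near; rewrite invr_gt0 ltr_wpDl.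
  have /andP[_ r2] : 0 < rho e < 1 by near: e; exact: gauge_near.
  have xe : `|x e| <= C * `|rho e `^ (- N)| by near: e.
  rewrite (ger0_norm (powR_ge0 _ _)) in xe.
  apply: (@le_trans _ _ (C * rho e `^ (- N) * rho e `^ n%:R)).
    by rewrite powR_mulrn ?(ltW r0)// ler_wpM2r// exprn_ge0// ltW.
  rewrite -mulrA -powRD; last by rewrite (gt_eqF r0) implybT.
  apply: (@le_trans _ _ (C * rho e)).
    rewrite ler_wpM2l// -[leRHS]powRr1 ?(ltW r0)//.
    rewrite ger_powR ?r0 ?(ltW r2)//; lra.
  apply: (@le_trans _ _ ((C + 1) * rho e)).
    by rewrite ler_wpM2r ?lerDl// ltW.
  by rewrite -ler_pdivlMl ?mulr1 ?(ltW r1)// ltr_wpDl.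
exists n.+1%:R => //; exists 1; near=> e.
have /andP[r0 r1] : 0 < rho e < 1 by near: e; exact: gauge_near.
have xe : `|x e| * rho e ^+ n <= 1 by near: e.
rewrite mul1r (ger0_norm (powR_ge0 _ _)) powR_invn ?(ltW r0)//.
rewrite -[leRHS]mul1r ler_pdivlMr ?exprn_gt0// (le_trans _ xe)//.
by rewrite ler_wpM2l// exprS ler_piMl ?exprn_ge0 ?ltW.
Unshelve. all: by end_near. Qed.

Lemma negligibleE x : negligible rho x <->
  forall n : nat, \forall e \near 0^'+, `|x e| <= rho e ^+ n.
Proof.
split=> [H n|H N N0].
  have /bigOhC_ge0[C C0 HC] : bigOh x (fun e => rho e `^ n.+1%:R) by exact: H.
  near=> e.
  have /andP[r0 r1] : 0 < rho e < (C + 1)^-1.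
    by near: e; apply: gauge_near; rewrite invr_gt0 ltr_wpDl.
  have xe : `|x e| <= C * `|rho e `^ n.+1%:R| by near: e.
  rewrite (ger0_norm (powR_ge0 _ _)) powR_mulrn ?(ltW r0)// in xe.
  rewrite (le_trans xe)// exprS mulrA ler_piMl ?exprn_ge0 ?(ltW r0)//.
  apply: (@le_trans _ _ ((C + 1) * rho e)).
    by rewrite ler_wpM2r ?lerDl// ltW.
  by rewrite -ler_pdivlMl ?mulr1 ?(ltW r1)// ltr_wpDl.
have [n Nn] : exists n : nat, N <= n%:R.
  by have /andP[_ /ltW] := truncn_itv (ltW N0); exists (Num.trunc N).+1.
exists 1; near=> e.
have /andP[r0 r1] : 0 < rho e < 1 by near: e; exact: gauge_near.
have xe : `|x e| <= rho e ^+ n by near: e.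
rewrite mul1r (ger0_norm (powR_ge0 _ _)) (le_trans xe)// -powR_mulrn ?(ltW
  r0)//.
by rewrite ger_powR// r0 ltW.
Unshelve. all: by end_near. Qed.

Lemma moderate_near_le x y : (\forall e \near 0^'+, `|x e| <= `|y e|) ->
  moderate rho y -> moderate rho x.
Proof. by move=> xy [N N0 hy]; exists N => //; apply: bigOh_le_l xy hy. Qed.

Lemma negligible_near_le x y : (\forall e \near 0^'+, `|x e| <= `|y e|) ->
  negligible rho y -> negligible rho x.
Proof. by move=> xy hy N N0; apply: bigOh_le_l xy (hy N N0). Qed.

Lemma moderate_near_eq x y : (\forall e \near 0^'+, x e = y e) ->
  moderate rho y -> moderate rho x.
Proof. by move=> xy; apply: moderate_near_le; apply: filterS xy => e ->. Qed.

Lemma negligible_near_eq x y : (\forall e \near 0^'+, x e = y e) ->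
  negligible rho y -> negligible rho x.
Proof. by move=> xy; apply: negligible_near_le; apply: filterS xy => e ->. Qed.

Lemma moderate_cst (r : R) : moderate rho (fun=> r).
Proof.
apply/moderateE; exists 1%N; near=> e.
have /andP[r0 r1] : 0 < rho e < (`|r| + 1)^-1.
  by near: e; apply: gauge_near; rewrite invr_gt0 ltr_wpDl.
rewrite expr1 (@le_trans _ _ ((`|r| + 1) * rho e))//.
  by rewrite ler_wpM2r ?lerDl// ltW.
by rewrite -ler_pdivlMl ?mulr1 ?(ltW r1)// ltr_wpDl.
Unshelve. all: by end_near. Qed.

Lemma moderate_rhoX n : moderate rho (fun e => rho e ^+ n).
Proof.
apply: moderate_near_le (moderate_cst 1); near=> e.
have /andP[r0 r1] : 0 < rho e < 1 by near: e; exact: gauge_near.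
by rewrite normr1 ger0_norm ?exprn_ge0 ?(ltW r0)// exprn_ile1 ?ltW.
Unshelve. all: by end_near. Qed.

Lemma moderate_rhoV n : moderate rho (fun e => rho e ^- n).
Proof.
apply/moderateE; exists n; near=> e.
have /andP[r0 r1] : 0 < rho e < 1 by near: e; exact: gauge_near.
by rewrite gtr0_norm ?invr_gt0 ?exprn_gt0// mulVf// gt_eqF// exprn_gt0.
Unshelve. all: by end_near. Qed.

Lemma moderate_sum (I : Type) (r : seq I) (P : pred I) (f : I -> R -> R) :
  (forall i, P i -> moderate rho (f i)) ->
  moderate rho (fun e => \sum_(i <- r | P i) f i e).
Proof.
move=> H.
rewrite (_ : (fun e => _) = \sum_(i <- r | P i) f i); last first.
  by apply/funext => e; rewrite fct_sumE.
elim/big_ind : _ => //; last exact: moderateD.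
exact: moderate_cst.
Qed.

Lemma negligible_sum (I : Type) (r : seq I) (P : pred I) (f : I -> R -> R) :
  (forall i, P i -> negligible rho (f i)) ->
  negligible rho (fun e => \sum_(i <- r | P i) f i e).
Proof.
move=> H.
rewrite (_ : (fun e => _) = \sum_(i <- r | P i) f i); last first.
  by apply/funext => e; rewrite fct_sumE.
elim/big_ind : _ => //; last exact: negligibleD.
exact: negligible0.
Qed.

Lemma is_repr_repr c : is_repr (mnet_fun (repr c)) c.
Proof. by split; [case: (repr c) => x /= /asboolP | exact: gclass_repr]. Qed.

Lemma gclass_is_repr x : moderate rho x -> is_repr x (gclass rho x).
Proof. by []. Qed.

Lemma is_repr_sub x y c : is_repr x c -> is_repr y c -> negligible rho (x - y).
Proof. by move=> [mx <-] [my /esym]; move/moderate_gclass_eq; apply. Qed.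

Lemma is_repr_negligible x y c : is_repr x c -> negligible rho (y - x) ->
  is_repr y c.
Proof.
move=> [mx <-] nyx; have my : moderate rho y.
  by rewrite -(subrK x y); apply: moderateD => //; exact: negligible_moderate.
by split=> //; apply/moderate_gclass_eq.
Qed.

Lemma is_repr_near x y c : is_repr x c -> (\forall e \near 0^'+, y e = x e) ->
  is_repr y c.
Proof.
move=> xc yx; apply: (is_repr_negligible xc).
apply: negligible_near_eq (@negligible0 _ _).
by apply: filterS yx => e yx; rewrite -[LHS]/(y e - x e) yx subrr.
Qed.

Lemma gclass_near x y : moderate rho y -> (\forall e \near 0^'+, x e = y e) ->
  gclass rho x = gclass rho y.
Proof. by move=> my xy; have [] := is_repr_near (gclass_is_repr my) xy. Qed.

Lemma is_repr_fun_eq x c c' : is_repr x c -> is_repr x c' -> c = c'.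
Proof. by move=> [_ <-] []. Qed.

Lemma is_repr_mk (m : mnet rho) : is_repr (mnet_fun m) (\pi_(gnum rho)%qT m).
Proof.
case: m => x hx; split => /=; first exact/asboolP.
by rewrite /gclass (_ : insubd _ _ = MNet hx)//; apply/val_inj;
  rewrite val_insubd hx.
Qed.

Lemma is_reprP x c : is_repr x c ->
  exists2 m : mnet rho, mnet_fun m = x & c = (\pi_(gnum rho)%qT m).
Proof.
move=> [/asboolP hx <-]; have hx' : x \in moderatep rho by [].
exists (MNet hx') => //.
rewrite /gclass (_ : insubd _ _ = MNet hx')//; apply/val_inj.
by rewrite val_insubd hx'.
Qed.

Lemma is_reprD x y c c' : is_repr x c -> is_repr y c' ->
  is_repr (x + y) (c + c').
Proof.
move=> /is_reprP[m <- ->] /is_reprP[m' <- ->]; rewrite -rmorphD;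
  exact: (is_repr_mk (m + m')).
Qed.

Lemma is_reprN x c : is_repr x c -> is_repr (- x) (- c).
Proof. move=> /is_reprP[m <- ->]; rewrite -rmorphN;
  exact: (is_repr_mk (- m)). Qed.

Lemma is_reprB x y c c' : is_repr x c -> is_repr y c' ->
  is_repr (x - y) (c - c').
Proof. by move=> xc yc; apply: is_reprD => //; exact: is_reprN. Qed.

Lemma is_reprM x y c c' : is_repr x c -> is_repr y c' ->
  is_repr (x * y) (c * c').
Proof.
move=> /is_reprP[m <- ->] /is_reprP[m' <- ->]; rewrite -rmorphM;
  exact: (is_repr_mk (m * m')).
Qed.

Lemma is_repr0 : is_repr (0 : R -> R) (0 : gnum rho).
Proof. by have := is_repr_mk (0 : mnet rho); rewrite rmorph0. Qed.

Lemma is_repr1 : is_repr (1 : R -> R) (1 : gnum rho).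
Proof. by have := is_repr_mk (1 : mnet rho); rewrite rmorph1. Qed.

Lemma is_repr0E x : is_repr x (0 : gnum rho) <-> negligible rho x.
Proof.
split=> [x0|nx]; first by rewrite -[x]subr0; apply: is_repr_sub x0 is_repr0.
by apply: is_repr_negligible is_repr0 _; rewrite subr0.
Qed.

(** An inequality up to negligible errors can be repaired: cutting [x] off at [y] changes it only by
    the excess of [x] over [y], which lies below every power of [rho]. *)
Lemma gleP x y c c' : is_repr x c -> is_repr y c' ->
  gle c c' <-> forall n : nat, \forall e \near 0^'+, x e <= y e + rho e ^+ n.
Proof.
move=> xc yc; split=> [[p [q [pc qc pq]]] n|H].
  have /negligibleE/(_ n.+1) xp := is_repr_sub xc pc.
  have /negligibleE/(_ n.+1) yq := is_repr_sub yc qc.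
  near=> e.
  have /andP[r0 r1] : 0 < rho e < 2^-1 by near: e; apply: gauge_near.
  have xp_e : `|x e - p e| <= rho e ^+ n.+1 by near: e.
  have yq_e : `|y e - q e| <= rho e ^+ n.+1 by near: e.
  have pq_e : p e <= q e.
    apply: pq; apply/andP; split; near: e; first exact: nbhs_right_gt.
    exact: nbhs_right_le.
  have : rho e ^+ n.+1 <= 2^-1 * rho e ^+ n.
    by rewrite exprS ler_wpM2r ?exprn_ge0 ?ltW.
  move: xp_e yq_e; rewrite !ler_norml => /andP[_ xp_e] /andP[yq_e _].
  lra.
pose p e := if 0 < e <= 1 then Num.min (x e) (y e) else 0.
pose q e := if 0 < e <= 1 then y e else 0.
have good : \forall e \near (0 : R)^'+, 0 < e <= 1.
  by apply: (@near_at_right0 _ 1) => // e /andP[-> /ltW].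
exists p, q; split.
- apply: (is_repr_negligible xc); apply/negligibleE => n; near=> e.
  have -> : (p - x) e = p e - x e by [].
  rewrite /p; have -> : 0 < e <= 1 by near: e.
  have xy : x e <= y e + rho e ^+ n by near: e.
  have /andP[r0 _] : 0 < rho e < 1 by near: e; exact: gauge_near.
  have [_|yx] := leP (x e) (y e).
    by rewrite subrr normr0 exprn_ge0// ltW.
  by rewrite distrC gtr0_norm ?subr_gt0// lerBlDl.
- apply: (is_repr_near yc); near=> e; rewrite /q ifT//; near: e; exact: good.
- by move=> e e01; rewrite /p /q e01 ge_min lexx orbT.
Unshelve. all: by end_near. Qed.

(** A moderate inverse keeps [|x|] above [rho ^ n / 2], and [0 <= c] then leaves only the positive
    sign. Conversely, a lower bound by a power of [rho] makes [x^-1] moderate. *)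
Lemma glt0P x c : is_repr x c ->
  glt 0 c <-> exists n : nat, \forall e \near 0^'+, rho e ^+ n <= x e.
Proof.
move=> xc; rewrite /glt subr0; split=> [[c0 [c' cc']]|[n Hn]].
  have := is_repr_repr c'; set y := mnet_fun _ => yc'.
  have /moderateE[n Hn] : moderate rho y by case: yc'.
  have := is_repr_sub (is_reprM xc yc').
  rewrite cc' => /(_ _ is_repr1)/negligibleE/(_ 1%N) xy1.
  (* An error of order [n + 2] is below [rho ^ n / 2], too small to let [x e] be negative. *)
  have {}c0 := (gleP is_repr0 xc).1 c0 n.+2.
  exists n.+1; near=> e.
  have /andP[r0 r1] : 0 < rho e < 2^-1 by near: e; apply: gauge_near.
  have xy1_e : `|x e * y e - 1| <= rho e ^+ 1 by near: e.
  have Hn_e : `|y e| * rho e ^+ n <= 1 by near: e.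
  have c0_e : 0 <= x e + rho e ^+ n.+2 by near: e.
  have rn0 : 0 < rho e ^+ n by rewrite exprn_gt0.
  have xy2 : 2^-1 <= `|x e| * `|y e|.
    move: xy1_e; rewrite expr1 -normrM ler_norml => /andP[xy1_e _].
    by apply: (le_trans _ (ler_norm _)); lra.
  have xr : 2^-1 * rho e ^+ n <= `|x e|.
    rewrite (le_trans (ler_wpM2r (ltW rn0) xy2))// -mulrA ler_piMr//.
  have [x0|x0] := leP 0 (x e).
    rewrite ger0_norm// in xr;
      rewrite (le_trans _ xr)// exprS ler_wpM2r// ltW//.
  have : rho e ^+ n.+2 < 2^-1 * rho e ^+ n.
    rewrite exprS exprS mulrA ltr_pM2r// -[ltRHS]mulr1 ltr_pM//.
    - exact: ltW.
    - exact: ltW.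
    - lra.
  rewrite ltr0_norm// in xr; lra.
split.
  apply/(gleP is_repr0 xc) => m; near=> e.
  have /andP[r0 r1] : 0 < rho e < 1 by near: e; apply: gauge_near.
  have Hn_e : rho e ^+ n <= x e by near: e.
  by rewrite addr_ge0// ?(le_trans _ Hn_e)// exprn_ge0// ltW.
pose y e := (x e)^-1.
have my : moderate rho y.
  apply: moderate_near_le (moderate_rhoV n); near=> e.
  have /andP[r0 r1] : 0 < rho e < 1 by near: e; apply: gauge_near.
  have Hn_e : rho e ^+ n <= x e by near: e.
  have rn0 : 0 < rho e ^+ n by rewrite exprn_gt0.
  rewrite gtr0_norm ?invr_gt0 ?(lt_le_trans rn0)//.
  by rewrite gtr0_norm ?invr_gt0// lef_pV2// posrE (lt_le_trans rn0).
exists (gclass rho y).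
have xy := is_reprM xc (gclass_is_repr my).
apply: (is_repr_fun_eq xy); apply: (is_repr_near is_repr1); near=> e.
have /andP[r0 r1] : 0 < rho e < 1 by near: e; apply: gauge_near.
have Hn_e : rho e ^+ n <= x e by near: e.
rewrite -[LHS]/(x e * (x e)^-1) mulfV// gt_eqF// (lt_le_trans _ Hn_e)//.
by rewrite exprn_gt0.
Unshelve. all: by end_near. Qed.

Lemma gltP x y c c' : is_repr x c -> is_repr y c' ->
  glt c c' <-> exists n : nat, \forall e \near 0^'+, x e + rho e ^+ n <= y e.
Proof.
move=> xc yc; have H := glt0P (is_reprB yc xc).
have -> : glt c c' = glt 0 (c' - c) by rewrite /glt subr0.
split=> [/H|H']; last apply/H; [move=> H'|]; case: H' => n Hn; exists n;
  near=> e.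
  have Hn_e : rho e ^+ n <= y e - x e by near: e.
  by rewrite -lerBrDl.
have Hn_e : x e + rho e ^+ n <= y e by near: e.
by rewrite -[leRHS]/(y e - x e) lerBrDl.
Unshelve. all: by end_near. Qed.

Section Vec.
Variable n : nat.
Implicit Types (v w : R -> 'rV[R]_n) (C : 'rV[gnum rho]_n).

Lemma is_vreprP v C :
  is_vrepr v C <-> forall i, is_repr (fun e => v e 0 i) (C 0 i).
Proof.
split=> [[/vmoderateP mv <-] i|H]; first by split; rewrite ?mxE.
split; first by apply/vmoderateP => i; case: (H i).
by apply/rowP => i; rewrite mxE; case: (H i).
Qed.

Lemma vclass_is_vrepr v : vmoderate rho v -> is_vrepr v (vclass rho v).
Proof. by []. Qed.

Lemma gnorm_ball_coord v C (r : gnum rho) x : is_vrepr v C -> is_repr x r ->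
  glt (gnorm C) r -> forall i, \forall e \near 0^'+, `|v e 0 i| <= x e.
Proof.
move=> vC xr; have [mw wC] := vrepr_is_vrepr C.
move/(gltP (gclass_is_repr mw) xr) => [m Hm] i.
have /is_vreprP/(_ i) vi := vC.
have /is_vreprP/(_ i) wi := conj mw wC.
have /negligibleE/(_ m) vw := is_repr_sub vi wi.
near=> e.
have Hm_e : enorm (vrepr C e) + rho e ^+ m <= x e by near: e.
have vw_e : `|v e 0 i - vrepr C e 0 i| <= rho e ^+ m by near: e.
have := coord_le_enorm (vrepr C e) i.
have := lerB_normD (v e 0 i - vrepr C e 0 i) (vrepr C e 0 i).
have := ler_normD (v e 0 i - vrepr C e 0 i) (vrepr C e 0 i).
rewrite subrK; lra.
Unshelve. all: by end_near. Qed.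

(** The strict inequality needs a gap, taken as [rho ^ m.+1]. The second spare power keeps the sum
    of the coordinates below a multiple of that gap, and a factor [rho] absorbs the constant
    [2 n + 1]. *)
Lemma coord_gnorm_ball v C (r : gnum rho) x m : is_vrepr v C -> is_repr x r ->
  (\forall e \near 0^'+, rho e ^+ m <= x e) ->
  (forall i, \forall e \near 0^'+, `|v e 0 i| <= rho e ^+ m.+2) ->
  glt (gnorm C) r.
Proof.
move=> vC xr Hm vm; have [mw wC] := vrepr_is_vrepr C.
apply/(gltP (gclass_is_repr mw) xr); exists m.+1.
have {}vm : \forall e \near 0^'+,
    forall i, `|vrepr C e 0 i| <= 2 * rho e ^+ m.+2.
  apply: filter_forall => i.
  have /is_vreprP/(_ i) vi := vC.
  have /is_vreprP/(_ i) wi := conj mw wC.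
  have /negligibleE/(_ m.+2) vw := is_repr_sub wi vi.
  near=> e.
  have H1 : `|v e 0 i| <= rho e ^+ m.+2 by near: e; exact: vm.
  have H2 : `|vrepr C e 0 i - v e 0 i| <= rho e ^+ m.+2 by near: e.
  have := ler_normD (vrepr C e 0 i - v e 0 i) (v e 0 i).
  rewrite subrK; lra.
near=> e.
have vm_e i : `|vrepr C e 0 i| <= 2 * rho e ^+ m.+2 by move: i; near: e.
have Hm_e : rho e ^+ m <= x e by near: e.
have /andP[r0 r1] : 0 < rho e < (2 * n%:R + 1)^-1.
  by near: e; apply: gauge_near; rewrite invr_gt0 ltr_wpDl ?mulr_ge0.
have /andP[_ r2] : 0 < rho e < 1 by near: e; exact: gauge_near.
apply: (le_trans _ Hm_e).
have : enorm (vrepr C e) <= n%:R * (2 * rho e ^+ m.+2).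
  apply: (le_trans (enorm_le_sum _)).
  have : \sum_(i < n) `|vrepr C e 0 i| <= \sum_(i < n) 2 * rho e ^+ m.+2.
    by apply: ler_sum.
  by move=> /le_trans; apply; rewrite sumr_const card_ord [leRHS]mulr_natl.
move=> H; apply: (le_trans (lerD H (lexx _))).
have -> : n%:R * (2 * rho e ^+ m.+2) + rho e ^+ m.+1 =
   (2 * n%:R * rho e + 1) * rho e * rho e ^+ m by rewrite !exprS; ring.
rewrite ler_piMl ?exprn_ge0 ?(ltW r0)//.
rewrite (@le_trans _ _ ((2 * n%:R + 1) * rho e))//.
  by rewrite ler_wpM2r ?(ltW r0)// lerD2r ler_piMr ?mulr_ge0// ltW.
rewrite -ler_pdivlMl ?mulr1 ?(ltW r1)// ltr_wpDl ?mulr_ge0//.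
Unshelve. all: by end_near. Qed.

End Vec.
End NetArithmetic.

(** * Partial derivatives *)

Section PartialDerivatives.
Context {R : realType}.

Lemma differentiable_littleo (V W : normedModType R) (f : V -> W)
  (df : {linear V -> W}) (x : V) :
  continuous df -> f \o shift x = cst (f x) + df +o_ 0 id ->
  differentiable f x.
Proof.
by move=> cdf H; apply/diff_locallyP; rewrite (diff_unique cdf H).
Qed.

Lemma is_derive_line (V W : normedModType R) (f : V -> W) (p v : V) (s : R) :
  derivable f (p + s *: v) v ->
  is_derive s 1 (fun s => f (p + s *: v)) ('D_v f (p + s *: v)).
Proof.
have E : (fun h : R => h^-1 *: (f (p + (h *: 1 + s) *: v) - f (p + s *: v))) =
    (fun h => h^-1 *: (f (h *: v + (p + s *: v)) - f (p + s *: v))).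
  by apply/funext => h; rewrite [h *: 1]mulr1 scalerDl addrCA.
by move=> d; apply: DeriveDef; rewrite /derivable/derive /= E.
Qed.

(** The order of [a] and [b] is left free because a coordinate of an increment may have either
    sign. *)
Lemma MVT_between (f : R -> R) (a b : R) :
  (forall c, Num.min a b <= c <= Num.max a b -> derivable f c 1) ->
  exists2 c, Num.min a b <= c <= Num.max a b & f b - f a = 'D_1 f c * (b - a).
Proof.
have key (x y : R) : x <= y -> (forall c, x <= c <= y -> derivable f c 1) ->
    exists2 c, x <= c <= y & f y - f x = 'D_1 f c * (y - x).
  move=> xy df.
  have [||c] := @MVT_segment R f ('D_1 f) x y xy.
  - move=> c /[!in_itv]/= /andP[/ltW xc /ltW cy]; apply: derivableP.
    by apply: df; rewrite xc.
  - by apply: derivable_within_continuous => c /[!in_itv]/=; exact: df.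
  - by rewrite in_itv/=; exists c.
have [ab|/ltW ba] := leP a b; first exact: key.
move=> /(key _ _ ba)[c cab E]; exists c => //.
by rewrite -opprB E -mulrN opprB.
Qed.

Section Partials.
Variable n : nat.
Implicit Types (g : 'rV[R]_n -> R) (x v : 'rV[R]_n).

Lemma coord_le_norm x i : `|x 0 i| <= `|x|.
Proof.
rewrite [leRHS]/Num.Def.normr/= mx_normrE.
by apply/bigmax_geP; right => /=; exists (0, i).
Qed.

Lemma norm_le_coord x (r : R) : 0 <= r -> (forall i, `|x 0 i| <= r) ->
  `|x| <= r.
Proof.
move=> r0 H; rewrite [leLHS]/Num.Def.normr/= mx_normrE.
by apply: bigmax_le => // -[i j] _ /=; rewrite ord1.
Qed.

(* The increment is split along the coordinate axes, one at a time. *)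
Lemma differentiable_partials g x :
  (forall i, \forall y \near x, derivable g y (delta_mx 0 i)) ->
  (forall i, {for x, continuous (fun y => 'D_(delta_mx 0 i) g y)}) ->
  differentiable g x.
Proof.
move=> dg cg.
pose D i := 'D_(delta_mx 0 i) g x.
pose L (v : 'rV[R]_n) := \sum_i v 0 i * D i.
have L_lin : linear L.
  move=> k u v; rewrite /L scaler_sumr -big_split/=; apply: eq_bigr => i _.
  by rewrite !mxE mulrDl -mulrA.
pose lL := GRing.isLinear.Build _ _ _ _ _ L_lin.
pose L' : {linear 'rV[R]_n -> R} := HB.pack L lL.
have cL : continuous L'.
  move=> v; apply: differentiable_continuous.
  rewrite (_ : (L' : _ -> _) = \sum_i (fun v : 'rV[R]_n => v 0 i * D i));
    last first.
    by apply/funext => w; rewrite fct_sumE.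
  apply: differentiable_sum => i; apply: differentiableM.
    exact: differentiable_coord.
  exact: differentiable_cst.
apply: (differentiable_littleo cL).
apply/eqaddoP => eps eps0.
(* Each of the [n] axis steps may cost [eps / n.+1] times [|h|]; the successor covers [n = 0]. *)
have eps'0 : 0 < eps / n.+1%:R by rewrite divr_gt0.
have Hn : \forall y \near x, forall i : 'I_n,
    derivable g y (delta_mx 0 i) /\
    `|'D_(delta_mx 0 i) g x - 'D_(delta_mx 0 i) g y| < eps / n.+1%:R.
  apply: (@filter_forall _ _ (fun (i : ordinal n) => _ : set _) (nbhs x)) => i;
    apply: filterI; first exact: dg.
  have := cg i; move/cvgrPdist_lt => /(_ _ eps'0); exact.
have /nbhs_normP[/= r r0 Hr] := Hn.
have h0r : \forall h \near (0 : 'rV[R]_n), `|h| < r by exact: nbhs0_lt.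
apply: filterS h0r => h hr.
pose T k : 'rV[R]_n := \row_i (if (i < k)%N then h 0 i else 0).
have Tr k : `|T k| <= `|h|.
  apply: norm_le_coord => // i; rewrite mxE; case: ifP => _.
    exact: coord_le_norm.
  by rewrite normr0.
suff : forall k, (k <= n)%N -> `|g (x + T k) - g x - L (T k)| <=
    k%:R * (eps / n.+1%:R) * `|h|.
  move=> /(_ n (leqnn n)); have -> : T n = h.
    by apply/rowP => i; rewrite mxE ltn_ord.
  have -> : (g \o shift x - (cst (g x) + L')) h = g (x + h) - g x - L h.
    by rewrite opprD addrA [x + h]addrC.
  move=> /le_trans; apply; rewrite ler_wpM2r//.
  by rewrite mulrCA ler_piMr ?(ltW eps0)// ler_pdivrMr// mul1r ler_nat.
elim=> [_|k IH kn].
  have -> : T 0%N = 0 by apply/rowP => i; rewrite !mxE.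
  by rewrite addr0 subrr /L big1 ?subr0 ?normr0 ?mul0r// => i _;
    rewrite mxE mul0r.
pose i := Ordinal kn; pose d := delta_mx 0 i : 'rV[R]_n.
have TS : T k.+1 = T k + h 0 i *: d.
  apply/rowP => j; rewrite !mxE eqxx/= ltnS leq_eqVlt.
  have [ji|ji] := eqVneq (j : nat) k.
    have -> : j = i by exact/val_inj.
    by rewrite eqxx mulr1 ltnn add0r.
  rewrite (_ : (j == i) = false) ?mulr0 ?addr0//.
  by apply/negbTE; rewrite -val_eqE.
(* In the maximum norm no point of the broken path is further from [x] than [|h|], so the bounds on
   the partial derivatives hold all along it. *)
have near_x (s : R) : Num.min 0 (h 0 i) <= s <= Num.max 0 (h 0 i) ->
    `|x - (x + T k + s *: d)| < r.
  move=> sh; apply: le_lt_trans hr.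
  rewrite -addrA opprD addNKr normrN.
  apply: norm_le_coord => // j; rewrite !mxE eqxx/=.
  have [->|ji] := eqVneq j i.
    rewrite /= ltnn mulr1 add0r; apply: le_trans (coord_le_norm h i).
    move: sh; case: (leP 0 (h 0 i)) => h0 /andP[s1 s2].
      by rewrite !ger0_norm.
    by rewrite !ler0_norm ?lerN2// ltW.
  by rewrite mulr0 addr0; have := coord_le_norm (T k) j;
    rewrite mxE => /le_trans; apply.
have [|s sh] := @MVT_between (fun s => g (x + T k + s *: d)) 0 (h 0 i).
  move=> s /near_x /Hr/(_ i)[gd _].
  by have [] := is_derive_line gd.
have [gd Dd] := Hr _ (near_x _ sh) i.
have [_ ->] := is_derive_line gd.
rewrite subr0 scale0r addr0 => E.
have LE : L (T k.+1) = L (T k) + h 0 i * D i.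
  rewrite TS; have := linearD L' (T k) (h 0 i *: d) => /= ->; congr (_ + _).
  rewrite /L (bigD1 i)//= big1 => [|j ji];
    rewrite !mxE eqxx/= ?eqxx ?mulr1 ?addr0//.
  by rewrite (negbTE ji) mulr0 mul0r.
rewrite LE TS addrA.
have -> : g (x + T k + h 0 i *: d) - g x - (L (T k) + h 0 i * D i) =
   (g (x + T k) - g x - L (T k)) +
   ('D_(delta_mx 0 i) g (x + T k + s *: d) - D i) * h 0 i.
  rewrite mulrBl -E; ring.
apply: (le_trans (ler_normD _ _)).
have -> : k.+1%:R * (eps / n.+1%:R) * `|h| =
    k%:R * (eps / n.+1%:R) * `|h| + eps / n.+1%:R * `|h|.
  by rewrite -(natr1 k); ring.
rewrite lerD ?IH ?(ltnW kn)//.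
by rewrite normrM ler_pM ?coord_le_norm// distrC ltW.
Qed.

Lemma derive_coord g x v : differentiable g x ->
  'D_v g x = \sum_i v 0 i * 'D_(delta_mx 0 i) g x.
Proof.
move=> dg; rewrite deriveE//.
rewrite [in LHS](row_sum_delta v) linear_sum; apply: eq_bigr => i _.
by rewrite linearZ/= deriveE.
Qed.

(** The scalar counterpart of [pd]: products and the mean value theorem live on scalar
    components. *)
Definition dword (s : seq 'I_n) g : 'rV[R]_n -> R :=
  foldr (fun i h x => 'D_(delta_mx 0 i) h x) g s.

Lemma dword_cat s t g : dword (s ++ t) g = dword s (dword t g).
Proof. by rewrite /dword foldr_cat. Qed.

Lemma MVT_rV g x y :
  (forall s, 0 <= s <= 1 -> differentiable g (x + s *: (y - x))) ->
  exists2 s, 0 <= s <= 1 &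
    g y - g x = \sum_i (y - x) 0 i * 'D_(delta_mx 0 i) g (x + s *: (y - x)).
Proof.
move=> dg.
have [|s] := @MVT_between (fun s => g (x + s *: (y - x))) 0 1.
  rewrite min_l// max_r// => s s01.
  by have [] := is_derive_line (diff_derivable (dg s s01) : derivable _ _ (y -
    x)).
rewrite min_l// max_r// => s01.
have [_ ->] := is_derive_line (diff_derivable (dg s s01) : derivable _ _ (y -
  x)).
rewrite scale1r scale0r addr0 [x + (y - x)]addrC subrK subr0 mulr1 derive_coord;
  last exact: dg.
by exists s.
Qed.

End Partials.

(** * Smooth maps and differentiability of their components *)

Section Smooth.
Variables n k : nat.
Implicit Types (O : set 'rV[R]_n) (f : 'rV[R]_n -> 'rV[R]_k).

Lemma pd_dword O f : open O -> smooth O f -> forall s x j, O x ->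
  pd s f x 0 j = dword s (fun y => f y 0 j) x.
Proof.
move=> oO sf; elim=> [//|i s IH] x j xO /=.
rewrite (@derive_mx R _ _ _ (pd s f)); last by have [_] := sf s x xO; apply.
rewrite mxE; apply: near_eq_derive; near=> y; apply: IH; near: y.
exact: open_nbhs_nbhs.
Unshelve. all: by end_near. Qed.

(** [smooth] speaks only of derivatives along the axes; the continuity of the next derivatives
    upgrades this to full differentiability, which the chain rule requires. *)
Lemma smooth_differentiable O f : open O -> smooth O f -> forall s x j, O x ->
  differentiable (dword s (fun y => f y 0 j)) x.
Proof.
move=> oO sf s x j xO.
have nO : nbhs x O by exact: open_nbhs_nbhs.
apply: differentiable_partials => i.
  apply: filterS nO => y yO.
  have [_ /(_ i)/derivable_mxP/(_ 0 j)] := sf s y yO.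
  apply: near_eq_derivable.
  near=> z; apply: (pd_dword oO) => //.
  near: z; exact: open_nbhs_nbhs.
have [c _] := sf (i :: s) x xO.
have c' : {for x, continuous (fun y => pd (i :: s) f y 0 j)}.
  apply: (@continuous_comp _ _ _ (pd (i :: s) f) (fun A : 'rV[R]_k => A 0 j)) =>
    //.
  exact: coord_continuous.
rewrite /prop_for /continuous_at -[X in _ --> X]/(dword (i :: s) _ x).
have nE : {near x, (fun y => pd (i :: s) f y 0 j) =1
    dword (i :: s) (fun y => f y 0 j)}.
  by apply: filterS nO => y yO; exact: (pd_dword oO).
rewrite -(pd_dword oO)//; apply: cvg_trans c'.
exact: near_eq_cvg nE.
Unshelve. all: by end_near. Qed.

Lemma differentiable_rV (V : normedModType R) (F : V -> 'rV[R]_k) x :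
  (forall j, differentiable (fun y => F y 0 j) x) -> differentiable F x.
Proof.
move=> dF.
rewrite (_ : F = \sum_j (fun y => F y 0 j *: delta_mx 0 j)); last first.
  by apply/funext => y; rewrite fct_sumE; exact: row_sum_delta.
by apply: differentiable_sum => j; exact: differentiableZl.
Qed.

Lemma differentiable_near_eq (V W : normedModType R) (f g : V -> W) x :
  (\near x, f x = g x) -> differentiable f x -> differentiable g x.
Proof.
move=> fg df; have fgx := nbhs_singleton fg.
apply: (differentiable_littleo (diff_continuous df)).
apply/eqaddoP => eps eps0.
have /eqaddoP/(_ eps eps0) := diff_locally df.
have fg' : \forall h \near 0, f (h + x) = g (h + x).
  by apply/(nbhsDl (fun y => f y = g y)); rewrite add0r.
move=> H; near=> h.
have -> : (g \o shift x - (cst (g x) + 'd f x)) h =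
          (f \o shift x - (cst (f x) + 'd f x)) h.
  by rewrite -[LHS]/(g (h + x) - (g x + _)) -fgx -(near fg' h).
by near: h.
Unshelve. all: by end_near. Qed.

Lemma differentiable_smooth O f : open O ->
  (forall s x j, O x -> differentiable (dword s (fun y => f y 0 j)) x) ->
  smooth O f.
Proof.
move=> oO df.
have dE s : (forall x, O x ->
  forall j, pd s f x 0 j = dword s (fun y => f y 0 j) x) ->
    forall x, O x -> differentiable (pd s f) x.
  move=> E x xO; apply: differentiable_rV => j.
  apply: differentiable_near_eq (df s x j xO); near=> y; rewrite E//.
  near: y; exact: open_nbhs_nbhs.
(* Both claims are proved together: the identity for a longer word differentiates [pd s f]
   componentwise, which needs its differentiability. *)
have key s : forall x, O x ->
  (forall j, pd s f x 0 j = dword s (fun y => f y 0 j) x) /\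
    differentiable (pd s f) x.
  elim: s => [|i s IH]; first by move=> x xO; split => //; exact: dE.
  have E : forall x, O x -> forall j,
    pd (i :: s) f x 0 j = dword (i :: s) (fun y => f y 0 j) x.
    move=> x xO j /=.
    rewrite (@derive_mx R _ _ _ (pd s f));
      last exact/diff_derivable/(IH x xO).2.
    rewrite mxE; apply: near_eq_derive; near=> y.
    apply: (IH _ _).1; near: y; exact: open_nbhs_nbhs.
  by move=> x xO; split; [exact: E|exact: dE].
move=> s x xO; have [_ d] := key s x xO; split.
  exact: differentiable_continuous.
by move=> i; exact: diff_derivable.
Unshelve. all: by end_near. Qed.

End Smooth.
End PartialDerivatives.

(** * Smooth nets *)

Section SmoothNets.
Context {R : realType} {rho : gauge R}.
Local Notation K := (gnum rho).

Section Algebra.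
Variable n : nat.
Implicit Types (X : set 'rV[K]_n) (O : R -> set 'rV[R]_n)
  (g h : R -> 'rV[R]_n -> R).

Definition gdomain X O := (forall e, open (O e)) /\ X `<=` internal O.

Definition moderate_on X g :=
  forall c v, X c -> is_vrepr v c -> moderate rho (fun e => g e (v e)).

Definition gsnet X O g := forall s : seq 'I_n,
  (forall e x, O e x -> differentiable (dword s (g e)) x) /\
  moderate_on X (fun e => dword s (g e)).

Lemma gsnet_moderate X O g : gsnet X O g -> moderate_on X g.
Proof. by move=> /(_ [::])[]. Qed.

Lemma gsnet_differentiable X O g e x : gsnet X O g -> O e x ->
  differentiable (g e) x.
Proof. by move=> /(_ [::])[+ _]; exact. Qed.

Lemma gsnet_dword X O g s : gsnet X O g -> gsnet X O (fun e => dword s (g e)).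
Proof.
move=> H t; have [dg mg] := H (t ++ s); split=> [e x|c v]; rewrite -?dword_cat.
  exact: dg.
by under eq_fun do rewrite -dword_cat; exact: mg.
Qed.

Lemma moderate_on_near X O g h : gdomain X O -> (forall e x, O e x ->
  g e x = h e x) ->
  moderate_on X h -> moderate_on X g.
Proof.
move=> [_ XO] gh mh c v Xc vc; apply: moderate_near_eq (mh c v Xc vc).
by apply: filterS (XO c Xc v vc) => e; exact: gh.
Qed.

(** By induction on the word, closure under a single derivation suffices, so that no higher order
    product or chain rule has to be written down. *)
Lemma derive_closed_gsnet (C : (R -> 'rV[R]_n -> R) ->
  Prop) X O : gdomain X O ->
  (forall g, C g -> [/\ forall e x, O e x -> differentiable (g e) x,
    moderate_on X g &
    forall i, exists2 g', C g' &
      forall e x, O e x -> 'D_(delta_mx 0 i) (g e) x = g' e x]) ->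
  forall g, C g -> gsnet X O g.
Proof.
move=> dXO H g Cg s; have [oO _] := dXO.
have [g' Cg' gg'] : exists2 g', C g' & forall e x, O e x ->
  dword s (g e) x = g' e x.
  elim: s => [|i s [g' Cg' gg']]; first by exists g.
  have [_ _ /(_ i)[g'' Cg'' g'g'']] := H _ Cg'; exists g'' => // e x Oex /=.
  rewrite -g'g''//; apply: near_eq_derive.
  apply: filterS (open_nbhs_nbhs (conj (oO e) Oex)) => y; exact: gg'.
have [dg' mg' _] := H _ Cg'; split; last exact: (moderate_on_near dXO gg').
move=> e x Oex; apply: differentiable_near_eq (dg' e x Oex).
by apply: filterS (open_nbhs_nbhs (conj (oO e) Oex)) => y /gg'.
Qed.

(** The algebra over the moderate constants generated by [B] and the coordinates. With an inductive
    predicate, stability under derivation only has to be checked on the generators. *)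
Inductive generated (B : (R -> 'rV[R]_n -> R) -> Prop) :
    (R -> 'rV[R]_n -> R) -> Prop :=
| generated_base g : B g -> generated B g
| generated_cst c : moderate rho c -> generated B (fun e _ => c e)
| generated_coord i : generated B (fun _ x => x 0 i)
| generated_add g h : generated B g -> generated B h ->
    generated B (fun e x => g e x + h e x)
| generated_mul g h : generated B g -> generated B h ->
    generated B (fun e x => g e x * h e x).

Lemma generated_sum B (I : Type) (r : seq I) (g : I -> R -> 'rV[R]_n -> R) :
  (forall i, generated B (g i)) ->
  generated B (fun e x => \sum_(i <- r) g i e x).
Proof.
move=> Bg; elim: r => [|i r IH].
  under eq_fun do under eq_fun do rewrite big_nil.
  exact: (generated_cst _ (moderate_cst 0)).
under eq_fun do under eq_fun do rewrite big_cons.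
exact: generated_add.
Qed.

Lemma generated_gsnet B X O : gdomain X O ->
  (forall g, B g -> [/\ forall e x, O e x -> differentiable (g e) x,
    moderate_on X g &
    forall i, exists2 g', generated B g' &
      forall e x, O e x -> 'D_(delta_mx 0 i) (g e) x = g' e x]) ->
  forall g, generated B g -> gsnet X O g.
Proof.
move=> dXO BH; apply: (derive_closed_gsnet dXO) => g; elim => {g}.
- exact: BH.
- move=> c mc; split.
  + by move=> e x _; exact: differentiable_cst.
  + by move=> ? ? _ _.
  + move=> i; exists (fun _ _ => 0);
    first exact: (generated_cst _ (moderate_cst 0)).
    by move=> e x _; rewrite -[fun=> _]/(cst (c e)) derive_cst.
- move=> j; split.
  + by move=> e x _; exact: differentiable_coord.
  + by move=> c v _ /is_vreprP/(_ j)[].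
  + move=> i; exists (fun _ _ => (j == i)%:R);
    first exact: (generated_cst _ (moderate_cst _)).
    move=> e x _; have := @derive_mx R _ 1 n id x (delta_mx 0 i) (@derivable_id
      _ _ _ _).
    by rewrite derive_id => /matrixP/(_ 0 j); rewrite !mxE eqxx => <-.
- move=> g h Bg [dg mg Dg] Bh [dh mh Dh]; split.
  + by move=> e x Oex; apply: differentiableD; [exact: dg|exact: dh].
  + by move=> c v Xc vc; apply: moderateD; [exact: mg vc|exact: mh vc].
  + move=> i; have [g' Bg' gg'] := Dg i; have [h' Bh' hh'] := Dh i.
    exists (fun e x => g' e x + h' e x); first exact: generated_add.
    move=> e x Oex; rewrite -gg'// -hh'//; apply: deriveD.
      by apply: diff_derivable; exact: dg.
    by apply: diff_derivable; exact: dh.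
- move=> g h Bg [dg mg Dg] Bh [dh mh Dh]; split.
  + by move=> e x Oex; apply: differentiableM; [exact: dg|exact: dh].
  + by move=> c v Xc vc; apply: moderateM; [exact: mg vc|exact: mh vc].
  + move=> i; have [g' Bg' gg'] := Dg i; have [h' Bh' hh'] := Dh i.
    exists (fun e x => g e x * h' e x + h e x * g' e x).
      by apply: generated_add; exact: generated_mul.
    move=> e x Oex; rewrite -gg'// -hh'//; apply: deriveM.
      by apply: diff_derivable; exact: dg.
    by apply: diff_derivable; exact: dh.
Qed.

Lemma gsnet_derive X O g i : gsnet X O g ->
  gsnet X O (fun e => 'D_(delta_mx 0 i) (g e)).
Proof. exact: (@gsnet_dword X O g [:: i]). Qed.

Lemma gsnet_base X O g : gdomain X O -> gsnet X O g ->
  [/\ forall e x, O e x -> differentiable (g e) x, moderate_on X g &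
    forall i, exists2 g', generated (gsnet X O) g' &
      forall e x, O e x -> 'D_(delta_mx 0 i) (g e) x = g' e x].
Proof.
move=> dXO gg; split; [|exact: gsnet_moderate gg|].
  by move=> e x; exact: gsnet_differentiable gg.
move=> i; exists (fun e => 'D_(delta_mx 0 i) (g e)) => //.
by apply: generated_base; exact: gsnet_derive.
Qed.

Lemma gsnet_generated X O g : gdomain X O -> generated (gsnet X O) g ->
  gsnet X O g.
Proof. by move=> dXO; apply: (generated_gsnet dXO) => {}g;
  exact: gsnet_base. Qed.

Lemma gsnetD X O g h : gdomain X O -> gsnet X O g -> gsnet X O h ->
  gsnet X O (fun e x => g e x + h e x).
Proof.
by move=> d gg gh; apply: gsnet_generated => //; apply: generated_add;
  exact: generated_base.
Qed.

Lemma gsnetM X O g h : gdomain X O -> gsnet X O g -> gsnet X O h ->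
  gsnet X O (fun e x => g e x * h e x).
Proof.
by move=> d gg gh; apply: gsnet_generated => //; apply: generated_mul;
  exact: generated_base.
Qed.

Lemma gsnet_cst X O c : gdomain X O -> moderate rho c ->
  gsnet X O (fun e _ => c e).
Proof. by move=> d mc; apply: gsnet_generated => //; exact: generated_cst. Qed.

Lemma gsnet_coord X O i : gdomain X O -> gsnet X O (fun _ x => x 0 i).
Proof. by move=> d; apply: gsnet_generated => //; exact: generated_coord. Qed.

Lemma gsnetX X O g m : gdomain X O -> gsnet X O g ->
  gsnet X O (fun e x => g e x ^+ m).
Proof.
move=> d gg; elim: m => [|m IH].
  exact: (gsnet_cst d (moderate_cst 1)).
rewrite (_ : (fun e x => g e x ^+ m.+1) = fun e x => g e x * g e x ^+ m).
  exact: gsnetM.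
by apply/funext => e; apply/funext => x; rewrite exprS.
Qed.

Lemma gsnetB X O g h : gdomain X O -> gsnet X O g -> gsnet X O h ->
  gsnet X O (fun e x => g e x - h e x).
Proof.
move=> d gg gh; apply: gsnet_generated => //; apply: generated_add.
  exact: generated_base.
under eq_fun do under eq_fun do rewrite -mulN1r.
apply: generated_mul; last exact: generated_base.
exact: (generated_cst _ (moderate_cst (-1))).
Qed.

Lemma gsnet_sum X O (I : Type) (r : seq I) (g : I -> R -> 'rV[R]_n -> R) :
  gdomain X O -> (forall i, gsnet X O (g i)) ->
  gsnet X O (fun e x => \sum_(i <- r) g i e x).
Proof.
move=> d gg; apply: gsnet_generated => //; apply: generated_sum => i.
exact: generated_base.
Qed.

Lemma gsnet_subdomain X X' O O' g : (X' `<=` X) -> (forall e, O' e `<=` O e) ->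
  gsnet X O g -> gsnet X' O' g.
Proof.
move=> XX OO H s; have [dg mg] := H s; split=> [e x /OO|c v /XX];
  [exact: dg|exact: mg].
Qed.

End Algebra.

(** * Composition of smooth nets *)

Section Composition.
Variables m n : nat.
Variables (X : set 'rV[K]_n) (O : R -> set 'rV[R]_n).
Variables (X' : set 'rV[K]_m) (O' : R -> set 'rV[R]_m).
Variables (g : R -> 'rV[R]_m -> R) (phi : 'I_m -> R -> 'rV[R]_n -> R).
Hypothesis dXO : gdomain X O.
Hypothesis gphi : forall j, gsnet X O (phi j).
Let Phi e x : 'rV[R]_m := \row_j phi j e x.
Hypothesis OO : forall e x, O e x -> O' e (Phi e x).
Hypothesis XX : forall c v, X c -> is_vrepr v c ->
  X' (vclass rho (fun e => Phi e (v e))).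

Lemma differentiable_row e x : O e x -> differentiable (Phi e) x.
Proof.
move=> Oex; apply: differentiable_rV => j.
under eq_fun do rewrite mxE.
exact: gsnet_differentiable (gphi j) Oex.
Qed.

Lemma derive_comp_row (h : 'rV[R]_m -> R) e x i : O e x ->
  differentiable h (Phi e x) ->
  'D_(delta_mx 0 i) (h \o Phi e) x =
  \sum_j 'D_(delta_mx 0 j) h (Phi e x) * 'D_(delta_mx 0 i) (phi j e) x.
Proof.
move=> Oex dh; have dP := differentiable_row Oex.
rewrite deriveE; last exact: differentiable_comp.
rewrite diff_comp//= -deriveE// -deriveE// derive_coord//;
  apply: eq_bigr => j _.
rewrite mulrC; congr (_ * _).
rewrite derive_mx; last exact: diff_derivable.
by rewrite mxE; under eq_fun do rewrite mxE.
Qed.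

Lemma row_vrepr c v : X c -> is_vrepr v c ->
  is_vrepr (fun e => Phi e (v e)) (vclass rho (fun e => Phi e (v e))).
Proof.
move=> Xc vc; split => //; apply/vmoderateP => j.
under eq_fun do rewrite mxE.
exact: gsnet_moderate (gphi j) _ _ Xc vc.
Qed.

(** By the chain rule a derivative of [dword s g] composed with [Phi] is a sum of products of such
    composites with derivatives of the [phi j]. The generators are therefore the composites for all
    words [s], together with all smooth nets on [X]. *)
Lemma gsnet_comp : gsnet X' O' g -> gsnet X O (fun e x => g e (Phi e x)).
Proof.
move=> gg.
pose B h := gsnet X O h \/ exists s, h = fun e x => dword s (g e) (Phi e x).
apply: (@generated_gsnet _ B X O dXO); last by apply: generated_base; right;
  exists [::].
move=> h [gh|[s ->]].
  have [dh mh Dh] := gsnet_base dXO gh; split => // i; have [h' _ E] := Dh i.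
  exists (fun e => 'D_(delta_mx 0 i) (h e)) => //.
  by apply: generated_base; left; exact: gsnet_derive.
have [dg mg] := gg s; split.
- move=> e x Oex; apply: (@differentiable_comp _ _ _ _ (Phi e)).
    exact: differentiable_row.
  by apply: dg; exact: OO.
- by move=> c v Xc vc; exact: mg (XX Xc vc) (row_vrepr Xc vc).
- move=> i.
  exists (fun e x => \sum_j dword (j :: s) (g e) (Phi e x) *
                           'D_(delta_mx 0 i) (phi j e) x).
    apply: generated_sum => j; apply: generated_mul; apply: generated_base.
      by right; exists (j :: s).
    by left; exact: gsnet_derive.
  move=> e x Oex; apply: derive_comp_row => //.
  by apply: dg; exact: OO.
Qed.

End Composition.

(** * Generalized smooth functions as families of scalar nets *)

Section Represents.
Variables n k : nat.
Implicit Types (X : set 'rV[K]_n) (f : 'rV[K]_n -> 'rV[K]_k)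
  (O : R -> set 'rV[R]_n) (g : 'I_k -> R -> 'rV[R]_n -> R).

Definition represents X f O g := [/\ gdomain X O, forall j, gsnet X O (g j) &
  forall c v, X c -> is_vrepr v c ->
    forall j, is_repr (fun e => g j e (v e)) (f c 0 j)].

(** [defines] guarantees openness and smoothness only for [0 < e <= 1], while [gdomain] and [gsnet]
    speak of every [e]; emptying the domain elsewhere reconciles the two. *)
Definition cut_domain O : R -> set 'rV[R]_n :=
  fun e => [set x | 0 < e <= 1 /\ O e x].

Lemma near_cut : \forall e \near (0 : R)^'+, 0 < e <= 1.
Proof. by apply: (@near_at_right0 _ _ 1) => // e /andP[-> /ltW]. Qed.

Lemma defines_represents X f O fe : defines X f O fe ->
  represents X f (cut_domain O) (fun j e x => fe e x 0 j).
Proof.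
move=> [oO XO H].
have dX : gdomain X (cut_domain O).
  split=> [e|c Xc v vc].
    have [e01|e01] := pselect (0 < e <= 1).
      rewrite (_ : cut_domain O e = O e); first exact: (oO e e01).1.
      by apply/seteqP; split => x; [case|split].
    rewrite (_ : cut_domain O e = set0); first exact: open0.
    by apply/seteqP; split => x //; case.
  by apply: filterI; [exact: near_cut|exact: XO vc].
split => //.
- move=> j s; split=> [e x [e01 Oex]|c v Xc vc].
    by have [oOe sm] := oO e e01; exact: (smooth_differentiable oOe sm).
  have [ms0 _] := H c v Xc vc; have /vmoderateP/(_ j) ms := ms0 s.
  apply: moderate_near_eq ms; apply: filterS (dX.2 c Xc v vc) => e [e01 Oe].
  by have [oOe sm] := oO e e01; rewrite (pd_dword oOe sm).
- move=> c v Xc vc j; have [mm0 ->] := H c v Xc vc; have mm := mm0 [::].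
  by have /is_vreprP := vclass_is_vrepr mm.
Qed.

Lemma represents_defines X f O g : represents X f O g ->
  defines X f O (fun e x => \row_j g j e x).
Proof.
move=> [[oO XO] gg H].
have sm e : smooth (O e) (fun x => \row_j g j e x).
  apply: differentiable_smooth => // s x j Oex.
  under [fun y => _]eq_fun do rewrite mxE.
  exact: (gg j s).1.
split=> // c v Xc vc; split=> [s|].
  apply/vmoderateP => j; apply: moderate_near_eq ((gg j s).2 c v Xc vc).
  apply: filterS (XO c Xc v vc) => e Oe.
  rewrite (pd_dword (oO e) (sm e))//.
  by under [fun y => _]eq_fun do rewrite mxE.
apply/rowP => j; rewrite mxE; have [_ <-] := H c v Xc vc j.
by under [in RHS]eq_fun do rewrite mxE.
Qed.

End Represents.
End SmoothNets.

(** * Uniform bounds along nets *)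

Section Uniformity.
Context {R : realType} {rho : gauge R}.

(* The witness at [e] is a point where [g e] exceeds the largest possible power
   of [1 / rho e] with exponent at most [1 / e]. *)
Lemma uniform_moderate (T : Type) (A : R -> set T) (g : R -> T -> R) (v0 : R ->
  T) :
  (\forall e \near 0^'+, A e (v0 e)) ->
  (forall v, (\forall e \near 0^'+, A e (v e)) ->
    moderate rho (fun e => g e (v e))) ->
  exists N : nat, \forall e \near 0^'+,
    forall y, A e y -> `|g e y| * rho e ^+ N <= 1.
Proof.
move=> Av0 H.
pose bad e n := exists2 y, A e y & 1 < `|g e y| * rho e ^+ n.
have : forall e, exists y, (A e (v0 e) -> A e y) /\
    forall n : nat, bad e n -> n%:R <= e^-1 ->
    exists2 m, (n <= m)%N & 1 < `|g e y| * rho e ^+ m.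
  move=> e.
  pose Q := fun n : nat => `[< bad e n >] && (n%:R <= e^-1).
  have [exQ|nQ] := pselect (exists n, Q n); last first.
    exists (v0 e); split => // n bn ne; exfalso; apply: nQ; exists n.
    by apply/andP; split => //; apply/asboolP.
  (* The cap [e^-1] makes a largest bad exponent exist even where [g e] is unbounded on [A e]. As it
     tends to infinity, it ends up excluding no fixed exponent. *)
  have bQ i : Q i -> (i <= Num.trunc `|e^-1|)%N.
    move=> /andP[_ ie]; rewrite -ltnS -(@ltr_nat R) (le_lt_trans ie)//.
    have /andP[_] := truncn_itv (normr_ge0 e^-1).
    exact/le_lt_trans/ler_norm.
  case: (ex_maxnP exQ bQ) => m /andP[/asboolP[y Ay ym] _] maxm.
  exists y; split => // n bn ne; exists m => //; apply: maxm.
  by apply/andP; split => //; apply/asboolP.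
move=> /choice[v Hv].
have Av : \forall e \near 0^'+, A e (v e).
  by apply: filterS Av0 => e; exact: (Hv e).1.
have /moderateE[N HN] := H v Av.
exists N; near=> e => y Ay; rewrite leNgt; apply/negP => bad_y.
have /andP[r0 r1] : 0 < rho e < 1 by near: e; exact: gauge_near.
have e0 : 0 < e by near: e; exact: nbhs_right_gt.
have Ne : N%:R <= e^-1.
  have eN : e < N.+1%:R^-1 by near: e; exact: nbhs_right_lt.
  rewrite -[leRHS]mul1r ler_pdivlMr//.
  move: eN; rewrite -[ltRHS]mul1r ltr_pdivlMr// -natr1; lra.
have [m Nm] := (Hv e).2 N (ex_intro2 _ _ y Ay bad_y) Ne.
apply/negP; rewrite -leNgt.
have HN_e : `|g e (v e)| * rho e ^+ N <= 1 by near: e.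
apply: le_trans HN_e; rewrite ler_wpM2l//.
by rewrite ler_wiXn2l ?ltW.
Unshelve. all: by end_near. Qed.

(** The hypothesis is applied to a net of counterexamples, with [v0] in their place wherever there
    is none: for [e] small the selected point satisfies [Q e], so no counterexample existed. *)
Lemma uniform_near (T : Type) (A Q : R -> set T) (v0 : R -> T) :
  (\forall e \near 0^'+, A e (v0 e)) ->
  (forall v, (\forall e \near 0^'+, A e (v e)) ->
    \forall e \near 0^'+, Q e (v e)) ->
  \forall e \near 0^'+, A e `<=` Q e.
Proof.
move=> Av0 H.
have : forall e, exists y, (A e (v0 e) -> A e y) /\ (Q e y -> A e `<=` Q e).
  move=> e; have [AQ|/existsNP[y /not_implyP[Ay nQy]]] := pselect (A e `<=` Q
    e).
    by exists (v0 e).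
  by exists y.
move=> /choice[v Hv].
have Av : \forall e \near 0^'+, A e (v e).
  by apply: filterS Av0 => e; exact: (Hv e).1.
by apply: filterS (H v Av) => e; exact: (Hv e).2.
Qed.

End Uniformity.

(** * Independence of the representative *)

Section MeanValue.
Context {R : realType} {rho : gauge R}.
Local Notation K := (gnum rho).

Lemma gdomainI n (X : set 'rV[K]_n) (O O' : R -> set 'rV[R]_n) :
  gdomain X O -> gdomain X O' -> gdomain X (fun e => O e `&` O' e).
Proof.
move=> [oO XO] [oO' XO']; split=> [e|c Xc v vc]; first exact: openI.
by apply: filterI; [exact: XO vc|exact: XO' vc].
Qed.

Lemma is_vrepr_negligible n (v w : R -> 'rV[R]_n) (c : 'rV[K]_n) :
  is_vrepr v c -> (forall i, negligible rho (fun e => w e 0 i - v e 0 i)) ->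
  is_vrepr w c.
Proof.
move=> /is_vreprP vc nw; apply/is_vreprP => i.
exact: is_repr_negligible (vc i) (nw i).
Qed.

Lemma is_vrepr_sub n (v w : R -> 'rV[R]_n) (c : 'rV[K]_n) :
  is_vrepr v c -> is_vrepr w c ->
    forall i, negligible rho (fun e => w e 0 i - v e 0 i).
Proof. by move=> /is_vreprP vc /is_vreprP wc i;
  exact: is_repr_sub (wc i) (vc i). Qed.

Lemma segment_vrepr n (v w : R -> 'rV[R]_n) (c : 'rV[K]_n) (s : R -> R) :
  is_vrepr v c -> is_vrepr w c -> (\forall e \near 0^'+, 0 <= s e <= 1) ->
  is_vrepr (fun e => v e + s e *: (w e - v e)) c.
Proof.
move=> vc wc s01; apply: (is_vrepr_negligible vc) => i.
apply: negligible_near_le (is_vrepr_sub vc wc i).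
apply: filterS s01 => e /andP[s0 s1].
by rewrite !mxE [v e 0 i + _]addrC addrK normrM ger0_norm// ler_piMl.
Qed.

(** Every net on the segments between [v] and [w] again represents [c]. Hence the segments lie in
    [O] for [e] small, and the derivatives at the mean value points are moderate, while the
    increments are negligible. *)
Lemma gsnet_repr_indep n (X : set 'rV[K]_n) (O : R -> set 'rV[R]_n) g c v w :
  gdomain X O -> gsnet X O g -> X c -> is_vrepr v c -> is_vrepr w c ->
  negligible rho (fun e => g e (w e) - g e (v e)).
Proof.
move=> [oO XO] gg Xc vc wc.
have segO : \forall e \near 0^'+,
    [set s | 0 <= s <= 1] `<=` [set s | O e (v e + s *: (w e - v e))].
  apply: (@uniform_near _ _ _ _ (fun=> 0)) => [|s s01].
    by apply: nearW => e /=; rewrite lexx ler01.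
  exact: XO _ Xc _ (segment_vrepr vc wc s01).
have : forall e, exists s, 0 <= s <= 1 /\
    ([set s | 0 <= s <= 1] `<=` [set s | O e (v e + s *: (w e - v e))] ->
     g e (w e) - g e (v e) = \sum_i (w e - v e) 0 i *
       'D_(delta_mx 0 i) (g e) (v e + s *: (w e - v e))).
  move=> e; have [sO|] := pselect ([set s | 0 <= s <= 1] `<=` [set s | O e (v e
    + s *: (w e - v e))]); last first.
    by exists 0; rewrite lexx ler01.
  have [|s s01 E] := @MVT_rV _ _ (g e) (v e) (w e).
    by move=> s /sO; exact: gsnet_differentiable gg.
  by exists s.
move=> /choice[s Hs].
have s01 : \forall e \near 0^'+, 0 <= s e <= 1 by apply: nearW => e;
  exact: (Hs e).1.
have xc := segment_vrepr vc wc s01.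
apply: (@negligible_near_eq _ _ _ (fun e => \sum_i (w e - v e) 0 i *
       'D_(delta_mx 0 i) (g e) (v e + s e *: (w e - v e)))); last first.
  apply: negligible_sum => i _; under eq_fun do rewrite mulrC.
  apply: negligibleM; first exact: (gg [:: i]).2 Xc xc.
  apply: negligible_near_eq (is_vrepr_sub vc wc i).
  by apply: nearW => e; rewrite !mxE.
by apply: filterS segO => e; exact: (Hs e).2.
Qed.

End MeanValue.

(** * Slabs *)

Section Slabs.
Context {R : realType} {rho : gauge R}.
Local Notation K := (gnum rho).
Variables (a b : K) (al be : R -> R).
Hypothesis ab : glt a b.
Hypothesis ala : is_repr al a.
Hypothesis beb : is_repr be b.
Variables (n : nat) (P : pred 'I_n).

(** Some coordinates lie in [[a, b]], the others are free. The interval, the whole line, the domain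
    of the Lagrangian and the strip of a parameter integral all have this form, so that partial
    derivatives are treated once. *)
Definition slab : set 'rV[K]_n := [set z | forall i, P i -> gitv a b (z 0 i)].

Definition box e : set 'rV[R]_n :=
  [set x | forall i, P i -> al e <= x 0 i <= be e].

Lemma gap_lt : exists p : nat, \forall e \near 0^'+, al e + rho e ^+ p <= be e.
Proof. exact/(gltP ala beb). Qed.

Lemma near_lt : \forall e \near 0^'+, al e < be e.
Proof.
have [p Hp] := gap_lt; near=> e.
have /andP[r0 _] : 0 < rho e < 1 by near: e; exact: gauge_near.
have Hp_e : al e + rho e ^+ p <= be e by near: e.
by rewrite (lt_le_trans _ Hp_e)// ltrDl exprn_gt0.
Unshelve. all: by end_near. Qed.

Lemma box_slab v c : is_vrepr v c -> (\forall e \near 0^'+, box e (v e)) ->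
  slab c.
Proof.
move=> /is_vreprP vc bv i Pi; split.
  apply/(gleP ala (vc i)) => m; near=> e.
  have /andP[r0 _] : 0 < rho e < 1 by near: e; exact: gauge_near.
  have bv_e : box e (v e) by near: e.
  by have /andP[av _] := bv_e i Pi;
    rewrite (le_trans av)// lerDl exprn_ge0// ltW.
apply/(gleP (vc i) beb) => m; near=> e.
have /andP[r0 _] : 0 < rho e < 1 by near: e; exact: gauge_near.
have bv_e : box e (v e) by near: e.
by have /andP[_ vb] := bv_e i Pi; rewrite (le_trans vb)// lerDl exprn_ge0// ltW.
Unshelve. all: by end_near. Qed.

(** A representative may leave the box by a negligible amount; clamping the coordinates in [P]
    brings it back without changing the class. *)
Lemma slab_box v c : slab c -> is_vrepr v c ->
  exists2 w, is_vrepr w c & \forall e \near 0^'+, box e (w e).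
Proof.
move=> sc vc.
exists (fun e => \row_i if P i then Num.max (al e) (Num.min (be e) (v e 0 i))
  else v e 0 i).
  apply: (is_vrepr_negligible vc) => i; apply/negligibleE => m.
  have /is_vreprP/(_ i) vi := vc.
  have [Pi|nPi] := boolP (P i); last first.
    near=> e; rewrite mxE (negbTE nPi) subrr normr0.
    have /andP[r0 _] : 0 < rho e < 1 by near: e; exact: gauge_near.
    by rewrite exprn_ge0// ltW.
  have [/(gleP ala vi)/(_ m) av /(gleP vi beb)/(_ m) vb] := sc i Pi.
  near=> e; rewrite mxE Pi.
  have /andP[r0 _] : 0 < rho e < 1 by near: e; exact: gauge_near.
  have av_e : al e <= v e 0 i + rho e ^+ m by near: e.
  have vb_e : v e 0 i <= be e + rho e ^+ m by near: e.
  have rm : 0 < rho e ^+ m by rewrite exprn_gt0.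
  have abe : al e < be e by near: e; exact: near_lt.
  have [bv|vb'] := leP (be e) (v e 0 i).
    by rewrite max_r ?(ltW abe)// distrC ger0_norm ?subr_ge0// lerBlDl.
  have [av'|va] := leP (al e) (v e 0 i); first by rewrite subrr normr0 ltW.
  by rewrite ger0_norm ?subr_ge0 ?(ltW va)// lerBlDl.
near=> e => i Pi; rewrite mxE Pi le_max lexx/= ge_max ge_min lexx/= andbT ltW//.
near: e; exact: near_lt.
Unshelve. all: by end_near. Qed.

Lemma box_segment e x y s : 0 <= s <= 1 -> box e x -> box e y ->
  box e (x + s *: (y - x)).
Proof.
move=> /andP[s0 s1] bx by_ i Pi; rewrite !mxE.
have /andP[x1 x2] := bx i Pi; have /andP[y1 y2] := by_ i Pi.
apply/andP; split; nra.
Qed.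

(** Convex, for the mean value theorem, and bounded around a moderate net, so that every net of its
    points represents a point of the slab, as the uniform bounds require. *)
Definition near_box (w : R -> 'rV[R]_n) e : set 'rV[R]_n :=
  [set y | box e y /\ forall j, `|y 0 j - w e 0 j| <= 1].

Lemma near_box_segment w e x y s : 0 <= s <= 1 -> near_box w e x ->
  near_box w e y -> near_box w e (x + s *: (y - x)).
Proof.
move=> s01 [bx xw] [by_ yw]; split; first exact: box_segment.
move=> j; have := xw j; have := yw j; rewrite !mxE !ler_norml.
move: s01 => /andP[s0 s1] /andP[y1 y2] /andP[x1 x2]; apply/andP; split; nra.
Qed.

Section NearBox.
Variables (c : 'rV[K]_n) (w : R -> 'rV[R]_n).
Hypothesis wc : is_vrepr w c.
Hypothesis bw : \forall e \near 0^'+, box e (w e).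

Lemma near_box_center : \forall e \near 0^'+, near_box w e (w e).
Proof. by apply: filterS bw => e be_; split => // j; rewrite subrr normr0. Qed.

Lemma near_box_slab v : (\forall e \near 0^'+, near_box w e (v e)) ->
  is_vrepr v (vclass rho v) /\ slab (vclass rho v).
Proof.
move=> bv; have vv : is_vrepr v (vclass rho v).
  split => //; apply/vmoderateP => j.
  have -> : (fun e => v e 0 j) = (fun e => v e 0 j - w e 0 j) + (fun e =>
    w e 0 j).
    by apply/funext => e; rewrite -[RHS]/(v e 0 j - w e 0 j + w e 0 j) subrK.
  apply: moderateD; last by have /is_vreprP/(_ j)[] := wc.
  apply: moderate_near_le (moderate_cst 1).
  by apply: filterS bv => e [_ /(_ j)]; rewrite normr1.
split => //; apply: box_slab vv _.
by apply: filterS bv => e [].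
Qed.

Lemma near_box_domain O : slab `<=` internal O ->
  \forall e \near 0^'+, near_box w e `<=` O e.
Proof.
move=> XO; apply: (uniform_near near_box_center) => v /near_box_slab[vv sv].
exact: XO sv _ vv.
Qed.

Lemma near_box_moderate g : moderate_on slab g ->
  exists N : nat, \forall e \near 0^'+,
    forall y, near_box w e y -> `|g e y| * rho e ^+ N <= 1.
Proof.
move=> mg; apply: (uniform_moderate near_box_center) => v /near_box_slab[vv sv].
exact: mg sv vv.
Qed.

(** The mean value theorem with a uniform bound on the sum of all first derivatives of all the
    [g j]; the sum lets one exponent serve every [j]. *)
Lemma near_box_lipschitz k O (g : 'I_k -> R -> 'rV[R]_n -> R) :
  gdomain slab O -> (forall j, gsnet slab O (g j)) ->
  exists N : nat, \forall e \near 0^'+,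
    forall j y z, near_box w e y -> near_box w e z ->
    `|g j e z - g j e y| * rho e ^+ N <= \sum_i `|z 0 i - y 0 i|.
Proof.
move=> dO gg.
have [N HN] : exists N : nat, \forall e \near 0^'+, forall y, near_box w e y ->
    `|\sum_j \sum_i `|'D_(delta_mx 0 i) (g j e) y| | * rho e ^+ N <= 1.
  apply: near_box_moderate => c' v Xc' vc'.
  apply: moderate_sum => j _; apply: moderate_sum => i _.
  apply: (@moderate_near_le _ _ _ (fun e => 'D_(delta_mx 0 i) (g j e) (v e))).
    by apply: nearW => e; rewrite normr_id.
  exact: (gg j [:: i]).2 Xc' vc'.
exists N; near=> e => j y z by_ bz.
have bO : near_box w e `<=` O e by near: e; apply: near_box_domain; exact: dO.2.
have HN_e : forall y, near_box w e y ->
    `|\sum_j \sum_i `|'D_(delta_mx 0 i) (g j e) y| | * rho e ^+ N <= 1 by near: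
      e.
have /andP[r0 _] : 0 < rho e < 1 by near: e; exact: gauge_near.
have [s s01|s s01 ->] := @MVT_rV _ _ (g j e) y z.
  by apply: gsnet_differentiable (gg j) _; apply: bO; exact: near_box_segment.
set x := y + _; have bx : near_box w e x by exact: near_box_segment.
set S := \sum_i `|z 0 i - y 0 i|.
have S0 : 0 <= S by apply: sumr_ge0.
have rN : 0 <= rho e ^+ N by rewrite exprn_ge0// ltW.
have step : `|\sum_i (z - y) 0 i * 'D_(delta_mx 0 i) (g j e) x| <=
    S * `|\sum_j \sum_i `|'D_(delta_mx 0 i) (g j e) x| |.
  apply: (le_trans (ler_norm_sum _ _ _)).
  rewrite /S mulr_suml; apply: ler_sum => i _.
  rewrite normrM !mxE ler_wpM2l//.
  rewrite [leRHS]ger0_norm; last by apply: sumr_ge0 => ? _; apply: sumr_ge0.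
  rewrite (bigD1 j)//= (bigD1 i)//= -addrA lerDl addr_ge0//.
    by apply: sumr_ge0.
  by apply: sumr_ge0 => ? _; apply: sumr_ge0.
apply: (le_trans (ler_wpM2r rN step)).
by rewrite -mulrA ler_piMr// HN_e.
Unshelve. all: by end_near. Qed.

End NearBox.

(* A second-order Taylor argument along an axis, with step [rho e ^+ q]. *)
Lemma derive_negligible O (h : R -> 'rV[R]_n -> R) c i v :
  gdomain slab O -> gsnet slab O h -> slab c -> is_vrepr v c ->
  (forall c v, slab c -> is_vrepr v c -> negligible rho (fun e => h e (v e))) ->
  negligible rho (fun e => 'D_(delta_mx 0 i) (h e) (v e)).
Proof.
move=> dO gh sc vc nh.
have [w wc bw] := slab_box sc vc.
suff nw : negligible rho (fun e => 'D_(delta_mx 0 i) (h e) (w e)).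
  have := negligibleD nw (gsnet_repr_indep dO (gsnet_derive i gh) sc wc vc).
  apply: negligible_near_eq; apply: nearW => e.
  by rewrite -[RHS]/('D_(delta_mx 0 i) (h e) (w e) + ('D_(delta_mx 0 i) (h e) (v
    e)
    - 'D_(delta_mx 0 i) (h e) (w e))) addrC subrK.
have [N HN] := near_box_lipschitz wc bw dO (fun _ : 'I_1 => gsnet_derive i gh).
have [p Hp] := gap_lt.
(* In the exponent of the step, [p] makes it fit into the interval, [N] pays for the Lipschitz
   constant, [m] is the order wanted, and the surplus absorbs the factors 2 and 3. *)
apply/negligibleE => m; pose q := (m + N + p + 2)%N.
(* The step goes towards the farther end, so it stays in the box even when [w] lies on its
   boundary. *)
pose sg e : R := if w e 0 i <= (al e + be e) / 2 then 1 else -1.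
pose y e := w e + (sg e * rho e ^+ q) *: delta_mx 0 i.
have yi e j : y e 0 j = w e 0 j + sg e * rho e ^+ q * (j == i)%:R.
  by rewrite !mxE eqxx.
have sg1 e : `|sg e| = 1 by rewrite /sg; case: ifP; rewrite ?normrN normr1.
have by_ : \forall e \near 0^'+, near_box w e (y e).
  near=> e.
  have bw_e : box e (w e) by near: e.
  have Hp_e : al e + rho e ^+ p <= be e by near: e.
  have /andP[r0 r1] : 0 < rho e < 2^-1 by near: e; exact: gauge_near.
  have rp : 0 < rho e ^+ p by rewrite exprn_gt0.
  have rq : 0 < rho e ^+ q by rewrite exprn_gt0.
  have rqp : 2 * rho e ^+ q <= rho e ^+ p.
    rewrite /q addn2 exprS; apply: (@le_trans _ _ (rho e ^+ (m + N + p).+1)).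
      by rewrite mulrA ler_piMl ?exprn_ge0 ?(ltW r0)//; lra.
    rewrite ler_wiXn2l ?(ltW r0)//; first lra.
    by rewrite -addnS -addSnnS leq_addl.
  split=> [j Pj|j]; rewrite yi.
    have [ji|ji] := eqVneq j i; last by rewrite mulr0 addr0; exact: bw_e.
    have := bw_e j Pj; rewrite ji mulr1 /sg => /andP[w1 w2].
    case: ifP => [wm|/negbT]; last rewrite -ltNge => wm.
      by apply/andP; split; lra.
    by apply/andP; split; lra.
  rewrite [w e 0 j + _]addrC addrK !normrM sg1 mul1r ger0_norm ?(ltW rq)//.
  rewrite mulr_ile1 ?(ltW rq)//.
    by rewrite exprn_ile1 ?(ltW r0)//; lra.
  by rewrite normr_nat lern1 leq_b1.
have [yy sy] := near_box_slab wc by_.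
(* Values of order [2 * q] over a step of order [q] leave a derivative of order [q] at the
   intermediate point. *)
have /negligibleE/(_ (2 * q)%N) hw := nh _ _ sc wc.
have /negligibleE/(_ (2 * q)%N) hy := nh _ _ sy yy.
near=> e.
have HN_e : forall (j : 'I_1) y z, near_box w e y -> near_box w e z ->
    `|'D_(delta_mx 0 i) (h e) z - 'D_(delta_mx 0 i) (h e) y| * rho e ^+ N <=
    \sum_i `|z 0 i - y 0 i| by near: e.
have hw_e : `|h e (w e)| <= rho e ^+ (2 * q) by near: e.
have hy_e : `|h e (y e)| <= rho e ^+ (2 * q) by near: e.
have by_e : near_box w e (y e) by near: e.
have bw_e : near_box w e (w e) by near: e; exact: near_box_center bw.
have bO : near_box w e `<=` O e by near: e; exact: near_box_domain wc bw _ dO.2.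
have /andP[r0 r1] : 0 < rho e < 3^-1 by near: e; apply: gauge_near.
have rq : 0 < rho e ^+ q by rewrite exprn_gt0.
have [s s01|s s01] := @MVT_rV _ _ (h e) (w e) (y e).
  by apply: gsnet_differentiable gh _; apply: bO; exact: near_box_segment.
set x := w e + _ => E; have bx : near_box w e x by exact: near_box_segment.
have {}E : h e (y e) - h e (w e) = sg e * rho e ^+ q * 'D_(delta_mx 0 i) (h e)
  x.
  rewrite E (bigD1 i)//= big1 ?addr0 => [|j ji].
    by rewrite mxE yi [X in _ + X]mxE eqxx mulr1 addrAC subrr add0r.
  by rewrite mxE yi [X in _ + X]mxE (negbTE ji) mulr0 addr0 subrr mul0r.
have Dx : `|'D_(delta_mx 0 i) (h e) x| <= 2 * rho e ^+ q.
  have : `|h e (y e) - h e (w e)| <= 2 * rho e ^+ (2 * q).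
    by apply: (le_trans (ler_normB _ _)); lra.
  rewrite E !normrM sg1 mul1r (ger0_norm (ltW rq)) mul2n -addnn exprD.
  by rewrite mulrCA ler_pM2l.
have := HN_e ord0 _ _ bx bw_e.
have xw : \sum_i0 `|w e 0 i0 - x 0 i0| <= rho e ^+ q.
  have xi j : w e 0 j - x 0 j = - (s * (sg e * rho e ^+ q * (j == i)%:R)).
    have -> : x 0 j = w e 0 j + s * (y e 0 j - w e 0 j) by rewrite !mxE.
    by rewrite yi; ring.
  rewrite (bigD1 i)//= big1 ?addr0 => [|j ji]; rewrite xi normrN.
    rewrite eqxx mulr1 !normrM sg1 mul1r (ger0_norm (ltW rq)).
    by have /andP[s0 s1] := s01; rewrite ger0_norm// ler_piMl// ltW.
  by rewrite (negbTE ji) !mulr0 normr0.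
move=> /le_trans/(_ xw) DD.
have rN : 0 < rho e ^+ N by rewrite exprn_gt0.
have rm : 0 < rho e ^+ m by rewrite exprn_gt0.
have qE : rho e ^+ q <= rho e ^+ m * rho e ^+ N * rho e.
  rewrite -exprD -exprSr ler_wiXn2l ?(ltW r0)//; first lra.
  by rewrite /q addn2 ltnS -addnS leq_addr.
have DN : `|'D_(delta_mx 0 i) (h e) (w e)| * rho e ^+ N <= rho e ^+ m * rho e ^+
  N.
  have : `|'D_(delta_mx 0 i) (h e) (w e)| <=
     `|'D_(delta_mx 0 i) (h e) (w e) - 'D_(delta_mx 0 i) (h e) x| +
     `|'D_(delta_mx 0 i) (h e) x|.
    by rewrite -[X in `|X| <= _](subrK ('D_(delta_mx 0 i) (h e) x)) ler_normD.
  move=> /(ler_wpM2r (ltW rN))/le_trans; apply; rewrite mulrDl.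
  have rN1 : rho e ^+ N <= 1 by rewrite exprn_ile1 ?(ltW r0)//; lra.
  have Dx' := ler_pM (normr_ge0 _) (ltW rN) Dx rN1.
  have : rho e ^+ m * rho e ^+ N * rho e <= rho e ^+ m * rho e ^+ N * 3^-1.
    by rewrite ler_wpM2l ?mulr_ge0 ?ltW.
  lra.
by rewrite ler_pM2r in DN.
Unshelve. all: by end_near. Qed.

End Slabs.

Lemma rVBE (V : zmodType) n (x y : 'rV[V]_n) i : (x - y) 0 i = x 0 i - y 0 i.
Proof. by rewrite !mxE. Qed.

(** * Partial derivatives at all points of a slab *)

Section PartialsOnSlabs.
Context {R : realType} {rho : gauge R}.
Local Notation K := (gnum rho).

Lemma is_vreprB n v w (c c' : 'rV[K]_n) : is_vrepr v c -> is_vrepr w c' ->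
  is_vrepr (fun e => v e - w e) (c - c').
Proof.
move=> /is_vreprP vc /is_vreprP wc; apply/is_vreprP => i; rewrite rVBE.
under eq_fun do rewrite rVBE.
exact: is_reprB.
Qed.

Variables (a b : K).
Hypothesis ab : glt a b.
Variables (n : nat) (P : pred 'I_n).
Local Notation X := (slab a b P).

(** The difference of the two nets is smooth on the common domain and has negligible values, so
    [derive_negligible] applies; the net chosen in [gpartial_int] then no longer matters. *)
Lemma represents_derive k (f : 'rV[K]_n -> 'rV[K]_k) O g O' g' i c v v' j :
  represents X f O g -> represents X f O' g' -> X c -> is_vrepr v c ->
    is_vrepr v' c ->
  negligible rho (fun e => 'D_(delta_mx 0 i) (g j e) (v e) -
                           'D_(delta_mx 0 i) (g' j e) (v' e)).
Proof.
move=> [dO gg gf] [dO' gg' gf'] Xc vc vc'.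
have dI := gdomainI dO dO'.
have gI : gsnet X (fun e => O e `&` O' e) (g j).
  by apply: gsnet_subdomain (gg j) => // e x [].
have gI' : gsnet X (fun e => O e `&` O' e) (g' j).
  by apply: gsnet_subdomain (gg' j) => // e x [].
have gB := gsnetB dI gI gI'.
have nB : negligible rho (fun e =>
    'D_(delta_mx 0 i) (fun x => g j e x - g' j e x) (v e)).
  apply: (derive_negligible ab (is_repr_repr a) (is_repr_repr b) i dI gB Xc vc).
  move=> c' w Xc' wc'; exact: is_repr_sub (gf c' w Xc' wc' j) (gf' c' w Xc' wc'
    j).
have nI := gsnet_repr_indep dI (gsnet_derive i gI') Xc vc' vc.
apply: (negligible_near_eq _ (negligibleD nB nI)).
apply: filterS (dI.2 c Xc v vc) => e Oe.
rewrite -[RHS]/('D_(delta_mx 0 i) (g j e - g' j e) (v e) +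
  ('D_(delta_mx 0 i) (g' j e) (v e) - 'D_(delta_mx 0 i) (g' j e) (v' e))).
rewrite deriveB; first by rewrite addrA subrK.
  exact: diff_derivable (gsnet_differentiable gI Oe).
exact: diff_derivable (gsnet_differentiable gI' Oe).
Qed.

Definition infinitesimal (p : nat) : K := gclass rho (fun e => rho e ^+ p).

Lemma infinitesimal_repr p : is_repr (fun e => rho e ^+ p) (infinitesimal p).
Proof. exact/gclass_is_repr/moderate_rhoX. Qed.

Lemma infinitesimal_gt0 p : glt 0 (infinitesimal p).
Proof. by apply/(glt0P (infinitesimal_repr p)); exists p; exact: nearW. Qed.

Lemma sharp_interior_sub (Y : set 'rV[K]_n) : sharp_interior Y `<=` Y.
Proof.
move=> c [r r0]; apply; rewrite /sharp_ball/=.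
have rr := is_repr_repr r; have [m Hm] := (glt0P rr).1 r0.
have cc := vrepr_is_vrepr c.
apply: (coord_gnorm_ball (is_vreprB cc cc) rr Hm) => i.
near=> e; rewrite subrr mxE normr0.
have /andP[r1 _] : 0 < rho e < 1 by near: e; exact: gauge_near.
by rewrite exprn_ge0// ltW.
Unshelve. all: by end_near. Qed.

Let al : R -> R := mnet_fun (repr a).
Let be : R -> R := mnet_fun (repr b).
Let ala : is_repr al a := is_repr_repr a.
Let beb : is_repr be b := is_repr_repr b.

Lemma sharp_interior_slab w c (p : nat) : is_vrepr w c ->
  (\forall e \near 0^'+, forall i, P i ->
    al e + rho e ^+ p <= w e 0 i <= be e - rho e ^+ p) ->
  sharp_interior X c.
Proof.
move=> wc wp; exists (infinitesimal p); first exact: infinitesimal_gt0.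
move=> z; rewrite /sharp_ball/= => zc.
have zz := vrepr_is_vrepr z.
have zw := gnorm_ball_coord (is_vreprB zz wc) (infinitesimal_repr p) zc.
have zw' : \forall e \near 0^'+, forall i,
  `|(vrepr z e - w e) 0 i| <= rho e ^+ p.
  by apply: filter_forall => i; exact: zw.
apply: (box_slab ala beb zz); near=> e => i Pi.
have wp_e : forall i, P i ->
    al e + rho e ^+ p <= w e 0 i <= be e - rho e ^+ p by near: e.
have zw_e : forall i, `|(vrepr z e - w e) 0 i| <= rho e ^+ p by near: e.
have := zw_e i; have /andP[w1 w2] := wp_e i Pi.
rewrite rVBE ler_norml => /andP[z1 z2]; apply/andP; split; lra.
Unshelve. all: by end_near. Qed.

(** Pushing the coordinates in [P] inwards gives sharply interior points arbitrarily close to any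
    point of the slab; this density makes limits along the sharp interior unique. *)
Lemma near_sharp_interior w (c : 'rV[K]_n) (q : nat) : is_vrepr w c ->
  (\forall e \near 0^'+, box al be P e (w e)) ->
  exists (c' : 'rV[K]_n) w', [/\ is_vrepr w' c', sharp_interior X c',
    \forall e \near 0^'+, box al be P e (w' e) &
    forall i, \forall e \near 0^'+, `|w' e 0 i - w e 0 i| <= rho e ^+ q].
Proof.
move=> wc bw; have [p Hp] := gap_lt ab ala beb.
(* [p] leaves room for a push at both ends, [q] bounds the displacement. *)
pose m := (p + q).+1.
pose w' e := \row_i if P i then
  Num.max (al e + rho e ^+ m) (Num.min (be e - rho e ^+ m) (w e 0 i)) else w e 0
    i.
have gap : \forall e \near 0^'+, [/\ 0 < rho e ^+ m, rho e ^+ m <= rho e ^+ q &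
    al e + 2 * rho e ^+ m <= be e].
  near=> e; have /andP[r0 r1] : 0 < rho e < 2^-1 by near: e; exact: gauge_near.
  have Hp_e : al e + rho e ^+ p <= be e by near: e.
  split; first by rewrite exprn_gt0.
    by rewrite ler_wiXn2l ?(ltW r0)//; [lra|exact/leqW/leq_addl].
  apply: le_trans Hp_e; rewrite lerD2l /m exprS mulrA.
  have : rho e ^+ (p + q) <= rho e ^+ p.
    by rewrite ler_wiXn2l ?(ltW r0)//; [lra|rewrite leq_addr].
  have : 0 < rho e ^+ (p + q) by rewrite exprn_gt0.
  nra.
have w'w : \forall e \near 0^'+, forall i,
  `|w' e 0 i - w e 0 i| <= rho e ^+ m /\
    (P i -> al e + rho e ^+ m <= w' e 0 i <= be e - rho e ^+ m).
  near=> e => i; rewrite /w' mxE.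
  have [rm rq ab_e] : [/\ 0 < rho e ^+ m, rho e ^+ m <= rho e ^+ q &
    al e + 2 * rho e ^+ m <= be e] by near: e.
  have bw_e : box al be P e (w e) by near: e.
  have [Pi|nPi] := boolP (P i); last by rewrite subrr normr0 ltW.
  have /andP[w1 w2] := bw_e i Pi.
  have [h1|h1] := leP (be e - rho e ^+ m) (w e 0 i).
    rewrite max_r; last lra.
    split; last by move=> _; apply/andP; split; lra.
    by rewrite ler_norml; apply/andP; split; lra.
  have [h2|h2] := leP (al e + rho e ^+ m) (w e 0 i).
    by rewrite subrr normr0 ltW//; split => // _; apply/andP; split; lra.
  split; last by move=> _; apply/andP; split; lra.
  by rewrite ler_norml; apply/andP; split; lra.
have w'c : is_vrepr w' (vclass rho w').
  split => //; apply/vmoderateP => j.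
  have -> : (fun e => w' e 0 j) = (fun e => w' e 0 j - w e 0 j) + (fun e =>
    w e 0 j).
    by apply/funext => e; rewrite -[RHS]/(w' e 0 j - w e 0 j + w e 0 j) subrK.
  apply: moderateD; last by have /is_vreprP/(_ j)[] := wc.
  apply: moderate_near_le (moderate_rhoX m).
  near=> e; have /andP[r0 r1] : 0 < rho e < 1 by near: e; exact: gauge_near.
  rewrite [leRHS]ger0_norm ?exprn_ge0 ?(ltW r0)//.
  have w'w_e : forall i, `|w' e 0 i - w e 0 i| <= rho e ^+ m /\
    (P i -> al e + rho e ^+ m <= w' e 0 i <= be e - rho e ^+ m) by near: e.
  exact: (w'w_e j).1.
exists (vclass rho w'), w'; split => //.
- apply: (sharp_interior_slab w'c (p := m)).
  by apply: filterS w'w => e H i; exact: (H i).2.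
- near=> e => i Pi.
  have w'w_e : forall i, `|w' e 0 i - w e 0 i| <= rho e ^+ m /\
    (P i -> al e + rho e ^+ m <= w' e 0 i <= be e - rho e ^+ m) by near: e.
  have [rm rq ab_e] : [/\ 0 < rho e ^+ m, rho e ^+ m <= rho e ^+ q &
    al e + 2 * rho e ^+ m <= be e] by near: e.
  have /andP[w1 w2] := (w'w_e i).2 Pi.
  by apply/andP; split; lra.
- move=> i; near=> e.
  have w'w_e : forall i, `|w' e 0 i - w e 0 i| <= rho e ^+ m /\
    (P i -> al e + rho e ^+ m <= w' e 0 i <= be e - rho e ^+ m) by near: e.
  have [rm rq ab_e] : [/\ 0 < rho e ^+ m, rho e ^+ m <= rho e ^+ q &
    al e + 2 * rho e ^+ m <= be e] by near: e.
  exact: le_trans (w'w_e i).1 rq.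
Unshelve. all: by end_near. Qed.

(** In the accuracy [(M + N).+1] the part [N] pays for the Lipschitz constant and the unit for the
    dimension [n]. *)
Lemma gsnet_close k O (h : 'I_k -> R -> 'rV[R]_n -> R) (c : 'rV[K]_n) w :
  gdomain X O -> (forall j, gsnet X O (h j)) -> is_vrepr w c ->
  (\forall e \near 0^'+, box al be P e (w e)) ->
  exists N : nat, forall (M : nat) w',
    (\forall e \near 0^'+, box al be P e (w' e)) ->
    (forall i, \forall e \near 0^'+,
      `|w' e 0 i - w e 0 i| <= rho e ^+ (M + N).+1) ->
    forall j, \forall e \near 0^'+, `|h j e (w' e) - h j e (w e)| <= rho e ^+ M.
Proof.
move=> dO gh wc bw.
have [N HN] := near_box_lipschitz ala beb wc bw dO gh.
exists N => M w' bw' w'w j.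
have w'w' : \forall e \near 0^'+, forall i,
  `|w' e 0 i - w e 0 i| <= rho e ^+ (M + N).+1.
  by apply: filter_forall => i; exact: w'w.
near=> e.
have /andP[r0 r1] : 0 < rho e < (n%:R + 1)^-1.
  by near: e; apply: gauge_near; rewrite invr_gt0 ltr_wpDl.
have /andP[_ r2] : 0 < rho e < 1 by near: e; exact: gauge_near.
have rN : 0 < rho e ^+ N by rewrite exprn_gt0.
have HN_e : forall (j : 'I_k) y z, near_box al be P w e y ->
  near_box al be P w e z ->
    `|h j e z - h j e y| * rho e ^+ N <= \sum_i `|z 0 i - y 0 i| by near: e.
have w'w_e : forall i, `|w' e 0 i - w e 0 i| <= rho e ^+ (M + N).+1 by near: e.
have bw_e : box al be P e (w e) by near: e.
have bw'_e : box al be P e (w' e) by near: e.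
have b1 : near_box al be P w e (w e).
  by split => // i; rewrite subrr normr0.
have b2 : near_box al be P w e (w' e).
  split => // i; apply: (le_trans (w'w_e i)).
  by rewrite exprn_ile1 ?ltW.
rewrite -(ler_pM2r rN); apply: (le_trans (HN_e j _ _ b1 b2)).
have : \sum_i `|w' e 0 i - w e 0 i| <= \sum_(i < n) rho e ^+ (M + N).+1.
  by apply: ler_sum.
move=> /le_trans; apply; rewrite sumr_const card_ord -mulr_natl exprS exprD
  mulrA.
rewrite ler_piMl ?mulr_ge0 ?exprn_ge0 ?(ltW r0)//.
have : (n%:R + 1) * rho e <= 1 by rewrite -ler_pdivlMl ?mulr1 ?(ltW r1)//
  ltr_wpDl.
by lra.
Unshelve. all: by end_near. Qed.

Section Represented.
Variables (k : nat) (f : 'rV[K]_n -> 'rV[K]_k).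
Variables (O : R -> set 'rV[R]_n) (g : 'I_k -> R -> 'rV[R]_n -> R).
Hypothesis fg : represents X f O g.
Variable i : 'I_n.

Lemma gpartial_int_repr c v j : X c -> is_vrepr v c ->
  is_repr (fun e => 'D_(delta_mx 0 i) (g j e) (v e)) (gpartial_int X f i c 0 j).
Proof.
move=> Xc vc; have [dO gg gf] := fg.
rewrite /gpartial_int; set S := (X in xget 0 X).
have /(xgetPex 0)[Q [fe [xe [df xec ->]]]] : exists y, S y.
  exists (vclass rho (fun e => pd [:: i] (fun x => \row_j g j e x) (v e))).
  exists O, (fun e x => \row_j g j e x), v; split => //.
  exact: represents_defines.
have fg' := defines_represents df.
have := represents_derive i j fg fg' Xc vc xec.
move=> nD; apply: (@is_repr_negligible _ _ (fun e => 'D_(delta_mx 0 i) (fun x =>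
  fe e x 0 j) (xe e))) => //.
have [dO' gg' _] := fg'.
have mD := (gg' j [:: i]).2 c xe Xc xec.
rewrite mxE; split; first exact: mD.
rewrite /=; apply/esym.
apply: (gclass_near mD); apply: filterS (dO'.2 c Xc xe xec) => e [e01 Oe].
case: df => /(_ e e01)[oOe sm] _ _.
exact: (pd_dword oOe sm [:: i] j Oe).
Qed.

Lemma gpartial_represents : represents X (gpartial X f i) O
  (fun j e => 'D_(delta_mx 0 i) (g j e)).
Proof.
have [dO gg gf] := fg; split => // [j|c v Xc vc]; first exact: gsnet_derive.
have [w wc bw] := slab_box ab ala beb Xc vc.
have gD j : gsnet X O (fun e =>
  'D_(delta_mx 0 i) (g j e)) by exact: gsnet_derive.
have [N HN] := gsnet_close dO gD wc bw.
have intX := @sharp_interior_sub X.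
rewrite /gpartial; case: asboolP => [ic|nic] j; first exact: gpartial_int_repr.
pose y : 'rV[K]_k := vclass rho (fun e =>
  \row_j 'D_(delta_mx 0 i) (g j e) (w e)).
have yj l : is_repr (fun e => 'D_(delta_mx 0 i) (g l e) (w e)) (y 0 l).
  split; first exact: (gD l [::]).2 Xc wc.
  by rewrite mxE; under [in RHS]eq_fun do rewrite mxE.
set S := (X in xget 0 X).
(* Outside the sharp interior [xget] must return [y]: it is a limit by the Lipschitz bound, and the
   only one because interior points come close to [c]. *)
suff Sy z : S z -> z = y.
  have /(xgetPex 0)/Sy -> : exists z, S z.
    exists y => A [r r0 rA].
    have rr := is_repr_repr r; have [m Hm] := (glt0P rr).1 r0.
    exists (infinitesimal (m.+2 + N).+1); first exact: infinitesimal_gt0.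
    move=> c' cc' ic'; apply: rA; rewrite /sharp_ball/=.
    have Xc' := intX _ ic'.
    have [w' wc' bw'] := slab_box ab ala beb Xc' (vrepr_is_vrepr c').
    have w'w l : \forall e \near 0^'+,
      `|w' e 0 l - w e 0 l| <= rho e ^+ (m.+2 + N).+1.
      have := gnorm_ball_coord (is_vreprB wc' wc) (infinitesimal_repr _) cc' l.
      by apply: filterS => e; rewrite rVBE.
    have close := HN m.+2 w' bw' w'w.
    apply: (@coord_gnorm_ball _ _ _ (fun e =>
      \row_l ('D_(delta_mx 0 i) (g l e) (w' e) -
        'D_(delta_mx 0 i) (g l e) (w e))) _ _ _ _ _ rr Hm) => [|l].
      apply/is_vreprP => l; rewrite rVBE.
      under eq_fun do rewrite mxE.
      exact: is_reprB (gpartial_int_repr l Xc' wc') (yj l).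
    by apply: filterS (close l) => e; rewrite mxE.
  apply: (is_repr_negligible (yj j)).
  exact: gsnet_repr_indep dO (gD j) Xc wc vc.
move=> Sz; apply/rowP => l; apply: (is_repr_fun_eq _ (yj l)).
have zz := is_repr_repr (z 0 l); apply: (is_repr_negligible zz).
apply/negligibleE => m.
have [r r0 rS] : sharp_nbhs c [set c' | sharp_interior X c' ->
    glt (gnorm (gpartial_int X f i c' - z)) (infinitesimal m.+1)].
  apply: (Sz [set z' | glt (gnorm (z' - z)) (infinitesimal m.+1)]).
  by exists (infinitesimal m.+1); [exact: infinitesimal_gt0|].
have rr := is_repr_repr r; have [q Hq] := (glt0P rr).1 r0.
(* The first summand brings the derivatives at [c'] within [rho ^ m.+1] of those at [c]; the second
   puts [c'] into the ball of radius [r]. *)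
have [c' [w' [wc' ic' bw' w'w]]] := near_sharp_interior ((m.+1 + N).+1 + q.+2)
  wc bw.
have r1 : \forall e \near 0^'+, 0 < rho e < 2^-1 by exact: gauge_near.
have close := HN m.+1 w' bw' _ l.
have cc' : glt (gnorm (c' - c)) r.
  apply: (coord_gnorm_ball (is_vreprB wc' wc) rr Hq) => h; near=> e.
  have w'w_e : `|w' e 0 h - w e 0 h| <= rho e ^+ ((m.+1 + N).+1 + q.+2).
    by near: e; exact: w'w.
  have /andP[r0_e r1_e] : 0 < rho e < 2^-1 by near: e.
  have r1'_e : rho e <= 1 by lra.
  rewrite rVBE; apply: le_trans w'w_e _.
  exact: (ler_wiXn2l (ltW r0_e) r1'_e (leq_addl _ _)).
have gz := rS c' cc' ic'.
pose Dw e : 'rV[R]_k := \row_j 'D_(delta_mx 0 i) (g j e) (w' e).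
have Dwc : is_vrepr Dw (gpartial_int X f i c').
  apply/is_vreprP => h; rewrite /Dw; under eq_fun do rewrite mxE.
  exact: gpartial_int_repr h (intX _ ic') wc'.
have gr := is_vreprB Dwc (vrepr_is_vrepr z).
have gzl := gnorm_ball_coord gr (infinitesimal_repr _) gz l.
near=> e.
have /andP[r0_e r1_e] : 0 < rho e < 2^-1 by near: e.
have gzl_e : `|(Dw e - vrepr z e) 0 l| <= rho e ^+ m.+1.
  by near: e.
have close_e : `|'D_(delta_mx 0 i) (g l e) (w' e) - 'D_(delta_mx 0 i) (g l e) (w
  e)|
    <= rho e ^+ m.+1.
  near: e; apply: close => h; near=> e.
  have w'w_e : `|w' e 0 h - w e 0 h| <= rho e ^+ ((m.+1 + N).+1 + q.+2).
    by near: e; exact: w'w.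
  have /andP[r0'_e r1'_e] : 0 < rho e < 2^-1 by near: e.
  have r1''_e : rho e <= 1 by lra.
  apply: le_trans w'w_e _.
  exact: (ler_wiXn2l (ltW r0'_e) r1''_e (leq_addr _ _)).
move: gzl_e; rewrite rVBE /Dw !mxE => gzl_e.
rewrite -[X in `|X|]/('D_(delta_mx 0 i) (g l e) (w e) - mnet_fun (repr (z 0 l))
  e).
rewrite -(subrKA ('D_(delta_mx 0 i) (g l e) (w' e)) ('D_(delta_mx 0 i) (g l e)
  (w e))).
apply: (le_trans (ler_normD _ _)); rewrite distrC.
have : rho e ^+ m.+1 <= 2^-1 * rho e ^+ m.
  by rewrite exprS ler_wpM2r ?exprn_ge0 ?ltW.
lra.
Unshelve. all: by end_near. Qed.

End Represented.
End PartialsOnSlabs.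

(** * Integrals of nets *)

Section RealIntegrals.
Context {R : realType}.
Local Notation mu := (@lebesgue_measure R).
Implicit Types (f g : R -> R) (a b x : R).

(** Continuity is two-sided even at the endpoints, since the nets are smooth on open sets that
    contain the closed interval for [e] small. *)
Definition continuous_on a b f := forall t, a <= t <= b ->
  {for t, continuous f}.

Lemma continuous_on_within a b f : continuous_on a b f ->
  {within `[a, b], continuous f}.
Proof.
move=> cf; apply: continuous_in_subspaceT => t /set_mem/=.
by rewrite in_itv/=; exact: cf.
Qed.

Lemma continuous_on_integrable a b f : continuous_on a b f ->
  mu.-integrable `[a, b] (EFin \o f).
Proof.
move=> /continuous_on_within; apply: continuous_compact_integrable.
exact: segment_compact.
Qed.

Lemma continuous_on_sub a b a' b' f : a' <= a -> b <= b' ->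
  continuous_on a' b' f -> continuous_on a b f.
Proof.
move=> aa bb cf t /andP[ta tb]; apply: cf.
by rewrite (le_trans aa)// (le_trans tb).
Qed.

Lemma Rintegral_itv_cst a b (r : R) : a <= b ->
  \int[mu]_(t in `[a, b]) r = r * (b - a).
Proof.
move=> ab; rewrite Rintegral_cst//= lebesgue_measure_itv/= lte_fin.
by move: ab; rewrite le_eqVlt => /predU1P[->|->//]; rewrite ltxx subrr.
Qed.

Lemma Rintegral_itv_le a b f (M : R) : a <= b -> continuous_on a b f ->
  (forall t, a <= t <= b -> `|f t| <= M) ->
  `|\int[mu]_(t in `[a, b]) f t| <= M * (b - a).
Proof.
move=> ab cf fM; rewrite -(Rintegral_itv_cst _ ab).
apply: (le_trans (le_normr_Rintegral _ (continuous_on_integrable cf))) => //.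
apply: le_Rintegral => //.
- apply: (@continuous_on_integrable _ _ (fun t => `|f t|)) => t tab.
  apply: continuous_comp; [exact: cf|exact: norm_continuous].
- by apply: (@continuous_on_integrable _ _ (fun=> M)) => t _;
  exact: cst_continuous.
Qed.

Lemma Rintegral_itv_split a x b f : a <= x <= b -> continuous_on a b f ->
  \int[mu]_(t in `[a, b]) f t =
  \int[mu]_(t in `[a, x]) f t + \int[mu]_(t in `[x, b]) f t.
Proof.
move=> /andP[ax xb] cf.
have cxb := continuous_on_sub ax (lexx b) cf.
apply/eqP; rewrite addrC -subr_eq; apply/eqP.
rewrite Rintegral_itvB ?bnd_simp//; last exact: continuous_on_integrable.
rewrite Rintegral_itv_obnd_cbnd//.
apply: integrableS (continuous_on_integrable cxb) => //.
by move=> t /=; rewrite !in_itv/= => /andP[xt ->]; rewrite (ltW xt).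
Qed.

End RealIntegrals.

(** * Integrals of negligible and of moderate nets *)

Section IntegralNets.
Context {R : realType} {rho : gauge R}.
Local Notation K := (gnum rho).
Local Notation mu := (@lebesgue_measure R).
Variables (a b : K).
Hypothesis ab : glt a b.

Section FixedBounds.
Variables (al be : R -> R).
Hypothesis ala : is_repr al a.
Hypothesis beb : is_repr be b.

Lemma interval_gitv tau : (\forall e \near 0^'+, al e <= tau e <= be e) ->
  is_repr tau (gclass rho tau) /\ gitv a b (gclass rho tau).
Proof.
move=> Ht; have mt : moderate rho tau.
  have m1 : moderate rho (fun e => `|al e| + `|be e|).
    apply: moderateD.
      by apply: moderate_near_le ala.1; apply: nearW => e; rewrite normr_id.
    by apply: moderate_near_le beb.1; apply: nearW => e; rewrite normr_id.
  apply: moderate_near_le m1; apply: filterS Ht => e /andP[t1 t2].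
  rewrite [leRHS]ger0_norm ?addr_ge0// ler_norml.
  have := ler_norm (be e); have := ler_norm (- al e); rewrite normrN.
  have := normr_ge0 (be e); have := normr_ge0 (al e).
  by move=> *; apply/andP; split; lra.
split => //; have tt := gclass_is_repr mt; split.
  apply/(gleP ala tt) => m; near=> e.
  have Ht_e : al e <= tau e <= be e by near: e.
  have /andP[r0 _] : 0 < rho e < 1 by near: e; exact: gauge_near.
  have rm : 0 < rho e ^+ m by rewrite exprn_gt0.
  by case/andP: Ht_e => *; lra.
apply/(gleP tt beb) => m; near=> e.
have Ht_e : al e <= tau e <= be e by near: e.
have /andP[r0 _] : 0 < rho e < 1 by near: e; exact: gauge_near.
have rm : 0 < rho e ^+ m by rewrite exprn_gt0.
by case/andP: Ht_e => *; lra.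
Unshelve. all: by end_near. Qed.

Lemma near_interval : \forall e \near 0^'+, al e <= al e <= be e.
Proof.
by apply: filterS (near_lt ab ala beb) => e abe; rewrite lexx ltW.
Qed.

Lemma moderate_length : moderate rho (fun e => be e - al e).
Proof. exact: (is_reprB beb ala).1. Qed.

(** The bound is first made uniform on [[al e, be e]], with [N] extra powers of [rho] to pay for the
    length of the interval, which is merely moderate. *)
Lemma integral_negligible (h : R -> R -> R) :
  (\forall e \near 0^'+, continuous_on (al e) (be e) (h e)) ->
  (forall tau, (\forall e \near 0^'+, al e <= tau e <= be e) ->
    negligible rho (fun e => h e (tau e))) ->
  negligible rho (fun e => \int[mu]_(t in `[al e, be e]) h e t).
Proof.
move=> ch nh.
have [N HN] := (moderateE _).1 moderate_length.
apply/negligibleE => m.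
have H := @uniform_near R R (fun e => [set t | al e <= t <= be e])
  (fun e => [set t | `|h e t| <= rho e ^+ (m + N)]) al near_interval _.
have {}H : \forall e \near 0^'+,
    [set t | al e <= t <= be e] `<=` [set t | `|h e t| <= rho e ^+ (m + N)].
  by apply: H => tau /nh/negligibleE; exact.
near=> e.
have /andP[r0 _] : 0 < rho e < 1 by near: e; exact: gauge_near.
have H_e : [set t | al e <= t <= be e] `<=` [set t | `|h e t| <= rho e ^+ (m +
  N)].
  by near: e.
have abe : al e < be e by near: e; exact: near_lt ab ala beb.
have HN_e : `|be e - al e| * rho e ^+ N <= 1 by near: e.
have := @Rintegral_itv_le _ (al e) (be e) (h e) (rho e ^+ (m + N)) (ltW abe).
move=> /(_ _ H_e)/le_trans; apply; first by near: e.
rewrite gtr0_norm ?subr_gt0// in HN_e.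
by rewrite exprD -mulrA ler_piMr ?exprn_ge0 ?(ltW r0)// mulrC.
Unshelve. all: by end_near. Qed.

Lemma integral_moderate (h : R -> R -> R) :
  (\forall e \near 0^'+, continuous_on (al e) (be e) (h e)) ->
  (forall tau, (\forall e \near 0^'+, al e <= tau e <= be e) ->
    moderate rho (fun e => h e (tau e))) ->
  moderate rho (fun e => \int[mu]_(t in `[al e, be e]) h e t).
Proof.
move=> ch mh.
have [N HN] := (moderateE _).1 moderate_length.
have [M HM] := @uniform_moderate R rho R (fun e => [set t | al e <= t <= be e])
  h al near_interval mh.
apply/moderateE; exists (M + N)%N; near=> e.
have /andP[r0 _] : 0 < rho e < 1 by near: e; exact: gauge_near.
have rM : 0 < rho e ^+ M by rewrite exprn_gt0.
have rN : 0 < rho e ^+ N by rewrite exprn_gt0.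
have HM_e : forall t, al e <= t <= be e ->
  `|h e t| * rho e ^+ M <= 1 by near: e.
have abe : al e < be e by near: e; exact: near_lt ab ala beb.
have HN_e : `|be e - al e| * rho e ^+ N <= 1 by near: e.
rewrite gtr0_norm ?subr_gt0// in HN_e.
have ch_e : continuous_on (al e) (be e) (h e) by near: e.
have le_int : `|\int[mu]_(t in `[al e,
  be e]) h e t| <= (rho e ^+ M)^-1 * (be e - al e).
  apply: Rintegral_itv_le => //; first exact: ltW.
  by move=> t /HM_e ht; rewrite -[leRHS]mul1r ler_pdivlMr.
rewrite exprD mulrA; apply: le_trans HN_e; rewrite ler_pM2r//.
by rewrite -ler_pdivlMr// mulrC.
Unshelve. all: by end_near. Qed.

Lemma const_slab_vrepr tau : (\forall e \near 0^'+, al e <= tau e <= be e) ->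
  is_vrepr (fun e => const_mx (tau e) : 'rV[R]_1) (const_mx (gclass rho tau)) /\
  slab a b xpredT (const_mx (gclass rho tau) : 'rV[K]_1).
Proof.
move=> /interval_gitv[tt tab]; split; last by move=> i _; rewrite mxE.
by apply/is_vreprP => i; rewrite mxE; under eq_fun do rewrite mxE.
Qed.

Lemma near_line_domain (O : R ->
  set 'rV[R]_1) : slab a b xpredT `<=` internal O ->
  \forall e \near 0^'+, forall t, al e <= t <= be e -> O e (const_mx t).
Proof.
move=> XO; apply: (@uniform_near R R (fun e => [set t | al e <= t <= be e])
  (fun e => [set t | O e (const_mx t)]) al near_interval) => tau.
move=> /const_slab_vrepr[vv sv]; exact: XO sv _ vv.
Qed.

End FixedBounds.

End IntegralNets.

(** * The generalized integral over an interval *)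

Section Lines.
Context {R : realType} {rho : gauge R}.
Local Notation K := (gnum rho).
Local Notation mu := (@lebesgue_measure R).
Variables (a b : K).
Hypothesis ab : glt a b.

Lemma line_slab : line (gitv a b) = slab a b (xpredT : pred 'I_1).
Proof.
apply/seteqP; split => x /=; first by move=> xab i _; rewrite ord1.
by move=> /(_ 0 isT).
Qed.

Lemma lineT_slab : line (setT : set K) = slab a b (pred0 : pred 'I_1).
Proof. by apply/seteqP; split => x. Qed.

Lemma lagr_dom_slab d : lagr_dom a b = slab a b (pred1 (lshift (d + d) ord0)).
Proof.
apply/seteqP; split => x; rewrite /lagr_dom/slab/= mxE.
  by move=> xab i /eqP ->.
by move=> /(_ _ (eqxx _)).
Qed.

Lemma derive_line (V : normedModType R) (f : R -> V) (x : 'rV[R]_1) i :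
  'D_(delta_mx 0 i) (fun y : 'rV[R]_1 => f (y 0 0)) x = 'D_1 f (x 0 0).
Proof.
rewrite /derive; set h1 := (fun _ : R => _); set h2 := (fun _ : R => _).
suff -> : h1 = h2 by [].
by apply/funext => h; rewrite /h1 /h2 /= !mxE ord1.
Qed.

Lemma const_mx_continuous t : {for t, continuous (fun t : R =>
  const_mx t : 'rV[R]_1)}.
Proof.
rewrite (_ : (fun t => _) = (fun t : R => t *: (const_mx 1 : 'rV[R]_1))).
  exact: scalel_continuous.
by apply/funext => s; apply/rowP => i; rewrite !mxE mulr1.
Qed.

Lemma is_derive_const_mx (f : 'rV[R]_1 ->
  R) t : differentiable f (const_mx t) ->
  is_derive t 1 (fun s => f (const_mx s)) ('D_(delta_mx 0 0) f (const_mx t)).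
Proof.
move=> df.
have E : (fun s => f (const_mx s)) = (fun s : R => f (0 + s *: delta_mx 0 0)).
  by apply/funext => s; congr f; apply/rowP => i;
    rewrite !mxE !ord1 add0r mulr1.
have E' : const_mx t = 0 + t *: delta_mx 0 0 :> 'rV[R]_1.
  by apply/rowP => i; rewrite !mxE !ord1 add0r mulr1.
rewrite E E'; apply: (@is_derive_line R _ _ f 0 (delta_mx 0 0) t).
rewrite -E'; exact: diff_derivable.
Qed.

Lemma line_continuous_on (O : set 'rV[R]_1) (f : 'rV[R]_1 -> R) al be :
  (forall t, al <= t <= be -> O (const_mx t)) ->
  (forall x, O x -> differentiable f x) ->
  continuous_on al be (fun t => f (const_mx t)).
Proof.
move=> tO df t tab; apply: (@continuous_comp _ _ _ (fun t : R =>
  const_mx t : 'rV[R]_1)).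
  exact: const_mx_continuous.
by apply: differentiable_continuous; apply: df; exact: tO.
Qed.

Local Notation X := (slab a b (xpredT : pred 'I_1)).

Section Bounds.
Variables (O : R -> set 'rV[R]_1) (g : R -> 'rV[R]_1 -> R).
Hypothesis dO : gdomain X O.
Hypothesis gg : gsnet X O g.
Local Notation I al be :=
  (fun e => \int[mu]_(t in `[al e, be e]) g e (const_mx t)).

Lemma gsnet_continuous_on al be : is_repr al a -> is_repr be b ->
  \forall e \near 0^'+, continuous_on (al e) (be e) (fun t => g e (const_mx t)).
Proof.
move=> ala beb; have := near_line_domain ab ala beb dO.2.
apply: filterS => e tO; apply: (line_continuous_on tO) => x.
exact: gsnet_differentiable gg.
Qed.

Lemma gsnet_interval_moderate al be tau : is_repr al a -> is_repr be b ->
  (\forall e \near 0^'+, al e <= tau e <= be e) ->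
  moderate rho (fun e => g e (const_mx (tau e))).
Proof.
move=> ala beb /(const_slab_vrepr ala beb)[vv sv].
exact: gsnet_moderate gg _ _ sv vv.
Qed.

Lemma integral_moderate_line al be : is_repr al a -> is_repr be b ->
  moderate rho (I al be).
Proof.
move=> ala beb; apply: (integral_moderate ab ala beb).
  exact: gsnet_continuous_on.
by move=> tau; exact: gsnet_interval_moderate.
Qed.

(** The two added pieces have negligible length, and on the wider interval a single power [rho ^- N]
    bounds the integrand. *)
Lemma integral_widen al be al1 be1 : is_repr al a -> is_repr be b ->
  is_repr al1 a -> is_repr be1 b ->
  (forall e, al1 e <= al e) -> (forall e, be e <= be1 e) ->
  negligible rho (I al1 be1 - I al be).
Proof.
move=> ala beb al1a be1b al1al bebe1.
have [N HN] := @uniform_moderate R rho R (fun e =>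
  [set t | al1 e <= t <= be1 e])
  (fun e t => g e (const_mx t)) al1 (near_interval ab al1a be1b)
  (fun tau => gsnet_interval_moderate al1a be1b).
have nd : negligible rho ((fun e => rho e ^- N) * ((al - al1) + (be1 - be))).
  apply: negligibleM; first exact: moderate_rhoV.
  by apply: negligibleD; [exact: is_repr_sub ala al1a|exact: is_repr_sub be1b
    beb].
apply: negligible_near_le nd; near=> e.
have HN_e : forall t, al1 e <= t <= be1 e ->
  `|g e (const_mx t)| * rho e ^+ N <= 1 by near: e.
have c_e : continuous_on (al1 e) (be1 e) (fun t => g e (const_mx t)).
  by near: e; exact: gsnet_continuous_on.
have abe : al e < be e by near: e; exact: near_lt ab ala beb.
have /andP[r0 _] : 0 < rho e < 1 by near: e; exact: gauge_near.
have rN : 0 < rho e ^+ N by rewrite exprn_gt0.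
have l1 := al1al e; have l2 := bebe1 e.
have ce1 : continuous_on (al e) (be1 e) (fun t => g e (const_mx t)).
  exact: continuous_on_sub c_e.
have ce2 : continuous_on (al1 e) (al e) (fun t => g e (const_mx t)).
  by apply: continuous_on_sub c_e => //; lra.
have ce3 : continuous_on (be e) (be1 e) (fun t => g e (const_mx t)).
  by apply: continuous_on_sub c_e => //; lra.
rewrite -[(I al1 be1 - I al be) e]/(\int[mu]_(t in `[al1 e,
  be1 e]) g e (const_mx t)
  - \int[mu]_(t in `[al e, be e]) g e (const_mx t)).
rewrite (@Rintegral_itv_split _ (al1 e) (al e)) //; last by apply/andP; split;
  lra.
rewrite (@Rintegral_itv_split _ (al e) (be e) (be1 e)) //; last by apply/andP;
  split; lra.
rewrite addrA addrAC addrK.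
rewrite -[X in _ <= `|X|]/(rho e ^- N * ((al e - al1 e) + (be1 e - be e))).
rewrite [leRHS]ger0_norm; last by rewrite mulr_ge0 ?invr_ge0 ?(ltW rN)//; lra.
rewrite mulrDr; apply: (le_trans (ler_normD _ _)); apply: lerD.
  apply: Rintegral_itv_le => // t /andP[t1 t2].
  by rewrite -[leRHS]mul1r ler_pdivlMr//; apply: HN_e; apply/andP; split; lra.
apply: Rintegral_itv_le => // t /andP[t1 t2].
by rewrite -[leRHS]mul1r ler_pdivlMr//; apply: HN_e; apply/andP; split; lra.
Unshelve. all: by end_near. Qed.

Lemma integral_bounds al be al' be' : is_repr al a -> is_repr be b ->
  is_repr al' a -> is_repr be' b -> negligible rho (I al be - I al' be').
Proof.
move=> ala beb ala' beb'.
(* Two representatives of a bound need not be ordered; both integrals are compared with the one over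
   the smallest interval that contains the other two. *)
pose al1 e := Num.min (al e) (al' e); pose be1 e := Num.max (be e) (be' e).
have al1a : is_repr al1 a.
  apply: (is_repr_negligible ala).
  apply: negligible_near_le (is_repr_sub ala' ala); apply: nearW => e.
  rewrite -[X in `|X| <= _]/(Num.min (al e) (al' e) - al e).
  rewrite -[X in _ <= `|X|]/(al' e - al e).
  by case: (leP (al e) (al' e)) => _; rewrite ?subrr ?normr0.
have be1b : is_repr be1 b.
  apply: (is_repr_negligible beb).
  apply: negligible_near_le (is_repr_sub beb' beb); apply: nearW => e.
  rewrite -[X in `|X| <= _]/(Num.max (be e) (be' e) - be e).
  rewrite -[X in _ <= `|X|]/(be' e - be e).
  by case: (leP (be e) (be' e)) => _; rewrite ?subrr ?normr0.
have n1 : negligible rho (I al1 be1 - I al be).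
  by apply: integral_widen => // e; rewrite ?ge_min ?le_max lexx.
have n2 : negligible rho (I al1 be1 - I al' be').
  by apply: integral_widen => // e; rewrite ?ge_min ?le_max lexx orbT.
by have := negligibleB n2 n1; rewrite opprB addrC addrA subrK.
Qed.

End Bounds.

(** Two changes separate the chosen integral from the given one, first the bounds and then the net;
    each costs a negligible amount. *)
Lemma gintegral_repr (f : K -> K) O g al be :
  represents (line (gitv a b)) (on_line (scalar f)) O g ->
  is_repr al a -> is_repr be b ->
  is_repr (fun e => \int[mu]_(t in `[al e, be e]) g ord0 e (const_mx t))
    (gintegral a b f).
Proof.
move=> fg ala beb; rewrite /gintegral; set S := (X in xget 0 X).
have /(xgetPex 0)[Q [fe [al' [be' [df ala' beb' ->]]]]] : exists y, S y.
  exists (gclass rho (fun e =>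
    \int[mu]_(t in `[al e, be e]) (\row_j g j e (const_mx t)) 0 0)).
  exists O, (fun e x => \row_j g j e x), al, be; split => //.
  exact: represents_defines.
move: df fg => /defines_represents;
  rewrite line_slab => -[dO' /(_ 0) gg' gf'] [dO /(_ 0) gg gf].
have mI := integral_moderate_line dO gg ala beb.
split => //; apply/moderate_gclass_eq => //.
  exact: (integral_moderate_line dO' gg').
have n1 := integral_bounds dO gg ala beb ala' beb'.
have n2 : negligible rho (fun e => \int[mu]_(t in `[al' e, be' e])
    (g ord0 e (const_mx t) - fe e (const_mx t) 0 0)).
  apply: (integral_negligible ab ala' beb').
    have c1 := gsnet_continuous_on dO gg ala' beb'.
    have c2 := gsnet_continuous_on dO' gg' ala' beb'.
    near=> e => t tab; apply: continuousB; last first.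
      by have := near c2 e; apply.
    by have := near c1 e; apply.
  move=> tau /(const_slab_vrepr ala' beb')[vv sv].
  exact: is_repr_sub (gf _ _ sv vv 0) (gf' _ _ sv vv 0).
have := negligibleD n1 n2; apply: negligible_near_eq; near=> e.
rewrite -[RHS]/((_ - _) + _) RintegralB//.
- by rewrite addrA subrK.
- by apply: continuous_on_integrable; near: e;
  exact: (gsnet_continuous_on dO gg ala' beb').
- by apply: continuous_on_integrable; near: e;
  exact: (gsnet_continuous_on dO' gg' ala' beb').
Unshelve. all: by end_near. Qed.

End Lines.

(** * Integrals depending on a parameter *)

Section ParameterIntegrals.
Context {R : realType} {rho : gauge R}.
Local Notation K := (gnum rho).
Local Notation mu := (@lebesgue_measure R).
Implicit Types (s t : R).

(** The coordinate [ord0] is the parameter of the variation, [ord_max] is the time. *)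
Definition pair_rV (V : Type) (s t : V) : 'rV[V]_2 :=
  \row_i if i == ord0 then s else t.

Lemma pair_rV0 (V : Type) (s t : V) : pair_rV s t 0 ord0 = s.
Proof. by rewrite mxE. Qed.

Lemma pair_rV1 (V : Type) (s t : V) : pair_rV s t 0 ord_max = t.
Proof. by rewrite mxE. Qed.

Lemma forall_I2 (Q : 'I_2 -> Prop) : Q ord0 -> Q ord_max -> forall i, Q i.
Proof.
move=> Q0 Q1 [[|[|//]] i2].
  by have -> : Ordinal i2 = ord0 by exact/val_inj.
by have -> : Ordinal i2 = ord_max by exact/val_inj.
Qed.

Lemma is_derive_pair_rV (f : 'rV[R]_2 ->
  R) s t : differentiable f (pair_rV s t) ->
  is_derive s 1 (fun s => f (pair_rV s t)) ('D_(delta_mx 0 ord0) f (pair_rV s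
    t)).
Proof.
have E r : pair_rV r t = pair_rV 0 t + r *: delta_mx 0 ord0 :> 'rV[R]_2.
  by apply/rowP; apply: forall_I2; rewrite !mxE /= ?mulr0 ?addr0 ?mulr1 ?add0r.
rewrite (_ : (fun s => _) = (fun r : R =>
  f (pair_rV 0 t + r *: delta_mx 0 ord0))); last first.
  by apply/funext => r; rewrite E.
rewrite E => df; apply: (@is_derive_line R _ _ f (pair_rV 0 t) (delta_mx 0 ord0)
  s).
exact: diff_derivable.
Qed.

Lemma pair_rV_continuous s t : {for t, continuous (fun t =>
  pair_rV s t : 'rV[R]_2)}.
Proof.
rewrite (_ : (fun t => _) =
    (fun t : R => pair_rV s 0 + t *: (delta_mx 0 ord_max : 'rV[R]_2))).
  apply: continuousD; first exact: cst_continuous.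
  exact: scalel_continuous.
by apply/funext => r; apply/rowP; apply: forall_I2;
  rewrite !mxE /= ?mulr0 ?addr0 ?mulr1 ?add0r.
Qed.

Lemma pair_continuous_on (O : set 'rV[R]_2) (f : 'rV[R]_2 -> R) s al be :
  (forall t, al <= t <= be -> O (pair_rV s t)) ->
  (forall x, O x -> differentiable f x) ->
  continuous_on al be (fun t => f (pair_rV s t)).
Proof.
move=> tO df t tab; apply: (@continuous_comp _ _ _ (fun t : R =>
  pair_rV s t : 'rV[R]_2)).
  exact: pair_rV_continuous.
by apply: differentiable_continuous; apply: df; exact: tO.
Qed.

Lemma parameter_integral (O : set 'rV[R]_2) (f : 'rV[R]_2 ->
  R) (al be s0 dl : R) :
  open O -> (forall x, O x -> differentiable f x) ->
  (forall x, O x -> {for x, continuous (fun x => 'D_(delta_mx 0 ord0) f x)}) ->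
  0 < dl -> al <= be ->
  (forall s t, s0 - dl <= s <= s0 + dl -> al <= t <= be -> O (pair_rV s t)) ->
  is_derive s0 1 (fun s => \int[mu]_(t in `[al, be]) f (pair_rV s t))
    (\int[mu]_(t in `[al, be]) 'D_(delta_mx 0 ord0) f (pair_rV s0 t)).
Proof.
move=> oO df cf dl0 albe sO.
(* A compact rectangle inside [O]; the maximum of the derivative on it is the constant that
   dominates under the integral sign. *)
pose A : set 'rV[R]_2 := [set v | forall i,
  (if i == ord0 then `[s0 - dl, s0 + dl]%classic else `[al,
    be]%classic) (v ord0 i)].
have cA : compact A.
  by apply: (@rV_compact _ _ (fun i : 'I_2 => if i == ord0 then _ else _)) => i;
    case: ifP => _; exact: segment_compact.
have AO : A `<=` O.
  move=> v Av; have := Av ord0; have := Av ord_max;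
    rewrite /= !in_itv/= => v1 v0.
  have -> : v = pair_rV (v 0 ord0) (v 0 ord_max).
    by apply/rowP; apply: forall_I2; rewrite mxE.
  exact: sO.
have Ap s t : s0 - dl <= s <= s0 + dl -> al <= t <= be -> A (pair_rV s t).
  by move=> h1 h2; apply: forall_I2; rewrite mxE /= in_itv.
have A0 : A !=set0.
  exists (pair_rV s0 al); apply: Ap; last by rewrite lexx.
  by apply/andP; split; lra.
have [M M0 HM] : exists2 M, 0 <= M & forall x, A x ->
  `|'D_(delta_mx 0 ord0) f x| <= M.
  have [|c _ Hc] := @compact_EVT_max _ R (fun x =>
    `|'D_(delta_mx 0 ord0) f x|) A A0 cA.
    apply: continuous_in_subspaceT => x /set_mem/AO Ox.
    exact: (@continuous_comp _ _ _ (fun x =>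
      'D_(delta_mx 0 ord0) f x) (fun y : R =>
        `|y|) x (cf x Ox) (@norm_continuous _ R _)).
  by exists `|'D_(delta_mx 0 ord0) f c| => // x /mem_set; exact: Hc.
have itvP s : `]s0 - dl, s0 + dl[%classic s -> s0 - dl <= s <= s0 + dl.
  by rewrite /= in_itv/= => /andP[/ltW -> /ltW ->].
have Is0 : `]s0 - dl, s0 + dl[%classic s0 by rewrite /= in_itv/=; apply/andP;
  split; lra.
have intf s : `]s0 - dl, s0 + dl[%classic s ->
    mu.-integrable `[al, be] (EFin \o (fun t => f (pair_rV s t))).
  move=> /itvP sI; apply: continuous_on_integrable.
  by apply: (pair_continuous_on (O := O)) => // t; exact: sO.
have derf s t : `]s0 - dl, s0 + dl[%classic s -> `[al, be]%classic t ->
    derivable (fun s => f (pair_rV s t)) s 1.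
  move=> /itvP sI; rewrite /= in_itv/= => tI.
  by have [] := is_derive_pair_rV (df _ (sO s t sI tI)).
have intM : mu.-integrable `[al, be] (EFin \o (fun _ : R => M)).
  by apply: (@continuous_on_integrable _ _ _ (fun=> M)) => t _;
    exact: cst_continuous.
have ubM s t : `]s0 - dl, s0 + dl[%classic s -> `[al, be]%classic t ->
    `|partial1of2 (fun s t => f (pair_rV s t)) s t| <= M.
  move=> /itvP sI; rewrite /= in_itv/= => tI.
  rewrite partial1of2E; have [_ ->] := is_derive_pair_rV (df _ (sO s t sI tI)).
  by apply: HM; exact: Ap.
have mI : measurable (`[al, be]%classic : set R) by [].
pose J s := \int[mu]_(t in `[al, be]) f (pair_rV s t).
have d1 : derivable J s0 1 := @derivable_under_integral R _ _ mu (fun s t =>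
  f (pair_rV s t)) `[al, be]%classic
  mI s0 (s0 - dl) (s0 + dl) Is0 intf derf (fun=> M) (fun=> M0) intM ubM.
have d2 : derive1 J s0 = \int[mu]_(t in `[al, be])
    partial1of2 (fun s t => f (pair_rV s t)) s0 t :=
      @differentiation_under_integral R _ _ mu (fun s t =>
        f (pair_rV s t)) `[al, be]%classic
  mI s0 (s0 - dl) (s0 + dl) Is0 intf derf (fun=> M) (fun=> M0) intM ubM.
rewrite -/J; apply: (DeriveDef d1); rewrite -derive1E d2.
apply: eq_Rintegral => t /set_mem/=; rewrite in_itv/= => tI.
rewrite partial1of2E.
by have [_ ->] := is_derive_pair_rV (df _ (sO s0 t (itvP s0 Is0) tI)).
Qed.

Variables (a b : K) (al be : R -> R).
Hypothesis ab : glt a b.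
Hypothesis ala : is_repr al a.
Hypothesis beb : is_repr be b.
Local Notation X2 := (slab a b (pred1 ord_max : pred 'I_2)).
Local Notation X1 := (slab a b (pred0 : pred 'I_1)).
Variable O : R -> set 'rV[R]_2.
Hypothesis dO : gdomain X2 O.

(** The parameters whose whole time segment lies in [O e]; the interior is taken because domains
    must be open. *)
Definition parameter_domain e : set 'rV[R]_1 :=
  interior [set x : 'rV[R]_1 | al e < be e /\ forall t, al e <= t <= be e ->
    O e (pair_rV (x 0 0) t)].

Lemma pair_slab (c : 'rV[K]_1) (v : R -> 'rV[R]_1) y tau : is_vrepr v c ->
  (\forall e \near 0^'+, `|y e - v e 0 0| <= 1) ->
  (\forall e \near 0^'+, al e <= tau e <= be e) ->
  let w := fun e => pair_rV (y e) (tau e) in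
  is_vrepr w (vclass rho w) /\ X2 (vclass rho w).
Proof.
move=> vc yv tab w; have [tt gt] := interval_gitv ala beb tab.
have my : moderate rho y.
  have -> : y = (fun e => y e - v e 0 0) + (fun e => v e 0 0).
    by apply/funext => e; rewrite -[RHS]/(y e - v e 0 0 + v e 0 0) subrK.
  apply: moderateD; last by have /is_vreprP/(_ 0)[] := vc.
  apply: moderate_near_le (moderate_cst 1).
  by apply: filterS yv => e; rewrite normr1.
split.
  split => //; apply/vmoderateP; apply: forall_I2.
    by under eq_fun do rewrite pair_rV0.
  by under eq_fun do rewrite pair_rV1; exact: tt.1.
move=> i /eqP ->; rewrite mxE.
by under eq_fun do rewrite pair_rV1.
Qed.

(** Uniformity over the unit interval of parameters around [v e] and over all times at once puts a
    full neighbourhood of [v e] into the set, hence [v e] into its interior. *)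
Lemma gdomain_parameter : gdomain X1 parameter_domain.
Proof.
split=> [e|c Xc v vc]; first exact: open_interior.
have H : \forall e \near 0^'+,
  [set q : R * R | `|q.1 - v e 0 0| <= 1 /\ al e <= q.2 <= be e]
    `<=` [set q | O e (pair_rV q.1 q.2)].
  apply: (@uniform_near _ _ _ _ (fun e => (v e 0 0, al e))).
    apply: filterS (near_lt ab ala beb) => e abe /=.
    by split; [rewrite subrr normr0|rewrite lexx ltW].
  move=> q qA.
  have [||ww Xw] := @pair_slab c v (fun e => (q e).1) (fun e => (q e).2) vc.
  - by apply: filterS qA => e [].
  - by apply: filterS qA => e [].
  exact: dO.2 Xw _ ww.
near=> e.
have H_e : [set q : R * R | `|q.1 - v e 0 0| <= 1 /\ al e <= q.2 <= be e]
    `<=` [set q | O e (pair_rV q.1 q.2)] by near: e.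
have : \forall x \near (v e), al e < be e /\
    forall t, al e <= t <= be e -> O e (pair_rV ((x : 'rV[R]_1) 0 0) t);
      last by [].
apply/nbhs_normP; exists 1 => //= x xv; split.
  by near: e; exact: near_lt ab ala beb.
move=> t tab; apply: (H_e (x 0 0, t)); split => //=.
have := coord_le_norm (v e - x) 0; rewrite rVBE distrC => /le_trans; apply.
exact: ltW.
Unshelve. all: by end_near. Qed.

Lemma is_derive_parameter_integral G e x : gsnet X2 O G ->
  parameter_domain e x ->
  is_derive (x 0 0) 1
    (fun s => \int[mu]_(t in `[al e, be e]) G e (pair_rV s t))
    (\int[mu]_(t in `[al e, be e]) 'D_(delta_mx 0 ord0) (G e) (pair_rV (x 0 0)
      t)).
Proof.
move=> gG; move=> /nbhs_normP[/= dl dl0 H].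
have [abe _] : al e < be e /\ forall t, al e <= t <= be e ->
  O e (pair_rV (x 0 0) t).
  by apply: H => /=; rewrite subrr normr0.
apply: (@parameter_integral (O e) (G e) _ _ _ (dl / 2)) => //.
- exact: dO.1.
- by move=> y; exact: gsnet_differentiable gG.
- move=> y Oy; apply: differentiable_continuous.
  exact: gsnet_differentiable (gsnet_derive ord0 gG) Oy.
- by rewrite divr_gt0.
- exact: ltW.
- move=> s t /andP[s1 s2] tab.
  have /= [|_] := H (const_mx s); last by move=> /(_ t tab); rewrite mxE.
  apply: (@le_lt_trans _ _ (dl / 2)); last lra.
  apply: norm_le_coord; first by rewrite divr_ge0 ?ltW.
  move=> i; rewrite rVBE !mxE !ord1 ler_norml; apply/andP; split; lra.
Qed.

Lemma derive_parameter_integral G e x i : gsnet X2 O G ->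
  parameter_domain e x ->
  'D_(delta_mx 0 i) (fun x : 'rV[R]_1 =>
     \int[mu]_(t in `[al e, be e]) G e (pair_rV (x 0 0) t)) x =
  \int[mu]_(t in `[al e, be e]) 'D_(delta_mx 0 ord0) (G e) (pair_rV (x 0 0) t).
Proof.
move=> gG Jx; have [_ <-] := is_derive_parameter_integral gG Jx.
exact: (derive_line (fun s => \int[mu]_(t in `[al e, be e]) G e (pair_rV s t))).
Qed.

(** Parameter integrals form a class closed under derivation: differentiation passes to the
    integrand, which remains a smooth net. *)
Lemma gsnet_parameter_integral G : gsnet X2 O G ->
  gsnet X1 parameter_domain
    (fun e x => \int[mu]_(t in `[al e, be e]) G e (pair_rV (x 0 0) t)).
Proof.
move=> gG.
pose C (h : R -> 'rV[R]_1 -> R) := exists2 G, gsnet X2 O G &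
  h = fun e x => \int[mu]_(t in `[al e, be e]) G e (pair_rV (x 0 0) t).
apply: (@derive_closed_gsnet _ _ _ C _ _ gdomain_parameter); last by exists G.
move=> _ [{gG}G gG ->].
have dG e x := @is_derive_parameter_integral G e x gG.
split.
- move=> e x Jx; apply: (@differentiable_comp _ _ _ _ (fun x : 'rV[R]_1 =>
  x 0 0)
    (fun s => \int[mu]_(t in `[al e, be e]) G e (pair_rV s t))).
    exact: differentiable_coord.
  by apply/derivable1_diffP; have [] := dG e x Jx.
- move=> c v Xc vc.
  have Hd := gdomain_parameter.2 c Xc v vc.
  apply: (integral_moderate ab ala beb).
    apply: filterS Hd => e /interior_subset[abe HO].
    by apply: (pair_continuous_on HO) => x; exact: gsnet_differentiable gG.
  move=> tau tab.
  have [||ww Xw] := @pair_slab c v (fun e => v e 0 0) tau vc.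
  - by apply: nearW => e; rewrite subrr normr0.
  - by [].
  exact: gsnet_moderate gG _ _ Xw ww.
- move=> i; exists (fun e x => \int[mu]_(t in `[al e, be e])
    'D_(delta_mx 0 ord0) (G e) (pair_rV (x 0 0) t)).
    by exists (fun e => 'D_(delta_mx 0 ord0) (G e)) => //; exact: gsnet_derive.
  move=> e x Jx.
  exact: derive_parameter_integral.
Qed.

End ParameterIntegrals.

(** * Lagrangians along curves *)

Section MoreNets.
Context {R : realType} {rho : gauge R}.
Local Notation K := (gnum rho).
Local Notation mu := (@lebesgue_measure R).

Lemma represents_sub n k (X X' : set 'rV[K]_n) (f : 'rV[K]_n -> 'rV[K]_k) O g :
  X' `<=` X -> represents X f O g -> represents X' f O g.
Proof.
move=> XX [[oO XO] gg gf]; split.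
- by split => // c /XX; exact: XO.
- by move=> j; apply: gsnet_subdomain XX _ (gg j) => e x.
- by move=> c v /XX; exact: gf.
Qed.

Lemma represents_eq n k (X : set 'rV[K]_n) (f f' : 'rV[K]_n -> 'rV[K]_k) O g :
  (forall c, X c -> f c = f' c) -> represents X f O g -> represents X f' O g.
Proof.
move=> ff [dO gg gf]; split => // c v Xc vc; rewrite -ff//; exact: gf.
Qed.

Lemma const_mx_vrepr (t : K) tau : is_repr tau t ->
  is_vrepr (fun e => const_mx (tau e) : 'rV[R]_1) (const_mx t).
Proof.
by move=> tt; apply/is_vreprP => i; rewrite mxE; under eq_fun do rewrite mxE.
Qed.

Lemma gdomain_preimage m n (X : set 'rV[K]_n) (O : R -> set 'rV[R]_n)
  (X' : set 'rV[K]_m) (O' : R -> set 'rV[R]_m) (phi : 'I_m -> R -> 'rV[R]_n ->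
    R) :
  gdomain X O -> gdomain X' O' -> (forall j, gsnet X O (phi j)) ->
  (forall c v, X c -> is_vrepr v c ->
    X' (vclass rho (fun e => \row_j phi j e (v e)))) ->
  gdomain X (fun e => [set x | O e x /\ O' e (\row_j phi j e x)]).
Proof.
move=> dO dO' gphi XX; split=> [e|c Xc v vc].
  rewrite openE => x [Ox O'x].
  have nO : nbhs x (O e) by apply: open_nbhs_nbhs; split => //; exact: dO.1.
  have nO' : nbhs (\row_j phi j e x) (O' e).
    by apply: open_nbhs_nbhs; split => //; exact: dO'.1.
  have cphi := differentiable_continuous (differentiable_row gphi Ox).
  by apply: filterI => //; exact: cphi nO'.
apply: filterI; first exact: dO.2 Xc _ vc.
exact: dO'.2 (XX c v Xc vc) _ (row_vrepr gphi Xc vc).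
Qed.

Lemma Rintegral_derive (f f' : R -> R) (al be : R) : al < be ->
  (forall t, al <= t <= be -> is_derive t 1 f (f' t)) ->
    continuous_on al be f' ->
  \int[mu]_(t in `[al, be]) f' t = f be - f al.
Proof.
move=> albe df cf'.
have cf : continuous_on al be f.
  move=> t /df d; apply: differentiable_continuous.
  by apply/derivable1_diffP; case: d.
rewrite /Rintegral (@continuous_FTC2 _ f' f)//.
- exact: continuous_on_within.
- split.
  + by move=> t; rewrite in_itv/= => /andP[/ltW t1 /ltW t2]; have [] := df t;
    rewrite ?t1.
  + by apply: cvg_at_right_filter; apply: cf; rewrite lexx ltW.
  + by apply: cvg_at_left_filter; apply: cf; rewrite lexx ltW.
- move=> t; rewrite in_itv/= => /andP[/ltW t1 /ltW t2]; rewrite derive1E.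
  by have [|_ ->] := df t; rewrite ?t1.
Qed.

Lemma derive_addZ (V : normedModType R) (f g : V -> R) (k : R) x v :
  derivable f x v -> derivable g x v ->
  'D_v (fun y => f y + k * g y) x = 'D_v f x + k * 'D_v g x.
Proof.
move=> df dg.
have -> : (fun y => f y + k * g y) = f + k *: g by [].
rewrite deriveD; [congr (_ + _); exact: deriveZ|exact: df|exact: derivableZ].
Qed.

Lemma uncurried_point d (F : K -> 'rV[K]_d -> 'rV[K]_d -> K) t x v :
  uncurried F (point t x v) = const_mx (F t x v).
Proof. by rewrite /uncurried /point row_mxKl row_mxKr row_mxKl row_mxKr mxE.
  Qed.

Variables (a b : K).
Hypothesis ab : glt a b.

Lemma gderiv_represents k (J : set K) (P : pred 'I_1) (u : K -> 'rV[K]_k) O g :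
  line J = slab a b P -> represents (line J) (on_line u) O g ->
  represents (line J) (on_line (gderiv J u)) O
    (fun j e => 'D_(delta_mx 0 ord0) (g j e)).
Proof.
move=> JP; rewrite /gderiv JP => ug.
apply: represents_eq (gpartial_represents ab ug ord0) => c Xc.
rewrite /on_line; congr (gpartial _ _ _ _).
by apply/rowP => i; rewrite mxE ord1.
Qed.

End MoreNets.

(** * Substitution of curves into the variables of the Lagrangian *)

Section LagrangianPaths.
Context {R : realType} {rho : gauge R}.
Local Notation K := (gnum rho).
Variable d : nat.

(** The layout of [point], but over any type, so that it serves real and generalized coordinates
    alike. *)
Definition lagr_path (V : Type) (t : V) (p q : 'I_d ->
  V) : 'rV[V]_(1 + (d + d)) :=
  row_mx (const_mx t) (row_mx (\row_j p j) (\row_j q j)).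

Lemma forall_lagr (Q : 'I_(1 + (d + d)) -> Prop) :
  Q (lshift (d + d) ord0) -> (forall j, Q (rshift 1 (lshift d j))) ->
  (forall j, Q (rshift 1 (rshift d j))) -> forall k, Q k.
Proof.
move=> Q0 Q1 Q2 k; case: (split_ordP k) => [i|i] ->; first by rewrite ord1.
by case: (split_ordP i) => j ->.
Qed.

Lemma lagr_path0 (V : Type) (t : V) p q : lagr_path t p q 0 (lshift (d + d)
  ord0) = t.
Proof. by rewrite row_mxEl mxE. Qed.

Lemma lagr_path1 (V : Type) (t : V) p q j :
  lagr_path t p q 0 (rshift 1 (lshift d j)) = p j.
Proof. by rewrite row_mxEr row_mxEl mxE. Qed.

Lemma lagr_path2 (V : Type) (t : V) p q j :
  lagr_path t p q 0 (rshift 1 (rshift d j)) = q j.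
Proof. by rewrite row_mxEr row_mxEr mxE. Qed.

Lemma point_lagr_path (t : K) (x v : 'rV[K]_d) :
  point t x v = lagr_path t (x 0) (v 0).
Proof.
apply/rowP; apply: forall_lagr => [|j|j].
- by rewrite lagr_path0 row_mxEl mxE.
- by rewrite lagr_path1 row_mxEr row_mxEl.
- by rewrite lagr_path2 row_mxEr row_mxEr.
Qed.

Lemma lagr_path_vrepr (t : K) (x v : 'rV[K]_d) (tau : R -> R) (p q : 'I_d ->
  R -> R) :
  is_repr tau t -> (forall j, is_repr (p j) (x 0 j)) ->
    (forall j, is_repr (q j) (v 0 j)) ->
  is_vrepr (fun e => lagr_path (tau e) (p ^~ e) (q ^~ e)) (point t x v :
    'rV[K]_(1 + (d + d))).
Proof.
move=> tt px qv; rewrite point_lagr_path; apply/is_vreprP;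
  apply: forall_lagr => [|j|j].
- by rewrite lagr_path0; under eq_fun do rewrite lagr_path0.
- by rewrite lagr_path1; under eq_fun do rewrite lagr_path1; exact: px.
- by rewrite lagr_path2; under eq_fun do rewrite lagr_path2; exact: qv.
Qed.

Lemma gsnet_lagr_path n (X : set 'rV[K]_n) O tau (p q : 'I_d -> R -> 'rV[R]_n ->
  R) :
  gsnet X O tau -> (forall j, gsnet X O (p j)) -> (forall j, gsnet X O (q j)) ->
  forall k, gsnet X O (fun e x =>
    lagr_path (tau e x) (fun j => p j e x) (fun j => q j e x) 0 k).
Proof.
move=> gt gp gq; apply: forall_lagr => [|j|j].
- by under eq_fun do under eq_fun do rewrite lagr_path0.
- by under eq_fun do under eq_fun do rewrite lagr_path1; exact: gp.
- by under eq_fun do under eq_fun do rewrite lagr_path2; exact: gq.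
Qed.

Variables (a b : K).
Hypothesis ab : glt a b.

Section Composite.
Variables (OF : R -> set 'rV[R]_(1 + (d + d))).
Hypothesis dOF : gdomain (lagr_dom a b) OF.
Variables (n : nat) (X : set 'rV[K]_n) (O : R -> set 'rV[R]_n).
Hypothesis dO : gdomain X O.
Variables (tau : R -> 'rV[R]_n -> R) (p q : 'I_d -> R -> 'rV[R]_n -> R).
Hypotheses (gtau : gsnet X O tau) (gp : forall j, gsnet X O (p j))
  (gq : forall j, gsnet X O (q j)).
Hypothesis tab : forall c v, X c -> is_vrepr v c ->
  gitv a b (gclass rho (fun e => tau e (v e))).

Definition path_net e x := lagr_path (tau e x) (fun j => p j e x) (fun j =>
  q j e x).

Definition path_domain e := [set x | O e x /\ OF e (path_net e x)].

Let phi k e x := path_net e x 0 k.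

Lemma path_netE e x : \row_k phi k e x = path_net e x.
Proof. by apply/rowP => k; rewrite mxE. Qed.

Lemma path_lagr c v : X c -> is_vrepr v c ->
  lagr_dom a b (vclass rho (fun e => path_net e (v e))).
Proof.
move=> Xc vc; rewrite /lagr_dom/= !mxE.
by under eq_fun do rewrite lagr_path0; exact: tab vc.
Qed.

Let gphi k : gsnet X O (phi k).
Proof. exact: gsnet_lagr_path. Qed.

Lemma gdomain_path : gdomain X path_domain.
Proof.
have := gdomain_preimage dO dOF gphi; rewrite /path_domain => H.
have {H} : gdomain X (fun e => [set x | O e x /\ OF e (\row_k phi k e x)]).
  apply: H => c v Xc vc; under eq_fun do rewrite path_netE; exact: path_lagr vc.
congr (gdomain _ _); apply/funext => e; apply/seteqP; split => x /=;
  rewrite path_netE//.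
Qed.

Lemma gsnet_path h : gsnet (lagr_dom a b) OF h ->
  gsnet X path_domain (fun e x => h e (path_net e x)).
Proof.
move=> gh.
have gphi' k : gsnet X path_domain (phi k).
  by apply: gsnet_subdomain (gphi k) => // e x [].
have := @gsnet_comp R rho _ _ X path_domain (lagr_dom a b) OF h phi gdomain_path
  gphi'.
under [X in _ -> _ -> _ -> gsnet _ _ X]eq_fun do under eq_fun do rewrite
  path_netE.
apply => //.
  by move=> e x [_]; rewrite path_netE.
by move=> c v Xc vc; under eq_fun do rewrite path_netE; exact: path_lagr vc.
Qed.

Lemma derive_path (h : 'rV[R]_(1 + (d + d)) -> R) e x i : O e x ->
  differentiable h (path_net e x) ->
  'D_(delta_mx 0 i) (fun x => h (path_net e x)) x =
  'D_(delta_mx 0 (lshift (d + d) ord0)) h (path_net e x) * 'D_(delta_mx 0 i)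
    (tau e) x +
  (\sum_j 'D_(delta_mx 0 (rshift 1 (lshift d j))) h (path_net e x) *
            'D_(delta_mx 0 i) (p j e) x +
   \sum_j 'D_(delta_mx 0 (rshift 1 (rshift d j))) h (path_net e x) *
            'D_(delta_mx 0 i) (q j e) x).
Proof.
move=> Oex dh.
have E : (fun x => h (path_net e x)) = h \o (fun x => \row_k phi k e x).
  by apply/funext => y; rewrite /= path_netE.
rewrite E (derive_comp_row gphi i Oex) ?path_netE//.
have E0 : phi (lshift (d + d) ord0) e = tau e.
  by apply/funext => y; rewrite /phi lagr_path0.
have E1 j : phi (rshift 1 (lshift d j)) e = p j e.
  by apply/funext => y; rewrite /phi lagr_path1.
have E2 j : phi (rshift 1 (rshift d j)) e = q j e.
  by apply/funext => y; rewrite /phi lagr_path2.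
rewrite big_split_ord big_ord1 big_split_ord /= E0.
by congr (_ + (_ + _)); apply: eq_bigr => j _; rewrite (E1, E2).
Qed.

End Composite.
End LagrangianPaths.

(** * The first variation *)

Section FirstVariation.
Context {R : realType} {rho : gauge R}.
Local Notation K := (gnum rho).
Local Notation mu := (@lebesgue_measure R).

Lemma gdomainT n (X : set 'rV[K]_n) : gdomain X (fun=> setT).
Proof. by split=> [e|c _ v _]; [exact: openT|exact: nearW]. Qed.

Variables (d : nat) (a b : K).
Variables (F : K -> 'rV[K]_d -> 'rV[K]_d -> K) (u : K -> 'rV[K]_d).
Variables (OF : R -> set 'rV[R]_(1 + (d + d))) (Fn : R ->
  'rV[R]_(1 + (d + d)) -> R).
Variables (Ou : R -> set 'rV[R]_1) (un : 'I_d -> R -> 'rV[R]_1 -> R).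
Hypothesis ab : glt a b.
Hypothesis hF : represents (lagr_dom a b) (uncurried F) OF (fun _ : 'I_1 => Fn).
Hypothesis hu : represents (line (gitv a b)) (on_line u) Ou un.
Local Notation X1 := (line (gitv a b)).
Local Notation D0 f := ('D_(delta_mx 0 (ord0 : 'I_1)) f).
Local Notation du := (gderiv (gitv a b) u).

Let dOF : gdomain (lagr_dom a b) OF. Proof. by case: hF. Qed.
Let gF : gsnet (lagr_dom a b) OF Fn. Proof. by case: hF => _ /(_ ord0). Qed.

Lemma gpartial_lagr k (f : 'rV[K]_(1 + (d + d)) -> 'rV[K]_k) O g i :
  represents (lagr_dom a b) f O g ->
  represents (lagr_dom a b) (gpartial (lagr_dom a b) f i) O
    (fun j e => 'D_(delta_mx 0 i) (g j e)).
Proof. by rewrite lagr_dom_slab => fg; exact (gpartial_represents ab fg i). Qed.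

Lemma gderiv_curve k (w : K -> 'rV[K]_k) O g :
  represents X1 (on_line w) O g ->
  represents X1 (on_line (gderiv (gitv a b) w)) O (fun j e => D0 (g j e)).
Proof. exact (@gderiv_represents _ _ a b ab k _ xpredT w O g (line_slab a b)).
  Qed.

Let tau (e : R) (x : 'rV[R]_1) := x 0 0.

Lemma line_gitv c v : X1 c -> is_vrepr v c ->
  gitv a b (gclass rho (fun e => tau e (v e))).
Proof.
by move=> Xc /is_vreprP/(_ 0)[_ E]; rewrite /tau E.
Qed.

Lemma gsnet_tau O : gdomain X1 O -> gsnet X1 O tau.
Proof. exact: gsnet_coord. Qed.

Section Curves.
Variables (w : K -> 'rV[K]_d) (O : R -> set 'rV[R]_1) (wn : 'I_d -> R ->
  'rV[R]_1 -> R).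
Hypothesis hw : represents X1 (on_line w) O wn.

Definition curve_path := path_net tau wn (fun j e => D0 (wn j e)).
Definition curve_domain := path_domain OF O tau wn (fun j e => D0 (wn j e)).

Let dO : gdomain X1 O. Proof. by case: hw. Qed.
Let gw j : gsnet X1 O (wn j). Proof. by case: hw. Qed.
Let gdw j : gsnet X1 O (fun e => D0 (wn j e)). Proof. exact: gsnet_derive. Qed.

Lemma gdomain_curve : gdomain X1 curve_domain.
Proof.
exact (gdomain_path dOF dO (gsnet_tau dO) gw gdw line_gitv).
Qed.

Lemma gsnet_curve h : gsnet (lagr_dom a b) OF h ->
  gsnet X1 curve_domain (fun e x => h e (curve_path e x)).
Proof.
exact (gsnet_path dOF dO (gsnet_tau dO) gw gdw line_gitv (h := h)).
Qed.

Lemma curve_vrepr c v : X1 c -> is_vrepr v c ->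
  is_vrepr (fun e => curve_path e (v e))
    (point (c 0 0) (w (c 0 0)) (gderiv (gitv a b) w (c 0 0))).
Proof.
move=> Xc vc; apply: lagr_path_vrepr.
- by have /is_vreprP/(_ 0) := vc.
- by move=> j; case: hw => _ _ /(_ c v Xc vc j).
- by move=> j; case: (gderiv_curve hw) => _ _ /(_ c v Xc vc j).
Qed.

Lemma composite_represents k (h : 'rV[K]_(1 + (d + d)) -> 'rV[K]_k) hn :
  represents (lagr_dom a b) h OF hn ->
  represents X1
    (on_line (fun t => h (point t (w t) (gderiv (gitv a b) w t)))) curve_domain
    (fun j e x => hn j e (curve_path e x)).
Proof.
move=> [_ gh hh]; split; first exact: gdomain_curve.
  by move=> j; exact: gsnet_curve.
move=> c v Xc vc j; apply: hh (curve_vrepr Xc vc) j.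
by rewrite /lagr_dom/= /point row_mxKl mxE.
Qed.

End Curves.

Definition grad2_net j e x :=
  'D_(delta_mx 0 (rshift 1 (lshift d j))) (Fn e) (curve_path un e x).
Definition grad3_net j e x :=
  'D_(delta_mx 0 (rshift 1 (rshift d j))) (Fn e) (curve_path un e x).
Definition euler_net j e x := grad2_net j e x - D0 (grad3_net j e) x.
Local Notation O1 := (curve_domain Ou un).

Lemma grad2_represents :
  represents X1 (on_line (fun t => grad2 a b F t (u t) (du t))) O1 grad2_net.
Proof.
split; first exact: gdomain_curve hu.
  by move=> j; exact (gsnet_curve hu (gsnet_derive (rshift 1 (lshift d j)) gF)).
move=> c v Xc vc j; rewrite /on_line mxE.
by case: (composite_represents hu (gpartial_lagr (rshift 1 (lshift d j)) hF)) =>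
  _ _ /(_ c v Xc vc 0).
Qed.

Lemma grad3_represents :
  represents X1 (on_line (fun t => grad3 a b F t (u t) (du t))) O1 grad3_net.
Proof.
split; first exact: gdomain_curve hu.
  by move=> j; exact (gsnet_curve hu (gsnet_derive (rshift 1 (rshift d j)) gF)).
move=> c v Xc vc j; rewrite /on_line mxE.
by case: (composite_represents hu (gpartial_lagr (rshift 1 (rshift d j)) hF)) =>
  _ _ /(_ c v Xc vc 0).
Qed.

Lemma gsnet_euler j : gsnet X1 O1 (euler_net j).
Proof.
have [dO g2 _] := grad2_represents; have [_ g3 _] := grad3_represents.
by apply: gsnetB => //; exact: gsnet_derive.
Qed.

Lemma euler_repr t ta j : gitv a b t -> is_repr ta t ->
  is_repr (fun e => euler_net j e (const_mx (ta e)))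
    ((grad2 a b F t (u t) (du t)
      - gderiv (gitv a b) (fun t' => grad3 a b F t' (u t') (du t')) t) 0 j).
Proof.
move=> tab tt; have vv := const_mx_vrepr tt.
have Xc : X1 (const_mx t : 'rV[K]_1) by rewrite /line/= mxE.
have [_ _ /(_ _ _ Xc vv j) r2] := grad2_represents.
have [_ _ /(_ _ _ Xc vv j) r3] := gderiv_curve grad3_represents.
have E : (const_mx t : 'rV[K]_1) 0 0 = t by rewrite mxE.
by rewrite /on_line E in r2 r3; rewrite rVBE; exact (is_reprB r2 r3).
Qed.

(** * Variation in the direction of a test function *)

Section TestFunction.
Variables (eta : K -> 'rV[K]_d) (Oe : R -> set 'rV[R]_1) (en : 'I_d -> R ->
  'rV[R]_1 -> R).
Hypothesis heta : represents (line (setT : set K)) (on_line eta) Oe en.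
Hypotheses (etaa : eta a = 0) (etab : eta b = 0).
Variables (al be : R -> R).
Hypothesis ala : is_repr al a.
Hypothesis beb : is_repr be b.

Let heta1 : represents X1 (on_line eta) Oe en.
Proof. exact: represents_sub heta. Qed.

Let Oc e := Ou e `&` Oe e.
Let dOc : gdomain X1 Oc.
Proof. by apply: gdomainI; [case: hu|case: heta1]. Qed.
Let gun j : gsnet X1 Oc (un j).
Proof. by case: hu => _ /(_ j) + _; apply: gsnet_subdomain => // e x []. Qed.
Let gen j : gsnet X1 Oc (en j).
Proof. by case: heta1 => _ /(_ j) + _; apply: gsnet_subdomain => // e x []. Qed.

Section Shifted.
Variables (s : K) (sg : R -> R).
Hypothesis sgs : is_repr sg s.

(** The parameter is a net, because [first_variation] differentiates in a generalized variable and
    the action is needed at every generalized number [s]. *)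
Definition shifted_net j e x := un j e x + sg e * en j e x.

Lemma shifted_represents :
  represents X1 (on_line (fun t => u t + s *: eta t)) Oc shifted_net.
Proof.
split => // [j|c v Xc vc j].
  apply: gsnetD => //; apply: gsnetM => //; apply: gsnet_cst => //;
    exact: sgs.1.
rewrite /on_line !mxE; apply: is_reprD.
  by case: hu => _ _ /(_ c v Xc vc j).
by apply: is_reprM => //; case: heta1 => _ _ /(_ c v Xc vc j).
Qed.

Lemma derive_shifted j e x : Oc e x ->
  D0 (shifted_net j e) x = D0 (un j e) x + sg e * D0 (en j e) x.
Proof.
move=> Ox; have du_ := diff_derivable (gsnet_differentiable (gun j) Ox) :
  derivable _ _ (delta_mx 0 ord0).
have de := diff_derivable (gsnet_differentiable (gen j) Ox) : derivable _ _
  (delta_mx 0 ord0).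
exact (derive_addZ (sg e) du_ de).
Qed.

Lemma action_repr : is_repr
  (fun e => \int[mu]_(t in `[al e, be e])
     Fn e (curve_path shifted_net e (const_mx t)))
  (action a b F (fun t => u t + s *: eta t)).
Proof.
pose w t := u t + s *: eta t.
have H := composite_represents shifted_represents hF.
have H' : represents X1 (on_line (scalar (fun t =>
  F t (w t) (gderiv (gitv a b) w t))))
    (curve_domain Oc shifted_net) (fun (_ : 'I_1) e x =>
      Fn e (curve_path shifted_net e x)).
  apply: represents_eq H => c Xc; apply/rowP => j.
  by rewrite /on_line uncurried_point.
exact (gintegral_repr ab H' ala beb).
Qed.

End Shifted.

Let row2 (x : 'rV[R]_2) : 'rV[R]_1 := \row__ x 0 ord_max.
(** The conjunct [setT x] gives the domain the preimage form produced by [gdomain_preimage]. *)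
Let base2 e := [set x : 'rV[R]_2 | setT x /\ Oc e (row2 x)].
Local Notation X2 := (slab a b (pred1 ord_max : pred 'I_2)).

Let row2_pair s t : row2 (pair_rV s t) = const_mx t.
Proof. by apply/rowP => i; rewrite mxE pair_rV1 mxE. Qed.

Let gcoord2 i O : gdomain X2 O -> gsnet X2 O (fun _ x => x 0 i).
Proof. exact: gsnet_coord. Qed.

Let row2_X1 c v : X2 c -> is_vrepr v c -> X1 (vclass rho (fun e => row2 (v e))).
Proof.
move=> /(_ ord_max (eqxx _)) Xc /is_vreprP/(_ ord_max)[_ E].
by rewrite /line/= mxE; under eq_fun do rewrite mxE; rewrite E.
Qed.

Let dbase2 : gdomain X2 base2.
Proof.
exact: (gdomain_preimage (gdomainT X2) dOc (fun _ =>
  gcoord2 ord_max (gdomainT X2)) row2_X1).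
Qed.

Let glift h : gsnet X1 Oc h -> gsnet X2 base2 (fun e x => h e (row2 x)).
Proof.
move=> gh; refine (gsnet_comp dbase2 (fun _ =>
  gcoord2 ord_max dbase2) _ row2_X1 gh).
by move=> e x [].
Qed.

Let tau2 (e : R) (x : 'rV[R]_2) := x 0 ord_max.
Let p2 j e (x : 'rV[R]_2) := un j e (row2 x) + x 0 ord0 * en j e (row2 x).
(** The velocity is written as [u' + s eta'] from the start, which makes it visibly affine in [s];
    [derive_shifted] identifies it with the derivative of the shifted curve. *)
Let q2 j e (x : 'rV[R]_2) := D0 (un j e) (row2 x) + x 0 ord0 * D0 (en j e) (row2
  x).

Let gshift f g : gsnet X1 Oc f -> gsnet X1 Oc g ->
  gsnet X2 base2 (fun e x => f e (row2 x) + x 0 ord0 * g e (row2 x)).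
Proof.
move=> gf gg; apply: (gsnetD dbase2 (glift gf)).
exact: (gsnetM dbase2 (gcoord2 ord0 dbase2) (glift gg)).
Qed.

Let gp2 j : gsnet X2 base2 (p2 j). Proof. exact: (gshift (gun j) (gen j)). Qed.
Let gq2 j : gsnet X2 base2 (q2 j).
Proof. exact: (gshift (gsnet_derive ord0 (gun j)) (gsnet_derive ord0 (gen j))).
  Qed.

Let path2 := path_net tau2 p2 q2.
Let O2 := path_domain OF base2 tau2 p2 q2.

Let tab2 c v : X2 c -> is_vrepr v c ->
  gitv a b (gclass rho (fun e => tau2 e (v e))).
Proof.
by move=> /(_ ord_max (eqxx _)) Xc /is_vreprP/(_ ord_max)[_ E]; rewrite /tau2 E.
Qed.

Let dO2 : gdomain X2 O2.
Proof. exact (gdomain_path dOF dbase2 (gcoord2 ord_max dbase2) gp2 gq2 tab2).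
  Qed.

Let G e x := Fn e (path2 e x).

Let gG : gsnet X2 O2 G.
Proof. exact (gsnet_path dOF dbase2 (gcoord2 ord_max dbase2) gp2 gq2 tab2 gF).
  Qed.

Let path2_shifted sg e t : Oc e (const_mx t) ->
  path2 e (pair_rV (sg e) t) = curve_path (shifted_net sg) e (const_mx t).
Proof.
move=> Ot; apply/rowP; apply: forall_lagr => [|j|j].
- by rewrite !lagr_path0 /tau2 pair_rV1 /tau mxE.
- by rewrite !lagr_path1 /p2 row2_pair pair_rV0.
- by rewrite !lagr_path2 /q2 row2_pair pair_rV0 derive_shifted.
Qed.

Let path2_0 e t : path2 e (pair_rV 0 t) = curve_path un e (const_mx t).
Proof.
apply/rowP; apply: forall_lagr => [|j|j].
- by rewrite !lagr_path0 /tau2 pair_rV1 /tau mxE.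
- by rewrite !lagr_path1 /p2 row2_pair pair_rV0 mul0r addr0.
- by rewrite !lagr_path2 /q2 row2_pair pair_rV0 mul0r addr0.
Qed.

Let derive_affine (f : 'rV[R]_2 -> R) s t (k l : R) :
  differentiable f (pair_rV s t) -> (forall r, f (pair_rV r t) = k + r * l) ->
  'D_(delta_mx 0 ord0) f (pair_rV s t) = l.
Proof.
move=> df fE; have [_ <-] := is_derive_pair_rV df.
rewrite (_ : (fun r => f (pair_rV r t)) = (fun r => cst k r + l * id r));
  last first.
  by apply/funext => r; rewrite fE mulrC.
rewrite derive_addZ; [|exact: derivable_cst|exact: derivable_id].
by rewrite derive_cst derive_id add0r mulr1.
Qed.

Let derive_path2 e t : Oc e (const_mx t) -> O2 e (pair_rV 0 t) ->
  'D_(delta_mx 0 ord0) (G e) (pair_rV 0 t) =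
  \sum_j (grad2_net j e (const_mx t) * en j e (const_mx t) +
          grad3_net j e (const_mx t) * D0 (en j e) (const_mx t)).
Proof.
move=> Ot [Bt Ft].
have dF : differentiable (Fn e) (path2 e (pair_rV 0 t)) by exact:
  gsnet_differentiable gF Ft.
rewrite /G (derive_path (gcoord2 ord_max dbase2) gp2 gq2 ord0 Bt dF).
rewrite (@derive_affine (tau2 e) 0 t t 0); last 2 first.
- exact: gsnet_differentiable (gcoord2 ord_max dbase2) Bt.
- by move=> r; rewrite /tau2 pair_rV1 mulr0 addr0.
rewrite mulr0 add0r -big_split; apply: eq_bigr => j _ /=.
rewrite (@derive_affine (p2 j e) 0 t (un j e (const_mx t)) (en j e (const_mx
  t))); last 2 first.
- exact: gsnet_differentiable (gp2 j) Bt.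
- by move=> r; rewrite /p2 row2_pair pair_rV0.
rewrite (@derive_affine (q2 j e) 0 t (D0 (un j e) (const_mx t)) (D0 (en j e)
  (const_mx t))); last 2 first.
- exact: gsnet_differentiable (gq2 j) Bt.
- by move=> r; rewrite /q2 row2_pair pair_rV0.
by rewrite -[path_net _ _ _ _ _]/(path2 e _) path2_0.
Qed.

Let near_Oc : \forall e \near 0^'+, forall t, al e <= t <= be e ->
  Oc e (const_mx t).
Proof. by apply: (near_line_domain ab ala beb); rewrite -line_slab;
  exact: dOc.2. Qed.

Let J e (x : 'rV[R]_1) := \int[mu]_(t in `[al e, be e]) G e (pair_rV (x 0 0) t).
Let OJ := parameter_domain al be O2.

(** Turns the action along the family into a smooth net in [s], so that its generalized derivative
    at [0] is read off [J]. *)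
Let action_represents : represents (line (setT : set K))
  (on_line (scalar (fun s => action a b F (fun t => u t + s *: eta t)))) OJ
  (fun _ : 'I_1 => J).
Proof.
rewrite (lineT_slab a b); split.
- exact: (gdomain_parameter ab ala beb dO2).
- by move=> _; exact: (gsnet_parameter_integral ab ala beb dO2 gG).
move=> c v _ vc j; rewrite /on_line /scalar mxE.
have /is_vreprP/(_ 0) v0 := vc.
apply: is_repr_near (action_repr v0) _.
apply: filterS near_Oc => e Oce; apply: eq_Rintegral => t /set_mem/=.
by rewrite in_itv/= => /Oce Ot;
  rewrite /G (path2_shifted (fun e => v e 0 0) Ot).
Qed.

(** The boundary expression of the integration by parts. *)
Let W e x := \sum_j grad3_net j e x * en j e x.
Let O3 e := O1 e `&` Oc e.

Let dO3 : gdomain X1 O3.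
Proof. by apply: gdomainI => //; exact: gdomain_curve hu. Qed.

Let gen3 j : gsnet X1 O3 (en j).
Proof. by apply: gsnet_subdomain (gen j) => // e x []. Qed.

Let ggrad3 j : gsnet X1 O3 (grad3_net j).
Proof. by case: grad3_represents => _ /(_ j) + _;
  apply: gsnet_subdomain => // e x []. Qed.

Let geuler j : gsnet X1 O3 (euler_net j).
Proof. by apply: gsnet_subdomain (gsnet_euler j) => // e x []. Qed.

Let gprod j : gsnet X1 O3 (fun e x => grad3_net j e x * en j e x).
Proof. exact: gsnetM. Qed.

Let gW : gsnet X1 O3 W.
Proof. exact: gsnet_sum. Qed.

Let derive_W e x : O3 e x -> D0 (W e) x =
  \sum_j (grad3_net j e x * D0 (en j e) x + en j e x * D0 (grad3_net j e) x).
Proof.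
move=> Ox.
rewrite (_ : W e = \sum_j (grad3_net j e * en j e)); last first.
  by apply/funext => y; rewrite fct_sumE.
rewrite derive_sum => [|j];
  last exact: diff_derivable (gsnet_differentiable (gprod j) Ox).
apply: eq_bigr => j _; apply: deriveM.
  exact: diff_derivable (gsnet_differentiable (ggrad3 j) Ox).
exact: diff_derivable (gsnet_differentiable (gen3 j) Ox).
Qed.

(* Integration by parts; the boundary terms are negligible. *)
Lemma first_variation_repr : is_repr
  (fun e => \int[mu]_(t in `[al e, be e])
     \sum_j euler_net j e (const_mx t) * en j e (const_mx t))
  (first_variation a b F u eta).
Proof.
have z0 := const_mx_vrepr (@is_repr0 R rho).
have [dJ _ /(_ (const_mx 0) _ I z0 0)] :=
  gderiv_represents ab (lineT_slab a b) action_represents.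
rewrite /on_line [X in gderiv _ _ X]mxE -/(first_variation a b F u eta) => r.
apply: is_repr_negligible r _.
(* At an endpoint each summand of [W] is a moderate factor times a net that represents a component
   of [eta c = 0]. *)
have nW ta c : is_repr ta c -> gitv a b c -> eta c = 0 ->
    negligible rho (fun e => W e (const_mx (ta e))).
  move=> tc cab etac; have vv := const_mx_vrepr tc.
  have Xc : X1 (const_mx c : 'rV[K]_1) by rewrite /line/= mxE.
  apply: negligible_sum => j _; apply: negligibleM.
    exact: gsnet_moderate (ggrad3 j) _ _ Xc vv.
  apply/is_repr0E; case: heta1 => _ _ /(_ _ _ Xc vv j).
  by rewrite /on_line [X in eta X]mxE etac mxE.
have aab : gitv a b a /\ gitv a b b.
  have lt := near_lt ab ala beb.
  have nlt : \forall e \near 0^'+, al e <= al e <= be e.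
    by apply: filterS lt => e /ltW ->; rewrite lexx.
  have nlt' : \forall e \near 0^'+, al e <= be e <= be e.
    by apply: filterS lt => e /ltW ->; rewrite lexx.
  have [_ ga] := interval_gitv ala beb nlt.
  have [_ gb] := interval_gitv ala beb nlt'.
  by rewrite ala.2 in ga; rewrite beb.2 in gb.
have nWW := negligibleB (nW al a ala aab.1 etaa) (nW be b beb aab.2 etab).
apply: negligible_near_eq nWW.
have XO3 : slab a b (xpredT : pred 'I_1) `<=` internal O3.
  by rewrite -line_slab; exact: dO3.2.
have nO3 := near_line_domain ab ala beb XO3.
have J0 : \forall e \near 0^'+, OJ e (const_mx 0).
  by have [[_ /(_ (const_mx 0) I _ z0)]] := action_represents.
near=> e.
have O3e : forall t, al e <= t <= be e -> O3 e (const_mx t) by near: e.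
have J0_e : OJ e (const_mx 0) by near: e.
have abe : al e < be e by near: e; exact: near_lt ab ala beb.
have O2e t : al e <= t <= be e -> O2 e (pair_rV 0 t).
  have [_ H] := interior_subset J0_e.
  by move=> tab; have := H t tab; rewrite mxE.
have cont h : gsnet X1 O3 h ->
  continuous_on (al e) (be e) (fun t => h e (const_mx t)).
  move=> gh; apply: (line_continuous_on O3e) => x;
    exact: gsnet_differentiable gh.
have gS : gsnet X1 O3 (fun e x => \sum_j euler_net j e x * en j e x).
  by apply: gsnet_sum => // j; exact: gsnetM.
have gDW : gsnet X1 O3 (fun e => D0 (W e)) by exact: gsnet_derive.
set S := fun e => \int[mu]_(t in `[al e, be e]) \sum_j _.
rewrite -[LHS]/(S e - D0 (J e) (const_mx 0)) -[RHS]/(W e (const_mx (al e)) - W e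
  (const_mx (be e))) /S.
have -> : D0 (J e) (const_mx 0) =
   \int[mu]_(t in `[al e, be e]) 'D_(delta_mx 0 ord0) (G e) (pair_rV 0 t).
  rewrite /J /= (derive_parameter_integral dO2 _ gG J0_e).
  by apply: eq_Rintegral => t _; rewrite mxE.
(* The product rule for [W] turns [grad2 eta + grad3 eta'] into [(grad2 - grad3') eta + W']. *)
have -> : \int[mu]_(t in `[al e,
  be e]) 'D_(delta_mx 0 ord0) (G e) (pair_rV 0 t) =
    \int[mu]_(t in `[al e, be e])
      (\sum_j euler_net j e (const_mx t) * en j e (const_mx t) +
       D0 (W e) (const_mx t)).
  apply: eq_Rintegral => t /set_mem/=; rewrite in_itv/= => tab.
  have Ot := O3e t tab.
  rewrite (derive_path2 Ot.2 (O2e t tab)) (derive_W Ot) -big_split.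
  by apply: eq_bigr => j _; rewrite /= /euler_net; ring.
have iS := continuous_on_integrable (cont _ gS).
have iW := continuous_on_integrable (cont _ gDW).
have dW t : al e <= t <= be e ->
    is_derive t 1 (fun t => W e (const_mx t)) (D0 (W e) (const_mx t)).
  move=> tab; apply: is_derive_const_mx.
  exact: gsnet_differentiable gW (O3e t tab).
rewrite RintegralD// (Rintegral_derive abe dW (cont _ gDW)).
by rewrite opprD addrA subrr add0r opprB.
Unshelve. all: by end_near. Qed.

End TestFunction.
End FirstVariation.

(** * The fundamental lemma *)

Section Peak.
Context {R : realType}.
Local Notation mu := (@lebesgue_measure R).

(** The cube of a Cauchy kernel of width [1 / k] centred at [t0], times a quadratic weight that
    vanishes at both ends. *)
Definition peak (al be t0 k t : R) : R :=
  (t - al) * (be - t) * ((1 + ((t - t0) * k) ^+ 2)^-1) ^+ 3.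

Lemma peak_continuous al be t0 k t : {for t, continuous (peak al be t0 k)}.
Proof.
apply: differentiable_continuous; apply/derivable1_diffP.
have p0 : 1 + ((t - t0) * k) ^+ 2 != 0 by rewrite gt_eqF// ltr_pwDl// sqr_ge0.
rewrite (_ : peak al be t0 k = (fun t => t - al) * (fun t => be - t) *
  (fun t => (1 + ((t - t0) * k) ^+ 2)^-1) ^+ 3); last first.
  by apply/funext => s; rewrite /peak.
apply: derivableM; first by apply: derivableM; exact: ex_derive.
apply: derivableX; apply: derivableV => //; exact: ex_derive.
Qed.

Lemma kernel_le (x y : R) : 0 < y -> 1 <= x * y ^+ 2 -> x^-1 <= y ^+ 2.
Proof.
move=> y0 xy; have y2 : 0 < y ^+ 2 by rewrite exprn_gt0.
have x0 : 0 < x by rewrite -(pmulr_lgt0 x y2); apply: lt_le_trans xy.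
by rewrite -[x^-1]mul1r ler_pdivrMr// mulrC.
Qed.

(* The kernel [peak] has mass at least [h ^ 4 / 16], of which only a fraction
   of order [h ^ 6] lies at distance more than [h] from [t0]. *)
Lemma peak_estimate (al be t0 h k A : R) (f : R -> R) :
  0 < h <= 2^-1 -> k * h ^+ 2 = 1 -> al + h <= t0 <= be - h -> 0 <= A ->
  continuous_on al be f ->
  (forall t, al <= t <= be -> `|f t| <= A) ->
  (forall t, al <= t <= be -> `|t - t0| <= h ->
    `|f t - f t0| <= A * `|t - t0|) ->
  `|f t0| * h ^+ 4 <= 16 * (`|\int[mu]_(t in `[al,
    be]) (f t * peak al be t0 k t)|
     + 2 * A * h ^+ 6 * (be - al) ^+ 3) + A * h ^+ 5.
Proof.
move=> /andP[h0 h1] kh /andP[t0a t0b] A0 cf fA fL.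
pose p := peak al be t0 k; pose L := be - al.
pose H t := (1 + ((t - t0) * k) ^+ 2)^-1.
have albe : al < be by lra.
have A2 : 0 <= 2 * A by rewrite mulr_ge0.
have L0 : 0 < L by rewrite /L; lra.
have k0 : 0 < k.
  by rewrite -(pmulr_lgt0 k (exprn_gt0 2 h0)) kh.
have H1 t : 1 <= 1 + ((t - t0) * k) ^+ 2 by rewrite lerDl sqr_ge0.
have H0 t : 0 < H t by rewrite invr_gt0 (lt_le_trans _ (H1 t)).
have cp : continuous_on al be p by move=> t _; exact: peak_continuous.
have w0 t : al <= t <= be -> 0 <= (t - al) * (be - t) <= L ^+ 2.
  move=> /andP[t1 t2]; apply/andP; split; first by rewrite mulr_ge0; lra.
  by rewrite expr2 ler_pM /L; lra.
have p0 t : al <= t <= be -> 0 <= p t.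
  by move=> /w0/andP[w0t _]; apply: mulr_ge0 => //; exact/exprn_ge0/ltW/H0.
have cst_on c : continuous_on al be (fun=> c) by move=> t _;
  exact: cst_continuous.
have contM f1 f2 : continuous_on al be f1 -> continuous_on al be f2 ->
    continuous_on al be (fun t => f1 t * f2 t).
  by move=> c1 c2 t tab; apply: continuousM; [exact: c1|exact: c2].
have contD f1 f2 : continuous_on al be f1 -> continuous_on al be f2 ->
    continuous_on al be (fun t => f1 t + f2 t).
  by move=> c1 c2 t tab; apply: continuousD; [exact: c1|exact: c2].
pose D := \int[mu]_(t in `[al, be]) p t.
(* Only [[t0, t0 + h ^ 2]] is used: there the weight is at least [h ^ 2 / 2] and the kernel at least
   [1 / 2], whose cube brings the factor [1 / 8]. *)
have Dge : h ^+ 4 / 16 <= D.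
  have h2h : h ^+ 2 <= h / 2 by rewrite expr2 ler_pM2l//; lra.
  have c1 : continuous_on t0 be p by apply: continuous_on_sub cp => //; lra.
  rewrite /D (@Rintegral_itv_split _ al t0)//; last by apply/andP; split; lra.
  have h20 : 0 < h ^+ 2 by rewrite exprn_gt0.
  rewrite (@Rintegral_itv_split _ t0 (t0 + h ^+ 2) be)//; last by apply/andP;
    split; lra.
  have i1 : 0 <= \int[mu]_(t in `[al, t0]) p t.
    by apply: Rintegral_ge0 => t /=; rewrite in_itv/= => /andP[? ?]; apply: p0;
      apply/andP; split; lra.
  have i3 : 0 <= \int[mu]_(t in `[t0 + h ^+ 2, be]) p t.
    by apply: Rintegral_ge0 => t /=; rewrite in_itv/= => /andP[? ?]; apply: p0;
      apply/andP; split; lra.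
  have sum3 (x y z c : R) : 0 <= x -> 0 <= z -> c <= y ->
    c <= x + (y + z) by lra.
  apply: sum3 => //.
  have -> : h ^+ 4 / 16 = \int[mu]_(t in `[t0, t0 + h ^+ 2]) (h ^+ 2 / 16).
    by rewrite Rintegral_itv_cst; [field|lra].
  apply: le_Rintegral => //.
  - apply: (@continuous_on_integrable _ _ _ (fun=> h ^+ 2 / 16)) => t _;
    exact: cst_continuous.
  - by apply: continuous_on_integrable; apply: continuous_on_sub cp => //; lra.
  move=> t /=; rewrite in_itv/= => /andP[t1 t2].
  have w1 : h ^+ 2 / 2 <= (t - al) * (be - t).
    have -> : h ^+ 2 / 2 = h * (h / 2) by field.
    by apply: ler_pM; lra.
  have x1 : ((t - t0) * k) ^+ 2 <= 1.
    rewrite exprn_ile1// ?mulr_ge0 ?(ltW k0)//; first lra.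
    by rewrite -kh mulrC ler_pM2l//; lra.
  have Hge : 2^-1 <= H t.
    by rewrite lef_pV2 ?posrE//; [lra|rewrite (lt_le_trans _ (H1 t))].
  have H3 : (2^-1) ^+ 3 <= H t ^+ 3 by rewrite lerXn2r ?nnegrE// ltW.
  have -> : h ^+ 2 / 16 = (h ^+ 2 / 2) * (2^-1) ^+ 3 by field.
  by rewrite ler_pM ?exprn_ge0// divr_ge0// ltW.
(* Since [k * h ^ 2 = 1], beyond distance [h] the square in the denominator exceeds [k], which is
   the inverse of [h ^ 2]. *)
have far t : al <= t <= be -> h < `|t - t0| -> p t <= L ^+ 2 * h ^+ 6.
  move=> tab th; have /andP[w1 w2] := w0 t tab.
  have Hh : H t <= h ^+ 2.
    apply: kernel_le => //.
    have E : ((t - t0) * k) ^+ 2 * h ^+ 2 = k * `|t - t0| ^+ 2.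
      rewrite real_normK ?num_real// exprMn.
      have -> : (t - t0) ^+ 2 * k ^+ 2 * h ^+ 2 = k * (k * h ^+ 2) * (t - t0) ^+
        2 by ring.
      by rewrite kh mulr1.
    rewrite mulrDl mul1r E -[X in X <= _]kh.
    have : k * h ^+ 2 <= k * `|t - t0| ^+ 2.
      by rewrite ler_pM2l// lerXn2r ?nnegrE// ltW.
    by have := sqr_ge0 h; lra.
  have -> : h ^+ 6 = (h ^+ 2) ^+ 3 by rewrite -exprM.
  by rewrite ler_pM ?exprn_ge0 ?(ltW (H0 t))// lerXn2r ?nnegrE ?(ltW (H0 t))//
    exprn_ge0// ltW.
have pt t : al <= t <= be ->
  `|(f t - f t0) * p t| <= A * h * p t + 2 * A * h ^+ 6 * L ^+ 2.
  move=> tab; rewrite normrM (ger0_norm (p0 t tab)).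
  have pt0 := p0 t tab.
  have c0 : 0 <= 2 * A * h ^+ 6 * L ^+ 2.
    exact: mulr_ge0 (mulr_ge0 A2 (ltW (exprn_gt0 6 h0))) (ltW (exprn_gt0 2 L0)).
  have [th|th] := leP `|t - t0| h.
    have : `|f t - f t0| * p t <= A * h * p t.
      rewrite ler_wpM2r//; apply: le_trans (fL t tab th) _.
      by rewrite ler_wpM2l.
    lra.
  have t0ab : al <= t0 <= be by apply/andP; split; lra.
  have ff : `|f t - f t0| <= 2 * A.
    apply: (le_trans (ler_normB _ _)); have := fA t tab; have := fA t0 t0ab;
      lra.
  have : `|f t - f t0| * p t <= (2 * A) * (L ^+ 2 * h ^+ 6).
    by rewrite ler_pM// far.
  have : 0 <= A * h * p t.
    by apply: mulr_ge0 => //; apply: mulr_ge0 => //; exact: ltW.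
  lra.
set nu := \int[mu]_(t in `[al, be]) _.
(* Splitting off [f t0 * D] leaves an integrand that is small near [t0] by the Lipschitz bound and
   far from it by the decay of the kernel. *)
have nuE : nu = \int[mu]_(t in `[al, be]) ((f t - f t0) * p t) + f t0 * D.
  rewrite /D -RintegralZl//; last exact: continuous_on_integrable.
  rewrite -RintegralD//.
  - by apply: eq_Rintegral => t _; rewrite -/p; ring.
  - by apply: continuous_on_integrable; apply: contM => //; apply: contD.
  - by apply: continuous_on_integrable; apply: contM.
have rest : `|\int[mu]_(t in `[al, be]) ((f t - f t0) * p t)| <=
    A * h * D + 2 * A * h ^+ 6 * L ^+ 2 * L.
  have ci : continuous_on al be (fun t => (f t - f t0) * p t).
    by apply: contM => //; apply: contD.
  apply: (le_trans (le_normr_Rintegral _ (continuous_on_integrable ci))) => //.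
  rewrite /D -RintegralZl//; last exact: continuous_on_integrable.
  rewrite -(Rintegral_itv_cst _ (ltW albe)) -RintegralD//.
  - apply: le_Rintegral => //.
    + apply: (@continuous_on_integrable _ _ _ (fun t =>
      `|(f t - f t0) * p t|)) => t tab.
      exact: (@continuous_comp _ _ _ (fun t => (f t - f t0) * p t) (fun y : R =>
        `|y|) t (ci t tab) (@norm_continuous _ R _)).
    + by apply: (@continuous_on_integrable _ _ _ (fun t =>
      A * h * p t + 2 * A * h ^+ 6 * L ^+ 2)); apply: contD => //; apply: contM.
  - by apply: (@continuous_on_integrable _ _ _ (fun t => A * h * p t));
    apply: contM.
  - exact: (@continuous_on_integrable _ _ _ (fun=> 2 * A * h ^+ 6 * L ^+ 2)).
have D0 : 0 < D by apply: lt_le_trans Dge; rewrite divr_gt0// exprn_gt0.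
have main : `|f t0| * D <= `|nu| + (A * h * D + 2 * A * h ^+ 6 * L ^+ 2 * L).
  have -> : `|f t0| * D = `|nu - \int[mu]_(t in `[al,
    be]) ((f t - f t0) * p t)|.
    by rewrite nuE addrC addKr normrM (gtr0_norm D0).
  by apply: (le_trans (ler_normB _ _)); rewrite lerD2l.
rewrite -/L; clearbody nu D L.
have c0 : 0 <= `|nu| + 2 * A * h ^+ 6 * L ^+ 3.
  apply: addr_ge0 => //.
  exact: mulr_ge0 (mulr_ge0 A2 (ltW (exprn_gt0 6 h0))) (ltW (exprn_gt0 3 L0)).
(* [D] occurs on both sides of [main], and only a lower bound for it is known. Replacing it by that
   bound needs [|f t0| - A * h] to be nonnegative; in the other case the term [A * h ^ 5] alone
   suffices. *)
have [small|big] := leP `|f t0| (A * h).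
  have : `|f t0| * h ^+ 4 <= A * h * h ^+ 4 by rewrite ler_wpM2r// exprn_ge0//
    ltW.
  have -> : A * h * h ^+ 4 = A * h ^+ 5 by ring.
  lra.
have : (`|f t0| - A * h) * (h ^+ 4 / 16) <= (`|f t0| - A * h) * D.
  by rewrite ler_wpM2l// subr_ge0 ltW.
have -> : (`|f t0| - A * h) * (h ^+ 4 / 16) = (`|f t0| * h ^+ 4 - A * h ^+ 5) /
  16 by field.
have -> : (`|f t0| - A * h) * D = `|f t0| * D - A * h * D by ring.
move: main; have -> : 2 * A * h ^+ 6 * L ^+ 2 * L = 2 * A * h ^+ 6 * L ^+ 3 by
  ring.
lra.
Qed.

(** [A ^ 4] arises from [A * L ^ 3]. The three terms give at most 16, 16 and 1 copies of
    [A ^ 4 * h ^ 5], which 49 covers. *)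
Lemma peak_consequence (X nu h A L : R) : 0 < h <= 2^-1 -> 1 <= A ->
  0 <= L -> L <= A -> nu <= h ^+ 5 ->
  X * h ^+ 4 <= 16 * (nu + 2 * A * h ^+ 6 * L ^+ 3) + A * h ^+ 5 ->
  X <= 49 * (A ^+ 4 * h).
Proof.
move=> /andP[h0 h1] A1 L0 LA nuh Xh.
have h4 : 0 < h ^+ 4 by rewrite exprn_gt0.
have L3 : L ^+ 3 <= A ^+ 3 by rewrite lerXn2r ?nnegrE//; lra.
rewrite -(ler_pM2r h4); apply: (le_trans Xh).
have e5 : 0 < h ^+ 5 by rewrite exprn_gt0.
have A4 : 1 <= A ^+ 4 by rewrite exprn_ege1.
have AA4 : A <= A ^+ 4 by rewrite ler_eXnr.
have A0 : 0 <= A by lra.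
have t1 : 2 * A * h ^+ 6 * L ^+ 3 <= A ^+ 4 * h ^+ 5 * (2 * h).
  have -> : A ^+ 4 * h ^+ 5 * (2 * h) = 2 * A * h ^+ 6 * A ^+ 3 by ring.
  apply: ler_wpM2l L3; apply: mulr_ge0; [lra|exact/exprn_ge0/ltW].
have t2 : A ^+ 4 * h ^+ 5 * (2 * h) <= A ^+ 4 * h ^+ 5.
  apply: ler_piMr; [apply: mulr_ge0; [lra|exact: ltW]|lra].
have t3 : h ^+ 5 <= A ^+ 4 * h ^+ 5 by rewrite ler_peMl// ltW.
have t4 : A * h ^+ 5 <= A ^+ 4 * h ^+ 5 by rewrite ler_wpM2r// ltW.
have -> : 49 * (A ^+ 4 * h) * h ^+ 4 = 49 * (A ^+ 4 * h ^+ 5) by ring.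
have s4 : 0 <= A ^+ 4 * h ^+ 5 by lra.
move: t1 t2 t3 t4 s4 nuh; move: (2 * A * h ^+ 6 * L ^+ 3) (A ^+ 4 * h ^+ 5 * (2
  * h)).
move: (A ^+ 4 * h ^+ 5) (A * h ^+ 5) (h ^+ 5) => *; lra.
Qed.

End Peak.

(** * Peaks as test functions, and the two implications *)

Section FundamentalLemma.
Context {R : realType} {rho : gauge R}.
Local Notation K := (gnum rho).
Local Notation mu := (@lebesgue_measure R).

(** The derivative of the inverse [H] is [- H ^ 2] times a derivative of the denominator, so [H] and
    the smooth nets generate a class closed under derivation; [H] is moderate because the
    denominator is at least [1]. *)
Lemma gsnet_inv1sqr n (X : set 'rV[K]_n) O p : gdomain X O -> gsnet X O p ->
  gsnet X O (fun e x => (1 + p e x ^+ 2)^-1).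
Proof.
move=> dO gp.
pose q e x := 1 + p e x ^+ 2.
have gq : gsnet X O q.
  apply: gsnetD => //; first exact: (gsnet_cst dO (moderate_cst 1)).
  exact: gsnetX.
have q1 e x : 1 <= q e x by rewrite lerDl sqr_ge0.
have q0 e x : q e x != 0 by rewrite gt_eqF// (lt_le_trans _ (q1 e x)).
pose H e x := (q e x)^-1.
pose B h := gsnet X O h \/ h = H.
apply: (@generated_gsnet _ _ _ B X O dO); last by apply: generated_base; right.
move=> h [gh|->].
  have [dh mh _] := gsnet_base dO gh; split => // i.
  exists (fun e => 'D_(delta_mx 0 i) (h e)) => //.
  by apply: generated_base; left; exact: gsnet_derive.
split.
- move=> e x Ox; apply: differentiableV => //;
  exact: gsnet_differentiable gq Ox.
- move=> c v Xc vc; apply: moderate_near_le (moderate_cst 1).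
  apply: nearW => e; rewrite normr1 ger0_norm; last first.
    by rewrite invr_ge0 (le_trans _ (q1 _ _)).
  by rewrite invf_le1 ?(lt_le_trans _ (q1 _ _)).
- move=> i; exists (fun e x =>
  -1 * (H e x * H e x) * 'D_(delta_mx 0 i) (q e) x).
    apply: generated_mul; last by apply: generated_base; left;
      exact: gsnet_derive.
    apply: generated_mul; first exact: (generated_cst _ (moderate_cst (-1))).
    by apply: generated_mul; apply: generated_base; right.
  move=> e x Ox; rewrite [LHS]deriveV//.
    by rewrite /H -exprVn expr2 mulN1r.
  exact: diff_derivable (gsnet_differentiable gq Ox).
Qed.

Variables (d : nat) (a b : K).
Variables (F : K -> 'rV[K]_d -> 'rV[K]_d -> K) (u : K -> 'rV[K]_d).
Variables (OF : R -> set 'rV[R]_(1 + (d + d))) (Fn : R ->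
  'rV[R]_(1 + (d + d)) -> R).
Variables (Ou : R -> set 'rV[R]_1) (un : 'I_d -> R -> 'rV[R]_1 -> R).
Hypothesis ab : glt a b.
Hypothesis hF : represents (lagr_dom a b) (uncurried F) OF (fun _ : 'I_1 => Fn).
Hypothesis hu : represents (line (gitv a b)) (on_line u) Ou un.
Local Notation X1 := (line (gitv a b)).
Local Notation XT := (line (setT : set K)).

Let al : R -> R := mnet_fun (repr a).
Let be : R -> R := mnet_fun (repr b).
Let ala : is_repr al a := is_repr_repr a.
Let beb : is_repr be b := is_repr_repr b.

Let euler j e x := euler_net Fn un j e x.
Let O1 := curve_domain OF Ou un.

Let gdomain_euler : gdomain X1 O1.
Proof. by case: (grad2_represents ab hF hu). Qed.

Let geuler j : gsnet X1 O1 (euler j).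
Proof. exact (gsnet_euler ab hF hu j). Qed.

Lemma euler_lagrange_negligible ta j : euler_lagrange a b F u ->
  (\forall e \near 0^'+, al e <= ta e <= be e) ->
  negligible rho (fun e => euler j e (const_mx (ta e))).
Proof.
move=> EL tab; have [tt gt] := interval_gitv ala beb tab.
apply/is_repr0E; have := euler_repr ab hF hu j gt tt.
by rewrite (EL _ gt) mxE.
Qed.

(** The integrand of [first_variation_repr] is negligible along every net of points of the interval,
    hence so is its integral. *)
Lemma euler_lagrange_critical : euler_lagrange a b F u ->
  critical_point a b F u.
Proof.
move=> EL eta [[_ [Q [fe /defines_represents heta]]] etaa etab].
set en := (fun j e x => fe e x 0 j) in heta.
have heta1 : represents X1 (on_line eta) (cut_domain Q) en.
  exact: represents_sub heta.
have r := first_variation_repr ab hF hu heta etaa etab ala beb.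
apply: (is_repr_fun_eq r); apply/is_repr0E.
have dI : gdomain X1 (fun e => O1 e `&` cut_domain Q e).
  by apply: gdomainI => //; case: heta1.
have gen j : gsnet X1 (fun e => O1 e `&` cut_domain Q e) (en j).
  by case: heta1 => _ /(_ j) + _; apply: gsnet_subdomain => // e x [].
have ge j : gsnet X1 (fun e => O1 e `&` cut_domain Q e) (euler j).
  by apply: gsnet_subdomain (geuler j) => // e x [].
have gS : gsnet X1 (fun e => O1 e `&` cut_domain Q e)
    (fun e x => \sum_j euler j e x * en j e x).
  by apply: gsnet_sum => // j; exact: gsnetM.
move: dI gS; rewrite line_slab => dI gS.
apply: (integral_negligible ab ala beb).
  exact: (gsnet_continuous_on ab dI gS ala beb).
move=> ta tab; apply: negligible_sum => j _.
under eq_fun do rewrite mulrC.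
apply: negligibleM; last exact: euler_lagrange_negligible.
have [vv sv] := const_slab_vrepr ala beb tab.
by rewrite -line_slab in sv; exact: gsnet_moderate (gen j) _ _ sv vv.
Qed.

Section Converse.
Hypothesis crit : critical_point a b F u.
Variable j0 : 'I_d.

Section PeakTest.
Variables (t0 k : R -> R).
Hypotheses (mt0 : moderate rho t0) (mk : moderate rho k).

Definition peak_net e (x : 'rV[R]_1) := peak (al e) (be e) (t0 e) (k e) (x 0 0).

Lemma gsnet_peak : gsnet XT (fun=> setT) peak_net.
Proof.
have dT := gdomainT XT.
have gx : gsnet XT (fun=> setT) (fun _ x => x 0 0) by exact: gsnet_coord.
have gc c : moderate rho c ->
  gsnet XT (fun=> setT) (fun e _ => c e) by exact: gsnet_cst.
have gH : gsnet XT (fun=> setT) (fun e x =>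
  (1 + ((x 0 0 - t0 e) * k e) ^+ 2)^-1).
  apply: gsnet_inv1sqr => //; apply: gsnetM => //; last exact: gc.
  by apply: gsnetB => //; exact: gc.
have gw : gsnet XT (fun=> setT) (fun e x => (x 0 0 - al e) * (be e - x 0 0)).
  apply: gsnetM => //.
    by apply: gsnetB => //; apply: gc; case: ala.
  by apply: gsnetB => //; apply: gc; case: beb.
rewrite /peak_net /peak.
exact (gsnetM dT gw (gsnetX 3 dT gH)).
Qed.

(** A map on generalized numbers has to choose a representative; [gsnet_repr_indep] makes the choice
    immaterial. The single nonzero component isolates one of the Euler-Lagrange equations. *)
Definition peak_test (t : K) : 'rV[K]_d :=
  \row_j if j == j0 then gclass rho (fun e =>
    peak_net e (const_mx (mnet_fun (repr t) e))) else 0.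

Let en j e x := if j == j0 then peak_net e x else 0.

Lemma peak_test_represents : represents XT (on_line peak_test) (fun=> setT) en.
Proof.
have dT := gdomainT XT; split => // [j|c v Xc vc j].
  rewrite /en; case: (j == j0); first exact: gsnet_peak.
  exact: (gsnet_cst dT (moderate_cst 0)).
rewrite /on_line /en mxE; case: (j == j0); last exact: is_repr0.
have v0 : is_vrepr (fun e => const_mx (mnet_fun (repr (c 0 0)) e) : 'rV[R]_1) c.
  have := const_mx_vrepr (is_repr_repr (c 0 0)).
  by congr (is_vrepr _ _); apply/rowP => i; rewrite mxE ord1.
have m0 := gsnet_moderate gsnet_peak Xc v0.
apply: (is_repr_negligible (gclass_is_repr m0)).
exact: gsnet_repr_indep dT gsnet_peak Xc v0 vc.
Qed.

Lemma peak_test_fun : test_fun a b peak_test.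
Proof.
have [dT gT rT] := peak_test_represents.
have vanish c ta : is_repr ta c ->
  (forall e, peak_net e (const_mx (ta e)) = 0) ->
    peak_test c = 0.
  move=> tc p0; apply/rowP => j.
  have := rT _ _ I (const_mx_vrepr tc) j.
  rewrite /on_line [X in peak_test X]mxE [RHS]mxE => r.
  apply: (is_repr_fun_eq r); apply: (is_repr_near is_repr0).
  by apply: nearW => e; rewrite /en; case: ifP => // _; exact: p0.
split.
- split => //; exists (fun=> setT), (fun e x => \row_j en j e x).
  exact: represents_defines peak_test_represents.
- by apply: (vanish _ _ ala) => e; rewrite /peak_net /peak mxE subrr !mul0r.
- by apply: (vanish _ _ beb) => e;
  rewrite /peak_net /peak mxE subrr mulr0 !mul0r.
Qed.

Lemma peak_integral_negligible : negligible rho (fun e =>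
  \int[mu]_(t in `[al e, be e])
    (euler j0 e (const_mx t) * peak (al e) (be e) (t0 e) (k e) t)).
Proof.
have [_ etaa etab] := peak_test_fun.
have r := first_variation_repr ab hF hu peak_test_represents etaa etab ala beb.
rewrite (crit peak_test_fun) in r; move/is_repr0E : r.
apply: negligible_near_eq; apply: nearW => e; apply: eq_Rintegral => t _.
rewrite (bigD1 j0)//= big1 ?addr0 => [|j jj0].
  by rewrite /en eqxx /peak_net mxE.
by rewrite /en (negbTE jj0) mulr0.
Qed.

End PeakTest.

Let dist_triangle (x y z h : R) : `|x - y| <= h -> `|y - z| <= h -> h <= 2^-1 ->
  `|x - z| <= 1.
Proof.
by move=> xy yz h1; rewrite -(subrKA y); apply: (le_trans (ler_normD _ _)); lra.
Qed.

Let rho_le1 (r : R) : r <= 50^-1 -> r <= 1.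
Proof. by move=> r50; lra. Qed.

Let small_step (h x y a' b' : R) : h <= y -> y <= x * 50^-1 -> 0 <= x ->
  x <= 1 ->
  a' + x <= b' -> h <= 2^-1 /\ a' + 2 * h <= b'.
Proof. by move=> *; split; lra. Qed.

Let bound_combine (x y z v c r : R) : `|x - y| <= v -> v <= z -> z <= c ->
  `|y| <= 49 * c -> c <= r * 50^-1 -> `|x| <= r.
Proof.
have := ler_normD (x - y) y; rewrite subrK; lra.
Qed.

Lemma euler_negligible ta : (\forall e \near 0^'+, al e <= ta e <= be e) ->
  negligible rho (fun e => euler j0 e (const_mx (ta e))).
Proof.
move=> tab.
have [vv sv] := const_slab_vrepr ala beb tab.
have dO : gdomain (slab a b (xpredT : pred 'I_1)) O1 by rewrite -line_slab.
have gE : gsnet (slab a b (xpredT : pred 'I_1)) O1 (euler j0) by rewrite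
  -line_slab.
have boxE (e t : R) : al e <= t <= be e ->
  box al be (xpredT : pred 'I_1) e (const_mx t).
  by move=> H i _; rewrite mxE.
have bw : \forall e \near 0^'+,
  box al be (xpredT : pred 'I_1) e (const_mx (ta e)).
  by apply: filterS tab => e; exact: boxE.
have [N1 HN1] := near_box_lipschitz ala beb vv bw dO (fun _ : 'I_1 => gE).
have [N2 HN2] := @uniform_moderate R rho R (fun e =>
  [set t | al e <= t <= be e])
  (fun e t => euler j0 e (const_mx t)) al (near_interval ab ala beb)
  (fun tau => gsnet_interval_moderate gE ala beb).
have [N3 HN3] := (moderateE _).1 (moderate_length ala beb).
have [g Hg] := gap_lt ab ala beb.
(* One exponent for the Lipschitz constant, the size of the Euler-Lagrange net and the length of the
   interval. *)
pose N := (N1 + N2 + N3)%N.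
apply/negligibleE => m.
(* [4 * N] cancels the factor [A ^ 4] of [peak_consequence], [m] is the order wanted, [g] fits
   [2 * h] into the interval, and the surplus absorbs the numerical constants. *)
pose q := (4 * N + (m + g + 2))%N.
pose h e := rho e ^+ q.
(* The peak must stay at distance [h] from both ends, so the point is moved inwards by at most [h];
   the Lipschitz bound carries the estimate back to [ta]. *)
pose t1 e := Num.max (al e + h e) (Num.min (be e - h e) (ta e)).
(* 50 is the 49 of [peak_consequence] plus one for the way back from [t1] to [ta]. *)
have small : \forall e \near 0^'+, [/\ 0 < rho e, rho e <= 50^-1,
    0 < h e, h e <= 2^-1 & al e + 2 * h e <= be e].
  near=> e.
  have /andP[r0 /ltW r1] : 0 < rho e < 50^-1 by near: e; apply: gauge_near.
  have Hg_e : al e + rho e ^+ g <= be e by near: e.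
  have r1' : rho e <= 1 := rho_le1 r1.
  have hr : h e <= rho e ^+ g * rho e.
    rewrite -exprSr /h /q ler_wiXn2l ?(ltW r0)//.
    by apply: leq_trans (leq_addl (4 * N)%N _);
      rewrite addn2 ltnS leqW// leq_addl.
  have rg0 : 0 < rho e ^+ g by rewrite exprn_gt0.
  have rg1 : rho e ^+ g <= 1 by rewrite exprn_ile1 ?(ltW r0).
  have rg50 : rho e ^+ g * rho e <= rho e ^+ g * 50^-1 by rewrite ler_pM2l.
  have [h2 h3] := small_step hr rg50 (ltW rg0) rg1 Hg_e.
  by split => //; exact: exprn_gt0.
have t1P : \forall e \near 0^'+, al e + h e <= t1 e <= be e - h e /\
    `|t1 e - ta e| <= h e.
  near=> e.
  have [r0 r1 h0 h1 hab] : [/\ 0 < rho e, rho e <= 50^-1,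
    0 < h e, h e <= 2^-1 & al e + 2 * h e <= be e] by near: e.
  have /andP[ta1 ta2] : al e <= ta e <= be e by near: e.
  rewrite /t1; have [c1|c1] := leP (be e - h e) (ta e).
    rewrite max_r; last lra.
    by split; [apply/andP; split; lra|rewrite ler_norml; apply/andP; split;
      lra].
  have [c2|c2] := leP (al e + h e) (ta e).
    by split; [apply/andP; split; lra|rewrite subrr normr0 ltW].
  by split; [apply/andP; split; lra|rewrite ler_norml; apply/andP; split; lra].
have t1ab : \forall e \near 0^'+, al e <= t1 e <= be e.
  near=> e.
  have [r0 r1 h0 h1 hab] : [/\ 0 < rho e, rho e <= 50^-1,
    0 < h e, h e <= 2^-1 & al e + 2 * h e <= be e] by near: e.
  have [/andP[c1 c2] _] : al e + h e <= t1 e <= be e - h e /\ `|t1 e - ta e| <=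
    h e.
    by near: e.
  by apply/andP; split; lra.
have [[mt1 _] _] := interval_gitv ala beb t1ab.
(* This value of [k] is the inverse of [h ^ 2]; the accuracy [5 * q] asked for next is [h ^ 5], one
   order better than the mass of the peak. *)
have mk : moderate rho (fun e => rho e ^- (2 * q)) by exact: moderate_rhoV.
have /negligibleE/(_ (5 * q)%N) nu_small := peak_integral_negligible mt1 mk.
have cE := gsnet_continuous_on ab dO gE ala beb.
near=> e.
have [r0 r1 h0 h1 hab] : [/\ 0 < rho e, rho e <= 50^-1,
    0 < h e, h e <= 2^-1 & al e + 2 * h e <= be e] by near: e.
have r1' : rho e <= 1 := rho_le1 r1.
have [t1e t1t] : al e + h e <= t1 e <= be e - h e /\ `|t1 e - ta e| <= h e by
  near: e.
have ta_e : al e <= ta e <= be e by near: e.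
have t1ab_e : al e <= t1 e <= be e by near: e.
have HN1_e : forall (j : 'I_1) y z, near_box al be xpredT (fun e =>
  const_mx (ta e)) e y ->
    near_box al be xpredT (fun e => const_mx (ta e)) e z ->
    `|euler j0 e z - euler j0 e y| * rho e ^+ N1 <= \sum_i `|z 0 i - y 0 i| by
      near: e.
have HN2_e : forall t, al e <= t <= be e ->
    `|euler j0 e (const_mx t)| * rho e ^+ N2 <= 1 by near: e.
have HN3_e : `|be e - al e| * rho e ^+ N3 <= 1 by near: e.
have cE_e : continuous_on (al e) (be e) (fun t =>
  euler j0 e (const_mx t)) by near: e.
have nu_e : `|\int[mu]_(t in `[al e, be e]) (euler j0 e (const_mx t) *
    peak (al e) (be e) (t1 e) (rho e ^- (2 * q)) t)| <= rho e ^+ (5 * q) by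
      near: e.
pose A := rho e ^- N.
have rN n : 0 < rho e ^+ n by rewrite exprn_gt0.
have A0 : 0 < A by rewrite invr_gt0.
have rNle n : (n <= N)%N -> rho e ^- n <= A.
  by move=> nN; rewrite lef_pV2 ?posrE// ler_wiXn2l// ltW.
have toA n x y : (n <= N)%N -> 0 <= y -> x * rho e ^+ n <= y -> x <= A * y.
  move=> nN y0; rewrite -ler_pdivlMr// => /le_trans; apply.
  by rewrite mulrC ler_wpM2r// rNle.
have fA t : al e <= t <= be e -> `|euler j0 e (const_mx t)| <= A.
  move=> /HN2_e H; rewrite -[A]mulr1; apply: toA H => //.
  by rewrite /N -addnA addnCA leq_addr.
have LA : be e - al e <= A.
  rewrite -[A]mulr1; apply: (toA N3) => //; first by rewrite /N leq_addl.
  move: HN3_e; rewrite ger0_norm// subr_ge0.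
  by case/andP: ta_e; exact: le_trans.
have fL s t : al e <= s <= be e -> al e <= t <= be e -> `|s - ta e| <= 1 ->
  `|t - ta e| <= 1 ->
    `|euler j0 e (const_mx t) - euler j0 e (const_mx s)| <= A * `|t - s|.
  move=> sab tab' s1 t1_; apply: (toA N1) => //;
    first by rewrite /N -addnA leq_addr.
  have := HN1_e 0 (const_mx s) (const_mx t); rewrite big_ord1 !mxE; apply.
    by split; [exact: boxE|move=> j; rewrite !mxE].
  by split; [exact: boxE|move=> j; rewrite !mxE].
have kh : rho e ^- (2 * q) * h e ^+ 2 = 1.
  by rewrite /h -exprM [(q * 2)%N]mulnC mulVf// gt_eqF.
have h01 : 0 < h e <= 2^-1 by rewrite h0 h1.
have fL1 t : al e <= t <= be e -> `|t - t1 e| <= h e ->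
    `|euler j0 e (const_mx t) - euler j0 e (const_mx (t1 e))| <= A * `|t - t1
      e|.
  move=> tab' th; apply: fL => //; last exact: dist_triangle th t1t h1.
  by apply: le_trans t1t _; apply: le_trans h1 _; rewrite invf_le1// ler1n.
have P := peak_estimate h01 kh t1e (ltW A0) cE_e fA fL1.
have A1 : 1 <= A by rewrite invf_ge1// exprn_ile1// ltW.
have h5 : rho e ^+ (5 * q) = h e ^+ 5 by rewrite /h -exprM mulnC.
rewrite h5 in nu_e.
have L0 : 0 <= be e - al e.
  by rewrite subr_ge0; case/andP: ta_e; exact: le_trans.
have X := peak_consequence h01 A1 L0 LA nu_e P.
have Y := fL1 (ta e) ta_e; rewrite distrC in Y.
have {}Y := Y t1t.
have Ch : A ^+ 4 * h e = rho e ^+ (m + g + 2).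
  by rewrite /A /h exprVn -exprM [(N * 4)%N]mulnC /q exprD mulKf// gt_eqF.
have Cm : A ^+ 4 * h e <= rho e ^+ m * 50^-1.
  rewrite Ch addn2 exprSr; apply: ler_pM => //; try exact: ltW.
  by rewrite ler_wiXn2l ?(ltW r0)// leqW// leq_addr.
have A14 : A * h e <= A ^+ 4 * h e.
  by rewrite ler_wpM2r ?(ltW h0)// ler_eXnr.
have A_dist : A * `|t1 e - ta e| <= A * h e by rewrite ler_wpM2l// ltW.
exact: bound_combine Y A_dist A14 X Cm.
Unshelve. all: by end_near. Qed.

Lemma critical_euler_lagrange_coord t : gitv a b t ->
  (grad2 a b F t (u t) (gderiv (gitv a b) u t)
   - gderiv (gitv a b) (fun t' =>
     grad3 a b F t' (u t') (gderiv (gitv a b) u t')) t) 0 j0 = 0.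
Proof.
move=> tab.
have sv : slab a b (xpredT : pred 'I_1) (const_mx t) by move=> i _; rewrite mxE.
(* An arbitrary representative of [t] may leave [[al e, be e]], where nothing is known; a clamped
   one does not for [e] small. *)
have [w wc bw] := slab_box ab ala beb sv (const_mx_vrepr (is_repr_repr t)).
have wt : is_repr (fun e => w e 0 0) t.
  by have /is_vreprP/(_ 0) := wc; rewrite mxE.
apply: (is_repr_fun_eq (euler_repr ab hF hu j0 tab wt)); apply/is_repr0E.
apply: euler_negligible; apply: filterS bw => e; exact.
Qed.

End Converse.
End FundamentalLemma.

Theorem theorem38 (R : realType) (rho : gauge R) (d : nat) (a b : gnum rho)
    (F : gnum rho -> 'rV[gnum rho]_d -> 'rV[gnum rho]_d -> gnum rho)
    (u : gnum rho -> 'rV[gnum rho]_d) :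
  glt a b -> is_lagrangian a b F -> is_GSF_curve (gitv a b) u ->
  (euler_lagrange a b F u <-> critical_point a b F u).
Proof.
move=> ab [_ [OF [fF /defines_represents hF]]] [_ [Ou [fu /defines_represents
  hu]]].
have hF' : represents (lagr_dom a b) (uncurried F) (cut_domain OF)
    (fun _ : 'I_1 => fun e x => fF e x 0 0).
  have E : (fun (j : 'I_1) e x => fF e x 0 j) = (fun=> fun e x => fF e x 0 0).
    by apply/funext => j; rewrite ord1.
  by rewrite E in hF.
split; first exact: (euler_lagrange_critical ab hF' hu).
move=> crit; rewrite /euler_lagrange => t tab.
apply/rowP => j; rewrite [RHS]mxE.
exact (critical_euler_lagrange_coord ab hF' hu crit j tab).
Qed.
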